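(* Let $T=\langle\tau_0,\tau_1,\tau_2,\tau_3\rangle$ be the group of signed permutation matrices on $\mathbb{E}^8$ defined in the context, and let $\mathcal{M}$, $\mathcal{R}$, $\overline{\mathcal{R}}$ and $\mathcal{P}$ be as defined there. Then: (a) $T$ is a string C-group (with respect to $\tau_0,\tau_1,\tau_2,\tau_3$) of order $768$ and with the presentation $$\langle \tau_0,\tau_1,\tau_2,\tau_3 \mid \tau_j^2=(\tau_0\tau_1)^8=(\tau_1\tau_2)^3=(\tau_2\tau_3)^3=1\ (0\le j\le 3),\ (\tau_0\tau_2)^2=(\tau_0\tau_3)^2=(\tau_1\tau_3)^2=((\tau_1\tau_0)^3\tau_1\tau_2)^2=1\rangle .$$ (b) The corresponding regular $4$-polytope $\mathcal{T}$ has type $\{8,3,3\}$ and is faithfully realized in $\mathbb{E}^8$, with base vertex $(1,1,1,1,-1,1,1,1)$. The polytope $\mathcal{T}$ is the minimal regular cover for Roli's cube $\mathcal{R}$ and for its enantiomorph $\overline{\mathcal{R}}$. It is also a double cover of the $4$-cube $\mathcal{P}$. (c) $\mathcal{T}\simeq\{\mathcal{M},\{3,3\}\}$ is the universal regular polytope with facets $\mathcal{M}$ and tetrahedral vertex-figures.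
   Context: Conventions. Matrices act on row vectors from the right, so products are read left to right. Let $b_1,\dots,b_4$ be the standard basis of $\mathbb{E}^4$. $\mathcal{P}$ is the $4$-cube with vertex set $\{\pm1\}^4$ (as an abstract polytope, its face lattice), $G$ the group of all $4\times4$ signed permutation matrices, and $G^+$ its subgroup of elements of determinant $+1$. Define elements of $G^+$ by - $\sigma_1$: $b_1\mapsto -b_4,\ b_2\mapsto b_1,\ b_3\mapsto b_2,\ b_4\mapsto b_3$; - $\sigma_2$: $b_1\mapsto b_2,\ b_2\mapsto b_4,\ b_4\mapsto b_1,\ b_3\mapsto b_3$; - $\sigma_3$: $b_2\mapsto b_4,\ b_4\mapsto b_3,\ b_3\mapsto b_2,\ b_1\mapsto b_1$; and $\bar\sigma_1=\sigma_1^{-1}$, $\bar\sigma_2=\sigma_1^2\sigma_2$, $\bar\sigma_3=\sigma_3$. One has $G^+=\langle\sigma_1,\sigma_2,\sigma_3\rangle=\langle\bar\sigma_1,\bar\sigma_2,\bar\sigma_3\rangle$. The group $T$. On $\mathbb{E}^8=\mathbb{E}^4\oplus\mathbb{E}^4$ let $\kappa_j=(\sigma_j,\bar\sigma_j)$ be the block-diagonal matrix $(x,y)\mapsto(x\sigma_j,y\bar\sigma_j)$, $j=1,2,3$. Let $\tau_0:(x,y)\mapsto(y,x)$, $\tau_1=\tau_0\kappa_1$, $\tau_2=\tau_0\kappa_1\kappa_2$, $\tau_3=\tau_0\kappa_1\kappa_2\kappa_3$, and $T=\langle\tau_0,\tau_1,\tau_2,\tau_3\rangle$. The polytopes $\mathcal{M}$,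 $\mathcal{R}$, $\overline{\mathcal{R}}$. Let $v=(1,1,1,1)$ and let $\mathcal{C}$ be the octagon with successive vertices $v,v\sigma_1,\dots,v\sigma_1^7$ (a Petrie polygon of $\mathcal{P}$). $\mathcal{M}$ is the regular $3$-polytope of type $\{8,3\}$ with vertices the $16$ points of $\{\pm1\}^4$, edges the $24$ images under $\langle\sigma_1,\sigma_2\rangle$ of the edge joining $v$ to $v\sigma_1^{-1}=(-1,1,1,1)$, and $2$-faces the $6$ images of $\mathcal{C}$ under $\langle\sigma_1,\sigma_2\rangle$ (incidence being inclusion). Roli's cube $\mathcal{R}$ is the chiral $4$-polytope of type $\{8,3,3\}$ whose vertices and edges are those of $\mathcal{P}$, whose $2$-faces are the $12$ images of $\mathcal{C}$ under $G^+$, and whose facets are the $4$ images of $\mathcal{M}$ under $G^+$, with incidence given by containment; its automorphism group is $G^+$ and its base vertex, edge, $2$-face and facet have stabilizers $\langle\sigma_2,\sigma_3\rangle$, $\langle\sigma_1\sigma_2,\sigma_3\rangle$, $\langle\sigma_1,\sigma_2\sigma_3\rangle$, $\langle\sigma_1,\sigma_2\rangle$. The enantiomorph $\overline{\mathcal{R}}$ is the chiral $4$-polytope obtained in the same way from the generators $\bar\sigma_1,\bar\sigma_2,\bar\sigma_3$: its faces of ranks $0,1,2,3$ are the right cosets in $G^+$ of $\langle\bar\sigma_2,\bar\sigma_3\rangle$, $\langle\bar\sigma_1\bar\sigma_2,\bar\sigma_3\rangle$, $\langle\bar\sigma_1,\bar\sigma_2\bar\sigma_3\rangle$, $\langle\bar\sigma_1,\bar\sigma_2\rangle$,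 two faces being incident when the cosets intersect. It may be realized in $\mathbb{E}^4$ with base vertex $\bar v=(-1,1,1,1)$. Abstract polytopes. An abstract $n$-polytope is a ranked poset with least face of rank $-1$ and greatest face of rank $n$, whose flags (maximal chains) all have $n+2$ elements, that is strongly flag-connected and satisfies the diamond condition. Two flags are adjacent ($j$-adjacent) if they differ in exactly one face (of rank $j$). A polytope is regular if its automorphism group is transitive on flags, and chiral if there are exactly two flag orbits with adjacent flags always in different orbits. A string C-group of rank 4 is a group generated by involutions $\tau_0,\dots,\tau_3$ with $(\tau_i\tau_j)^2=1$ for $|i-j|\ge2$ and satisfying the intersection condition $\langle\tau_i:i\in I\rangle\cap\langle\tau_j:j\in J\rangle=\langle\tau_k:k\in I\cap J\rangle$ for all $I,J\subseteq\{0,1,2,3\}$. The corresponding regular $4$-polytope has as $j$-faces the right cosets of $T_j=\langle\tau_i:i\ne j\rangle$ $(0\le j\le3)$, with $T_j\alpha\le T_k\beta$ iff $j\le k$ and $T_j\alpha\cap T_k\beta\neq\emptyset$, together with formal faces of ranks $-1$ and $4$. It has type $\{p,q,r\}$, where $p,q,r$ are the orders of $\tau_0\tau_1,\tau_1\tau_2,\tau_2\tau_3$. Realization. $\mathcal{T}$ is realized in $\mathbb{E}^8$ by Wythoff's construction: the vertices are the points of the $T$-orbit of the base vertex, which is fixed by $\langle\tau_1,\tau_2,\tau_3\rangle$, the vertex $T_0\alpha$ being represented by the image of the base vertex under $\alpha$; inductively, each $j$-face is represented by the family of the representatives of its $(j-1)$-faces. The realization is faithful if distinct faces of the same rank are represented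 by distinct objects. Covers. A covering of one $n$-polytope by another is a surjection of posets preserving rank, order and adjacency of flags ($j$-adjacent flags go to distinct $j$-adjacent flags). A regular cover of a polytope $\mathcal{Q}$ is a regular polytope covering $\mathcal{Q}$; it is minimal if every regular polytope that it covers and that itself covers $\mathcal{Q}$ is isomorphic to it. ''The'' minimal regular cover means that it is the unique minimal one up to isomorphism. A double cover is a covering that is two-to-one on flags. The universal regular polytope $\{\mathcal{M},\{3,3\}\}$ is the regular $4$-polytope with facets isomorphic to $\mathcal{M}$ and vertex-figures isomorphic to the tetrahedron $\{3,3\}$ which covers every regular $4$-polytope with such facets and vertex-figures. *)

(* Defs.v *)
From mathcomp Require Import all_boot all_order all_algebra all_fingroup.
From mathcomp Require Import boolp classical_sets functions cardinality reals.

Set Implicit Arguments.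
Unset Strict Implicit.
Unset Printing Implicit Defensive.

Import Order.TTheory GRing.Theory Num.Theory.
Local Open Scope classical_set_scope.
Local Open Scope card_scope.
Local Open Scope ring_scope.

(** * Groups of units of a ring, string C-groups and presentations *)

(* Subgroups of the group of units of [A]; matrices act on row vectors, so that
   the ring product of matrices is composition read from left to right. *)
Definition subgroup (A : unitRingType) (H : set A) : Prop :=
  [/\ H `<=` [set x | x \is a GRing.unit],
      H 1,
      forall x y, H x -> H y -> H (x * y)
    & forall x, H x -> H x^-1].

Definition gen (A : unitRingType) (S : set A) : set A :=
  smallest (@subgroup A) S.

Definition rcoset (A : unitRingType) (H : set A) (a : A) : set A :=
  [set h * a | h in H].

Definition has_order (A : unitRingType) (x : A) (n : nat) : Prop :=
  [/\ (0 < n)%N, x ^+ n = 1 & forall m, (0 < m < n)%N -> x ^+ m <> 1].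

Definition string_C_group (A : unitRingType) (n : nat) (t : 'I_n -> A) : Prop :=
  [/\ forall i, has_order (t i) 2,
      forall i j : 'I_n, (i.+1 < j)%N \/ (j.+1 < i)%N -> (t i * t j) ^+ 2 = 1
    & forall I J : set 'I_n,
        gen (t @` I) `&` gen (t @` J) = gen (t @` (I `&` J))].

(* The letter [(i, false)] is the i-th generator, [(i, true)] its inverse. *)
Definition word (n : nat) : Type := seq ('I_n * bool).

Definition eval_word (A : unitRingType) n (t : 'I_n -> A) (w : word n) : A :=
  \prod_(l <- w) (if l.2 then (t l.1)^-1 else t l.1).

(* Equality in the quotient of the free group by the normal closure of the
   relators. *)
Inductive word_eq n (rels : set (word n)) : word n -> word n -> Prop :=
| word_eq_refl w : word_eq rels w w
| word_eq_sym w1 w2 : word_eq rels w1 w2 -> word_eq rels w2 w1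
| word_eq_trans w1 w2 w3 :
    word_eq rels w1 w2 -> word_eq rels w2 w3 -> word_eq rels w1 w3
| word_eq_cancel w1 w2 i e :
    word_eq rels (w1 ++ [:: (i, e); (i, ~~ e)] ++ w2) (w1 ++ w2)
| word_eq_rel w1 w2 r :
    rels r -> word_eq rels (w1 ++ r ++ w2) (w1 ++ w2).

Definition has_presentation (A : unitRingType) n (G : set A) (t : 'I_n -> A)
    (rels : set (word n)) : Prop :=
  G = gen (range t) /\
  forall w, eval_word t w = 1 <-> word_eq rels w [::].

Definition pos_word n (s : seq 'I_n) : word n := [seq (i, false) | i <- s].

Definition word_exp n (w : word n) (k : nat) : word n := flatten (nseq k w).

(** * Abstract polytopes *)

Record ranked_structure := RankedStructure {
  face :> Type;
  fle : face -> face -> Prop;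
  rk : face -> int }.

Definition flt (P : ranked_structure) (F G : P) : Prop := fle F G /\ F <> G.

Definition partial_order (P : ranked_structure) : Prop :=
  [/\ forall F : P, fle F F,
      forall F G : P, fle F G -> fle G F -> F = G
    & forall F G H : P, fle F G -> fle G H -> fle F H].

Definition chain (P : ranked_structure) (Phi : set P) : Prop :=
  forall F G, Phi F -> Phi G -> fle F G \/ fle G F.

Definition flag (P : ranked_structure) (Phi : set P) : Prop :=
  chain Phi /\ forall Psi : set P, chain Psi -> Phi `<=` Psi -> Psi = Phi.

Definition adjacent_at (P : ranked_structure) (j : int) (Phi Psi : set P) :
    Prop :=
  [/\ flag Phi, flag Psi, Phi <> Psi
    & forall F, rk F <> j -> (Phi F <-> Psi F)].

Definition adjacent (P : ranked_structure) (Phi Psi : set P) : Prop :=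
  exists j, adjacent_at j Phi Psi.

Definition strongly_flag_connected (P : ranked_structure) : Prop :=
  forall Phi Psi : set P, flag Phi -> flag Psi ->
  exists (k : nat) (c : nat -> set P),
    [/\ c 0%N = Phi,
        c k = Psi,
        forall i, (i <= k)%N -> flag (c i) /\ Phi `&` Psi `<=` c i
      & forall i, (i < k)%N -> adjacent (c i) (c i.+1)].

Definition diamond_condition (P : ranked_structure) : Prop :=
  forall F G : P, flt F G -> rk G = rk F + 2 ->
    [set H | flt F H /\ flt H G] #= `I_2.

Definition least (P : ranked_structure) (L : P) : Prop := forall F, fle L F.

Definition greatest (P : ranked_structure) (U : P) : Prop := forall F, fle F U.

Definition polytope (n : nat) (P : ranked_structure) : Prop :=
  [/\ partial_order P,
      forall F G : P, flt F G -> rk F < rk G,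
      exists L : P, least L /\ rk L = -1
    & exists U : P, greatest U /\ rk U = n%:Z]
  /\
  [/\ forall Phi : set P, flag Phi -> Phi #= `I_n.+2,
      strongly_flag_connected P
    & diamond_condition P].

Definition isomorphism (X Y : ranked_structure) (f : X -> Y) : Prop :=
  bijective f /\ forall F G, fle F G <-> fle (f F) (f G).

Definition isomorphic (X Y : ranked_structure) : Prop :=
  exists f : X -> Y, isomorphism f.

Definition regular (n : nat) (P : ranked_structure) : Prop :=
  polytope n P /\
  forall Phi Psi : set P, flag Phi -> flag Psi ->
    exists f : P -> P, isomorphism f /\ f @` Phi = Psi.

(** ** Covers *)

Definition covering (n : nat) (X Y : ranked_structure) (f : X -> Y) : Prop :=
  [/\ polytope n X & polytope n Y] /\
  [/\ forall G : Y, exists F, f F = G,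
      forall F, rk (f F) = rk F,
      forall F G, fle F G -> fle (f F) (f G)
    & forall j (Phi Psi : set X),
        adjacent_at j Phi Psi -> adjacent_at j (f @` Phi) (f @` Psi)].

Definition covers (n : nat) (X Y : ranked_structure) : Prop :=
  exists f : X -> Y, covering n f.

Definition double_cover (n : nat) (X Y : ranked_structure) : Prop :=
  exists f : X -> Y, covering n f /\
    forall Psi : set Y, flag Psi ->
      [set Phi : set X | flag Phi /\ f @` Phi = Psi] #= `I_2.

Definition regular_cover (n : nat) (X Q : ranked_structure) : Prop :=
  regular n X /\ covers n X Q.

Definition minimal_regular_cover (n : nat) (X Q : ranked_structure) : Prop :=
  regular_cover n X Q /\
  forall Y, regular n Y -> covers n X Y -> covers n Y Q -> isomorphic Y X.

Definition the_minimal_regular_cover (n : nat) (X Q : ranked_structure) :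
    Prop :=
  minimal_regular_cover n X Q /\
  forall Y, minimal_regular_cover n Y Q -> isomorphic Y X.

(** ** Sections and universal polytopes *)

Definition section (P : ranked_structure) (F G : P) : ranked_structure :=
  @RankedStructure (set_type [set H : P | fle F H /\ fle H G])
    (fun H1 H2 => fle (val H1) (val H2))
    (fun H => rk (val H) - rk F - 1).

Definition facets_isomorphic_to (n : nat) (P M : ranked_structure) : Prop :=
  forall L F : P, least L -> rk F = n%:Z - 1 -> isomorphic (section L F) M.

Definition vertex_figures_isomorphic_to (P V : ranked_structure) : Prop :=
  forall F U : P, rk F = 0 -> greatest U -> isomorphic (section F U) V.

Definition regular_with (n : nat) (M V P : ranked_structure) : Prop :=
  [/\ regular n P, facets_isomorphic_to n P M
    & vertex_figures_isomorphic_to P V].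

Definition universal (n : nat) (M V P : ranked_structure) : Prop :=
  regular_with n M V P /\ forall Q, regular_with n M V Q -> covers n P Q.

(* The tetrahedron {3,3}: its faces are the subsets of its vertex set. *)
Definition tetrahedron : ranked_structure :=
  @RankedStructure {set 'I_4} (fun S S' => S \subset S')
    (fun S => #|S|%:Z - 1).

(** ** Adding improper faces; coset polytopes *)

Inductive with_improper (U : Type) :=
| Least
| Proper of U
| Greatest.
Arguments Least {U}.
Arguments Greatest {U}.

Definition add_improper (n : nat) (P : ranked_structure) : ranked_structure :=
  @RankedStructure (with_improper P)
    (fun F G => match F, G with
                | Least, _ | _, Greatest => True
                | Proper F', Proper G' => fle F' G'
                | _, _ => False
                end)
    (fun F => match F with
              | Least => -1
              | Proper F' => rk F'
              | Greatest => n%:Z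
              end).

(* The proper j-faces are the right cosets in [G] of [H j]. They are tagged
   with j, as cosets of different ranks are different faces. *)
Definition proper_cosets (A : unitRingType) (n : nat) (G : set A)
    (H : 'I_n -> set A) : ranked_structure :=
  @RankedStructure
    (set_type [set F : 'I_n * set A |
                 exists2 a, G a & F.2 = rcoset (H F.1) a])
    (fun F F' => ((val F).1 <= (val F').1)%N /\
                 (val F).2 `&` (val F').2 !=set0)
    (fun F => (val F).1%:Z).

Definition coset_polytope (A : unitRingType) (n : nat) (G : set A)
    (H : 'I_n -> set A) : ranked_structure :=
  add_improper n (proper_cosets G H).

Definition string_C_stab (A : unitRingType) n (t : 'I_n -> A)
    (j : 'I_n) : set A :=
  gen (t @` [set~ j]).

Definition string_C_polytope (A : unitRingType) n (t : 'I_n -> A) :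
    ranked_structure :=
  coset_polytope (gen (range t)) (string_C_stab t).

(** * Geometric realizations by iterated families *)

(* Points of [E], sets of points, sets of sets of points, and so on. *)
Fixpoint nfamily (E : Type) (j : nat) : Type :=
  if j is j'.+1 then set (nfamily E j') else E.

Fixpoint family_map (E : Type) (f : E -> E) (j : nat) :
    nfamily E j -> nfamily E j :=
  match j with
  | 0%N => f
  | j'.+1 => fun X => [set family_map f x | x in X]
  end.

(* Containment between objects of possibly different ranks. *)
Inductive contained (E : Type) (x : {j & nfamily E j}) :
    {j & nfamily E j} -> Prop :=
| contained_refl : contained x x
| contained_mem j (y : nfamily E j) (Z : nfamily E j.+1) :
    contained x (Tagged (nfamily E) y) -> (Z : set _) y ->
    contained x (Tagged (nfamily E) Z).

(* The structure of rank n whose proper j-faces are the members of [S j], each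
   of them being given as the family of its (j-1)-faces. *)
Definition family_complex (E : Type) (n : nat)
    (S : forall j, set (nfamily E j)) : ranked_structure :=
  add_improper n
    (@RankedStructure
       (set_type [set x : {j & nfamily E j} | (tag x < n)%N /\
                                             S (tag x) (tagged x)])
       (fun x y => contained (val x) (val y))
       (fun x => (tag (val x))%:Z)).

Fixpoint representative (P : ranked_structure) (E : Type) (pt : P -> E)
    (j : nat) : P -> nfamily E j :=
  match j with
  | 0%N => pt
  | j'.+1 => fun F =>
      [set representative pt j' G | G in [set G | rk G = j'%:Z /\ fle G F]]
  end.

Definition faithful (n : nat) (P : ranked_structure) (E : Type) (pt : P -> E) :
    Prop :=
  forall j (F G : P), (j < n)%N -> rk F = j%:Z -> rk G = j%:Z ->
    representative pt j F = representative pt j G -> F = G.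

(* Only the values of [pt] at the vertices matter. That such a [pt] exists
   includes the fact that the image of the base vertex under [a] depends only
   on the coset of [a]. *)
Definition faithful_wythoff_realization (K : realType) (m n : nat)
    (t : 'I_n.+1 -> 'M[K]_m.+1) (base : 'rV[K]_m.+1) : Prop :=
  (forall j, j <> ord0 -> base *m t j = base) /\
  exists pt : string_C_polytope t -> 'rV[K]_m.+1,
    (forall F a, gen (range t) a ->
       val F = (ord0, rcoset (string_C_stab t ord0) a) ->
       pt (Proper F) = base *m a) /\
    faithful n.+1 pt.

(** * The cube *)

Definition cube_vertex (K : realType) (n : nat) : set 'rV[K]_n :=
  [set x | forall i, x 0 i = 1 \/ x 0 i = -1].

(* Faces of the convex hull of the vertices, given by their vertex sets; the
   functional c = 0 gives the cube itself. *)
Definition cube_face (K : realType) (n : nat) (S : set 'rV[K]_n) : Prop :=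
  S = set0 \/
  exists c : 'cV[K]_n,
    S = [set x | cube_vertex x /\
           forall y, cube_vertex y -> (y *m c) 0 0 <= (x *m c) 0 0].

(* The largest rank of a matrix whose rows are differences of points of [S]. *)
Definition affine_dim (K : realType) (n : nat) (S : set 'rV[K]_n) : nat :=
  \max_(k < n.+1 | `[< exists A : 'M[K]_n,
      (forall i, exists x y, [/\ S x, S y & row i A = x - y]) /\
      \rank A = k >]) k.

Definition face_dim (K : realType) (n : nat) (S : set 'rV[K]_n) : int :=
  if `[< S = set0 >] then -1 else (affine_dim S)%:Z.

Definition cube (K : realType) (n : nat) : ranked_structure :=
  @RankedStructure (set_type [set S | @cube_face K n S])
    (fun S S' => val S `<=` val S') (fun S => face_dim (val S)).

(** * The groups, Roli's cube and its enantiomorph *)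

Unset Implicit Arguments.

Definition bvec (K : realType) (k : nat) : 'rV[K]_4 :=
  \row_(j < 4) (j.+1 == k)%:R.

(* The matrix sending the standard basis vectors to the given vectors. *)
Definition mx_of_images {K : realType} (x1 x2 x3 x4 : 'rV[K]_4) : 'M[K]_4 :=
  \matrix_(i < 4) [:: x1; x2; x3; x4]`_i.

Definition signed_perm_mx {K : realType} {n : nat} : set 'M[K]_n :=
  [set A | exists (e : 'I_n -> bool) (s : 'S_n),
     A = diag_mx (\row_i (-1) ^+ e i) *m perm_mx s].

Definition Gplus (K : realType) : set 'M[K]_4 :=
  [set A | signed_perm_mx A /\ \det A = 1].

Definition sigma1 (K : realType) : 'M[K]_4 :=
  mx_of_images (- bvec K 4) (bvec K 1) (bvec K 2) (bvec K 3).
Definition sigma2 (K : realType) : 'M[K]_4 :=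
  mx_of_images (bvec K 2) (bvec K 4) (bvec K 3) (bvec K 1).
Definition sigma3 (K : realType) : 'M[K]_4 :=
  mx_of_images (bvec K 1) (bvec K 4) (bvec K 2) (bvec K 3).

Definition sigmabar1 (K : realType) : 'M[K]_4 := (sigma1 K)^-1.
Definition sigmabar2 (K : realType) : 'M[K]_4 := sigma1 K ^+ 2 * sigma2 K.
Definition sigmabar3 (K : realType) : 'M[K]_4 := sigma3 K.

Definition kappa1 (K : realType) : 'M[K]_(4 + 4) :=
  block_mx (sigma1 K) 0 0 (sigmabar1 K).
Definition kappa2 (K : realType) : 'M[K]_(4 + 4) :=
  block_mx (sigma2 K) 0 0 (sigmabar2 K).
Definition kappa3 (K : realType) : 'M[K]_(4 + 4) :=
  block_mx (sigma3 K) 0 0 (sigmabar3 K).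

Definition tau0 (K : realType) : 'M[K]_(4 + 4) := block_mx 0 1%:M 1%:M 0.

Definition tau (K : realType) (j : 'I_4) : 'M[K]_8 :=
  [:: tau0 K;
      tau0 K *m kappa1 K;
      tau0 K *m kappa1 K *m kappa2 K;
      tau0 K *m kappa1 K *m kappa2 K *m kappa3 K]`_j.

Definition T (K : realType) : set 'M[K]_8 := gen (range (tau K)).

Definition T_polytope (K : realType) : ranked_structure :=
  string_C_polytope (tau K).

Definition T_base_vertex (K : realType) : 'rV[K]_8 :=
  \row_j [:: 1; 1; 1; 1; -1; 1; 1; 1]`_j.

Definition T_relators : set (word 4) :=
  let t (k : nat) : 'I_4 := inord k in
  let x (s : seq nat) := pos_word (map t s) in
  [set r | (exists j : 'I_4, r = word_exp (pos_word [:: j]) 2) \/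
     r \in [:: word_exp (x [:: 0; 1]) 8;
               word_exp (x [:: 1; 2]) 3;
               word_exp (x [:: 2; 3]) 3;
               word_exp (x [:: 0; 2]) 2;
               word_exp (x [:: 0; 3]) 2;
               word_exp (x [:: 1; 3]) 2;
               word_exp (word_exp (x [:: 1; 0]) 3 ++ x [:: 1; 2]) 2]%N].

Definition mx_act {K : realType} (g : 'M[K]_4) (x : 'rV[K]_4) : 'rV[K]_4 :=
  x *m g.

Definition vpoint (K : realType) : 'rV[K]_4 := const_mx 1.

(* The base octagon as the set of its edges. *)
Definition octagon (K : realType) : nfamily 'rV[K]_4 2 :=
  [set [set vpoint K *m sigma1 K ^+ k; vpoint K *m sigma1 K ^+ k.+1] |
    k in `I_8].

Definition M_group (K : realType) : set 'M[K]_4 := gen [set sigma1 K; sigma2 K].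

Definition M_base_edge (K : realType) : nfamily 'rV[K]_4 1 :=
  [set vpoint K; vpoint K *m (sigma1 K)^-1].

Definition M_faces (K : realType) (j : nat) : set (nfamily 'rV[K]_4 j) :=
  match j return set (nfamily 'rV[K]_4 j) with
  | 0%N => @cube_vertex K 4
  | 1%N => [set family_map (mx_act g) (M_base_edge K) | g in M_group K]
  | 2%N => [set family_map (mx_act g) (octagon K) | g in M_group K]
  | _ => set0
  end.

Definition M_polytope (K : realType) : ranked_structure :=
  family_complex 3 (M_faces K).

(* As a facet of Roli's cube, M is the family of its 2-faces. *)
Definition M_facet (K : realType) : nfamily 'rV[K]_4 3 := M_faces K 2.

Definition roli_faces (K : realType) (j : nat) : set (nfamily 'rV[K]_4 j) :=
  match j return set (nfamily 'rV[K]_4 j) with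
  | 0%N => @cube_vertex K 4
  | 1%N => [set e : set 'rV[K]_4 | cube_face e /\ face_dim e = 1]
  | 2%N => [set family_map (mx_act g) (octagon K) | g in Gplus K]
  | 3%N => [set family_map (mx_act g) (M_facet K) | g in Gplus K]
  | _ => set0
  end.

Definition roli_cube (K : realType) : ranked_structure :=
  family_complex 4 (roli_faces K).

Definition roli_bar_stab (K : realType) (j : 'I_4) : set 'M[K]_4 :=
  gen (nth set0
    [:: [set sigmabar2 K; sigmabar3 K];
        [set sigmabar1 K * sigmabar2 K; sigmabar3 K];
        [set sigmabar1 K; sigmabar2 K * sigmabar3 K];
        [set sigmabar1 K; sigmabar2 K]] j).

Definition roli_cube_bar (K : realType) : ranked_structure :=
  coset_polytope (Gplus K) (roli_bar_stab K).

(* Main.v *)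
From Stdlib Require Import PArith FMapPositive.
Require Import Defs.
From mathcomp Require Import all_boot all_order all_algebra all_fingroup.
From mathcomp Require Import boolp classical_sets functions cardinality reals.
From mathcomp Require Import zify ring lra.
Local Open Scope classical_set_scope.
Local Open Scope card_scope.
Local Open Scope ring_scope.
Set Implicit Arguments.
Unset Strict Implicit.
Unset Printing Implicit Defensive.
Import Order.TTheory GRing.Theory Num.Theory.

(** Polytopes are studied through their flags. A flag system consists of a set
    of flags, of the faces of each flag and of the passage to the adjacent
    flags; every polytope comes from one ([polytope_flag_system]) and every flag
    system gives a polytope ([flag_system_polytope]). Walks on flags then play
    the role of words in the generators. A polytope covers another one as soon
    as the closed walks at some flag of the first are closed at some flag of the
    second ([covers_of_walks]), and a polytope is regular exactly when a walk
    closed at one flag is closed at all flags ([regular_of_walks],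
    [walks_of_regular]). It follows that regular polytopes which cover each
    other are isomorphic ([regular_covers_antisym]).

    The flags of the polytope of [T] are the elements of [T]. These are written
    as signed permutations and numbered, so that [T] becomes a finite table of
    left multiplications by the generators; the remaining finite facts are
    checked on this table by computation. The order is the size of the table,
    and the intersection condition is its strong flag-connectedness
    ([T_string_C_group]). For the presentation, a spanning tree of the Cayley
    graph assigns a word to each element; every other edge of the graph is the
    last unknown edge of a cycle labelled by a relator, so that all words with
    the same value are equal modulo the relators ([T_presentation]).

    Roli's cube and its enantiomorph are described by one and the same table of
    384 flags, the base flag of the enantiomorph being the flag 0-adjacent to
    that of Roli's cube. The relators of [T] act trivially on it, hence [T]
    covers both polytopes. Conversely, a walk that is closed at a flag of a
    regular polytope covering one of them is closed at all flags, hence its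
    image is closed at two adjacent flags of the table, one in each of the two
    flag orbits. Only the identity of [T] fixes two such flags, because a
    rotation in [T] is a pair of rotations of the cube, one for each orbit;
    hence every regular cover covers the polytope of [T]
    ([regular_cover_covers_T], [T_minimal_cover]). The 4-cube is treated in the same
    way, each of its 384 flags being the image of two flags ([T_double_cover]).
    In the realization, the 32 vertices are distinct points and every face of
    higher rank is determined by the set of its faces of the preceding rank
    ([T_realization]).

    Besides the squares of the generators, each relator of [T] is the commutation
    of two distant generators or involves only three consecutive generators. In
    the first case it holds in every polytope; in the second case it holds in
    every polytope with facets [M] and tetrahedral vertex-figures, because the
    corresponding walks stay inside a facet or a vertex-figure, where they can be
    compared with those of [T] ([section_walk]). Therefore [T] covers all these
    polytopes ([T_universal]). *)

(** * Flag systems *)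

Section FlagSystem.
Local Open Scope nat_scope.

(** The flag reached from [x] by crossing successively the adjacencies listed
    in [w], when [a j] is the passage to the [j]-adjacent flag. *)
Definition walk (X : Type) (a : nat -> X -> X) (x : X) (w : seq nat) : X :=
  foldl (fun y j => a j y) x w.

(** A polytope of rank [n] described by a set [X] of flags: [F r x] is the face
    of rank [r - 1] of the flag [x], for [r] from [0] (the least face) to [n.+1]
    (the greatest one), so that [a j] changes [F j.+1] only. *)
Record flag_system (n : nat) (X C : Type) (F : nat -> X -> C)
    (a : nat -> X -> X) : Prop := FlagSystem {
  fs_bot : forall x y, F 0 x = F 0 y;
  fs_top : forall x y, F n.+1 x = F n.+1 y;
  fs_mix : forall r x y, r <= n.+1 -> F r x = F r y -> exists z,
    (forall i, i <= r -> F i z = F i x) /\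
    (forall i, r <= i -> i <= n.+1 -> F i z = F i y);
  fs_inj : forall x y, (forall r, r <= n.+1 -> F r x = F r y) -> x = y;
  fs_adjF : forall j i x, j < n -> i != j.+1 -> i <= n.+1 ->
    F i (a j x) = F i x;
  fs_adj_neq : forall j x, j < n -> F j.+1 (a j x) <> F j.+1 x;
  fs_diamond : forall j x y, j < n ->
    (forall i, i != j.+1 -> i <= n.+1 -> F i y = F i x) -> y = x \/ y = a j x;
  fs_conn : forall x y, exists w,
    [/\ all (fun j => j < n) w, walk a x w = y
      & forall j, j \in w -> F j.+1 x <> F j.+1 y] }.

(** [P] is the ranked structure whose faces are the [phi r x], those of ranks
    [r - 1 <= s - 1] being incident when they belong to a common flag. *)
Record presents (n : nat) (P : ranked_structure) (X : Type)
    (phi : nat -> X -> P) : Prop := Presents {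
  pr_cover : forall G, exists r x, r <= n.+1 /\ G = phi r x;
  pr_rk : forall r x, r <= n.+1 -> rk (phi r x) = (r%:Z - 1)%R;
  pr_le : forall r s x y, r <= n.+1 -> s <= n.+1 ->
    (fle (phi r x) (phi s y) <->
     r <= s /\ exists z, phi r z = phi r x /\ phi s z = phi s y);
  pr_bot : forall x y, phi 0 x = phi 0 y;
  pr_top : forall x y, phi n.+1 x = phi n.+1 y }.

(** The flag [x] as a set of faces. *)
Definition flagset (n : nat) (P : ranked_structure) (X : Type)
    (phi : nat -> X -> P) (x : X) : set P :=
  [set G | exists2 r, r <= n.+1 & G = phi r x].

Lemma flag_system_transfer n X C C' (F : nat -> X -> C) (F' : nat -> X -> C') a :
  (forall r x y, r <= n.+1 -> F r x = F r y <-> F' r x = F' r y) ->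
  flag_system n F a -> flag_system n F' a.
Proof.
move=> e [bot top mix inj aF an dia conn]; split.
- by move=> x y; apply/e => //; exact: bot.
- by move=> x y; apply/e => //; exact: top.
- move=> r x y hr /(e _ _ _ hr) /(mix _ _ _ hr)[z [z1 z2]]; exists z; split.
    by move=> i hi; apply/e; [lia | exact: z1].
  by move=> i hi hn; apply/e => //; exact: z2.
- by move=> x y h; apply: inj => r hr; apply/e => //; exact: h.
- by move=> j i x hj hi hn; apply/e => //; exact: aF.
- by move=> j x hj /e h; apply: (an j x hj); apply: h; lia.
- by move=> j x y hj h; apply: dia => // i hi hn; apply/e => //; exact: h.
- move=> x y; have [w [w1 w2 w3]] := conn x y; exists w; split => // j jw.
  have jn : j < n by move/allP: w1 => /(_ _ jw).
  by move/e => h; apply: (w3 j jw); apply: h; lia.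
Qed.

Lemma walk_cat X (a : nat -> X -> X) x w1 w2 :
  walk a x (w1 ++ w2) = walk a (walk a x w1) w2.
Proof. exact: foldl_cat. Qed.

Section Theory.
Variables (n : nat) (X C : Type) (F : nat -> X -> C) (a : nat -> X -> X).
Hypothesis fs : flag_system n F a.

Lemma adjK j x : j < n -> a j (a j x) = x.
Proof.
move=> jn; have [|e|//] := @fs_diamond _ _ _ _ _ fs j (a j x) x jn.
- by move=> i hi hn; rewrite (fs_adjF fs).
- by case: (@fs_adj_neq _ _ _ _ _ fs j x jn); rewrite -e.
Qed.

Lemma walk_rev x w : all (fun j => j < n) w -> walk a (walk a x w) (rev w) = x.
Proof.
elim: w x => [//|j w IH] x /= /andP[jn wn].
by rewrite rev_cons -cats1 walk_cat IH //= adjK.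
Qed.

(** Adjacencies at distant ranks commute: by [fs_mix] there is a flag with the
    low faces of [a i x] and the high faces of [a j x], and it is both
    [a j (a i x)] and [a i (a j x)]. *)
Lemma adjC i j x : i.+1 < j -> j < n -> a i (a j x) = a j (a i x).
Proof.
move=> ij jn; have i_n : i < n by lia.
have [||z [z1 z2]] := @fs_mix _ _ _ _ _ fs i.+2 (a i x) (a j x).
- by lia.
- by rewrite !(fs_adjF fs) //; lia.
have e1 : z = a j (a i x).
  have [k kj kn|e|//] := @fs_diamond _ _ _ _ _ fs j (a i x) z jn.
    have [ki|ki] := leqP k i.+2; first exact: z1.
    rewrite z2 //; last lia.
    by rewrite !(fs_adjF fs) //; lia.
  have := @fs_adj_neq _ _ _ _ _ fs j x jn.
  rewrite -z2; [|lia|lia].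
  by rewrite e (fs_adjF fs) //; lia.
have [k kj kn|e|e2] := @fs_diamond _ _ _ _ _ fs i (a j x) z i_n.
- have [ki|ki] := leqP k i.+1; last by apply: z2.
  rewrite z1; last lia.
  by rewrite !(fs_adjF fs) //; lia.
- have := @fs_adj_neq _ _ _ _ _ fs i x i_n.
  rewrite -z1; last lia.
  by rewrite e (fs_adjF fs) //; lia.
by rewrite -e1 -e2.
Qed.

Lemma walkF x w r : all (fun j => (j < n) && (r != j.+1)) w -> r <= n.+1 ->
  F r (walk a x w) = F r x.
Proof.
elim: w x => [//|j w IH] x /= /andP[/andP[jn rj] wn] hr.
by rewrite IH // (fs_adjF fs).
Qed.

End Theory.

(** ** From flag systems to polytopes *)

Section Polytope.
Variables (n : nat) (P : ranked_structure) (X : Type) (phi : nat -> X -> P).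
Hypothesis pr : presents n phi.

Let rkE := pr_rk pr.

Lemma pr_rank_inj r s x y : r <= n.+1 -> s <= n.+1 -> phi r x = phi s y -> r = s.
Proof. by move=> hr hs e; have := rkE x hr; rewrite e rkE //; lia. Qed.

Lemma pr_le_flag r s x : r <= s -> s <= n.+1 -> fle (phi r x) (phi s x).
Proof. by move=> rs hs; apply/(pr_le pr) => //; [lia | split=> //; exists x]. Qed.

Lemma pr_le_same r x y : r <= n.+1 -> fle (phi r x) (phi r y) ->
  phi r x = phi r y.
Proof. by move=> hr /(pr_le pr _ _ hr hr)[_ [z [<- <-]]]. Qed.

Lemma flagset_phi x r y : r <= n.+1 ->
  flagset n phi x (phi r y) <-> phi r y = phi r x.
Proof.
move=> hr; split=> [[s hs e]|->]; last by exists r.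
by move: (pr_rank_inj hr hs e) => rs; subst s.
Qed.

Lemma flagset_chain x : chain (flagset n phi x).
Proof.
move=> G H [r hr ->] [s hs ->].
by have [rs|/ltnW rs] := leqP r s; [left|right]; exact: pr_le_flag.
Qed.

Variable a : nat -> X -> X.
Hypothesis fs : flag_system n phi a.

Lemma flagset_inj x y : flagset n phi x `<=` flagset n phi y -> x = y.
Proof.
move=> h; apply: (fs_inj fs) => r hr.
by apply/flagset_phi => //; apply: h; exists r.
Qed.

(** A chain extends to a flag: going up through the ranks, [fs_mix] glues the
    flag built so far to a flag through the next face of the chain. *)
Lemma chain_sub_flagset (x0 : X) (Phi : set P) : chain Phi ->
  exists x, Phi `<=` flagset n phi x.
Proof.
move=> ch.
have claim k : k <= n.+1 -> exists x m,
    [/\ m <= k, m = 0 \/ Phi (phi m x)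
      & forall r y, r <= k -> Phi (phi r y) -> r <= m /\ phi r y = phi r x].
  elim: k => [_|k IH hk].
    exists x0, 0; split=> // [|r y]; first by left.
    by rewrite leqn0 => /eqP-> _; split=> //; exact: (pr_bot pr).
  have [x [m [mk hm hx]]] := IH (ltnW hk).
  case: (pselect (exists y, Phi (phi k.+1 y))) => [[y hy]|no]; last first.
    exists x, m; split=> // [|r y]; first exact: leqW.
    rewrite leq_eqVlt => /predU1P[->|hr] hy; last exact: hx.
    by case: no; exists y.
  have [z [z1 z2]] : exists z, phi m z = phi m x /\ phi k.+1 z = phi k.+1 y.
    case: hm => [->|hm]; first by exists y; split=> //; exact: (pr_bot pr).
    have hm' : m <= n.+1 by lia.
    case: (ch _ _ hm hy) => /(pr_le pr) [//|//|le [z]]; last by lia.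
    by exists z.
  have [||u [u1 u2]] := @fs_mix _ _ _ _ _ fs m x z; [lia | by [] |].
  have u3 : phi k.+1 u = phi k.+1 y by rewrite u2 //; lia.
  exists u, k.+1; split=> // [|r y' hr hy']; first by right; rewrite u3.
  split=> //; move: hr hy'; rewrite leq_eqVlt => /predU1P[->|hr] hy'.
    rewrite u3; case: (ch _ _ hy' hy) => h; first exact: pr_le_same.
    by apply/esym; exact: pr_le_same.
  by have [rm ->] := hx r y' hr hy'; rewrite u1.
have [x [m [_ _ hx]]] := claim n.+1 (leqnn _).
exists x => G hG; have [r [y [hr e]]] := pr_cover pr G.
by rewrite e; apply/flagset_phi => //; have [] := hx r y hr; rewrite -?e.
Qed.

Lemma flag_flagset x : flag (flagset n phi x).
Proof.
split; first exact: flagset_chain.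
move=> Psi ch h; have [y hy] := chain_sub_flagset x ch.
have e : x = y by apply: flagset_inj; exact: subset_trans h hy.
by apply/seteqP; split=> //; rewrite e.
Qed.

Lemma flagP (x0 : X) Phi : flag Phi -> exists x, Phi = flagset n phi x.
Proof.
move=> [ch mx]; have [x hx] := chain_sub_flagset x0 ch.
by exists x; apply/esym/mx => //; exact: flagset_chain.
Qed.

Lemma adjacent_flagset j x : j < n ->
  adjacent_at j%:Z (flagset n phi x) (flagset n phi (a j x)).
Proof.
move=> jn; split; [exact: flag_flagset|exact: flag_flagset| |].
  move=> e; have : flagset n phi (a j x) `<=` flagset n phi x by rewrite -e.
  move/flagset_inj => e'; apply: (@fs_adj_neq _ _ _ _ _ fs j x jn).
  by rewrite e'.
move=> G; have [r [y [hr ->]]] := pr_cover pr G.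
rewrite rkE // => hj; rewrite !flagset_phi // (fs_adjF fs) //.
by apply/eqP => e; apply: hj; lia.
Qed.

Lemma adjacent_flagsetP (j : int) x y :
  adjacent_at j (flagset n phi x) (flagset n phi y) ->
  exists2 k, k < n & j = k%:Z /\ y = a k x.
Proof.
move=> [_ _ neq same].
have xy : x <> y by move=> e; apply: neq; rewrite e.
have same' r : r <= n.+1 -> (r%:Z - 1)%R <> j -> phi r y = phi r x.
  move=> hr hj; apply/esym/flagset_phi => //; apply/same; first by rewrite rkE.
  by exists r.
have [k kn jk] : exists2 k, k < n & j = k%:Z.
  apply: contrapT => no; apply: xy; apply: (fs_inj fs) => r hr.
  case: (eqVneq r 0) => [->|r0]; first exact: (pr_bot pr).
  case: (eqVneq r n.+1) => [->|rn]; first exact: (pr_top pr).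
  rewrite same' // => e; apply: no; exists r.-1; lia.
exists k => //; split=> //.
have [|e|//] := @fs_diamond _ _ _ _ _ fs k x y kn.
  by move=> i hi hn; apply: same' => // e; move/eqP: hi; apply; lia.
by case: xy.
Qed.

Lemma flagset_card x : flagset n phi x #= `I_n.+2.
Proof.
have -> : flagset n phi x = (fun r => phi r x) @` `I_n.+2.
  by apply/seteqP; split=> G [r hr e]; exists r.
apply: inj_card_eq => r s; rewrite !inE /= => hr hs; exact: pr_rank_inj.
Qed.

Lemma flag_system_polytope (x0 : X) : polytope n P.
Proof.
have po : partial_order P.
  split.
  - by move=> G; have [r [x [hr ->]]] := pr_cover pr G; exact: pr_le_flag.
  - move=> G H; have [r [x [hr ->]]] := pr_cover pr G.
    have [s [y [hs ->]]] := pr_cover pr H.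
    move=> h1; move: (h1) => /(pr_le pr) [//|//|rs _].
    move=> /(pr_le pr) [//|//|sr _]; have e : r = s by lia.
    by subst s; apply: pr_le_same.
  - move=> G1 G2 G3; have [r [x [hr ->]]] := pr_cover pr G1.
    have [s [y [hs ->]]] := pr_cover pr G2.
    have [t [z [ht ->]]] := pr_cover pr G3.
    move=> /(pr_le pr) [//|//|rs [u [u1 u2]]].
    move=> /(pr_le pr) [//|//|st [v [v1 v2]]].
    have [||m [m1 m2]] := @fs_mix _ _ _ _ _ fs s u v; rewrite ?u2 ?v1 //.
    apply/(pr_le pr) => //; split; first lia.
    by exists m; rewrite m1 // m2.
have strict (G H : P) : flt G H -> (rk G < rk H)%R.
  have [r [x [hr ->]]] := pr_cover pr G.
  have [s [y [hs ->]]] := pr_cover pr H.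
  move=> [h neq]; move: (h) => /(pr_le pr) [//|//|rs _].
  rewrite !rkE //; case: (eqVneq r s) => [e|]; last lia.
  by subst s; case: neq; exact: pr_le_same.
split; split=> //.
- exists (phi 0 x0); split; last by rewrite rkE.
  move=> G; have [r [x [hr ->]]] := pr_cover pr G.
  by rewrite (pr_bot pr x0 x); apply: pr_le_flag.
- exists (phi n.+1 x0); split; last by rewrite rkE //; lia.
  move=> G; have [r [x [hr ->]]] := pr_cover pr G.
  by rewrite (pr_top pr x0 x); apply: pr_le_flag.
- by move=> Phi /(flagP x0)[x ->]; exact: flagset_card.
- move=> Phi Psi /(flagP x0)[x ->] /(flagP x0)[y ->].
  have [w [w1 w2 w3]] := fs_conn fs x y.
  exists (size w), (fun i => flagset n phi (walk a x (take i w))); split.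
  + by rewrite take0.
  + by rewrite take_size w2.
  + move=> i hi; split; first exact: flag_flagset.
    move=> G []; have [r [z [hr ->]]] := pr_cover pr G.
    rewrite !flagset_phi // => e1 e2; rewrite (walkF fs) //.
    apply/allP => j /mem_take jw; move/allP: (w1) => /(_ _ jw) -> /=.
    by apply/eqP => e; apply: (w3 j jw); rewrite -e -e1.
  + move=> i hi; exists (nth 0 w i)%:Z.
    rewrite (take_nth 0 hi) -cats1 walk_cat /=; apply: adjacent_flagset.
    by apply: (allP w1); exact: mem_nth.
move=> G H [le neq] rkGH.
have [x hx] : exists x, [set G; H] `<=` flagset n phi x.
  apply: (chain_sub_flagset x0) => A B [->|->] [->|->].
  - by left; case: po.
  - by left.
  - by right.
  - by left; case: po.
have [r hr eG] : flagset n phi x G by apply: hx; left.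
have [s hs eH] : flagset n phi x H by apply: hx; right.
move: rkGH; rewrite eG eH !rkE // => rs.
have {rs} rs : s = r.+2 by lia.
subst s; have rn : r < n by lia.
have -> : [set K | flt (phi r x) K /\ flt K (phi r.+2 x)] =
          (fun i : nat => if i is 0 then phi r.+1 x else phi r.+1 (a r x)) @` `I_2.
  apply/seteqP; split=> K /=; last first.
    have mid y : phi r y = phi r x -> phi r.+2 y = phi r.+2 x ->
        flt (phi r x) (phi r.+1 y) /\ flt (phi r.+1 y) (phi r.+2 x).
      move=> <- <-; split; split; try (apply: pr_le_flag => //; lia).
        by move/pr_rank_inj; lia.
      by move/pr_rank_inj; lia.
    move=> [[|[|//]]] _ <-; first exact: mid.
    by apply: mid; rewrite (fs_adjF fs) //; lia.
  move=> [ltGK ltKH].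
  have rkK : rk K = r%:Z.
    by have := strict _ _ ltGK; have := strict _ _ ltKH; rewrite !rkE //; lia.
  (* K is compatible with all the faces of x except the one of its own rank *)
  have [y hy] : exists y,
      [set K] `|` [set A | exists2 i, (i <= n.+1) && (i != r.+1) & A = phi i x]
        `<=` flagset n phi y.
    apply: (chain_sub_flagset x0).
    case: po => refl _ trans.
    have cmp i : i <= n.+1 -> i != r.+1 -> fle K (phi i x) \/ fle (phi i x) K.
      move=> hi ir; have [ri|ri] := leqP i r.
        by right; apply: trans ltGK.1; apply: pr_le_flag => //; lia.
      by left; apply: trans ltKH.1 _; apply: pr_le_flag => //; lia.
    move=> A B [->|[i /andP[hi ir] ->]] [->|[j /andP[hj jr] ->]].
    - by left; exact: refl.
    - exact: cmp.
    - by case: (cmp i hi ir); [right|left].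
    - by apply: (flagset_chain (x := x)); [exists i|exists j].
  have [t ht eK] : flagset n phi y K by apply: hy; left.
  have et : t = r.+1 by move: rkK; rewrite eK rkE //; lia.
  subst t; have [|e|e] := @fs_diamond _ _ _ _ _ fs r x y rn.
  - move=> i ir hi; apply/esym/flagset_phi => //; apply: hy; right.
    by exists i; rewrite ?hi ?ir.
  - by exists 0; rewrite // eK e.
  - by exists 1; rewrite // eK e.
apply: inj_card_eq => i j; rewrite !inE /=.
have neqa := @fs_adj_neq _ _ _ _ _ fs r x rn.
by case: i j => [|[|//]] [|[|//]] // _ _ e; case: neqa; rewrite e.
Qed.

End Polytope.
End FlagSystem.

(** ** From polytopes to flag systems *)

Lemma inj_surj_bijective (A B : Type) (f : A -> B) :
  injective f -> (forall b, exists a, f a = b) -> bijective f.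
Proof.
move=> inj surj; rewrite -setTT_bijective; split=> //.
- by move=> x y _ _; exact: inj.
- by move=> b _; have [x <-] := surj b; exists x.
Qed.

Lemma card2_other (T : Type) (D : set T) x : D x -> D #= `I_2 ->
  exists y, [/\ D y, y <> x & forall z, D z -> z = x \/ z = y].
Proof.
move=> Dx /card_set_bijP[h [hfun hinj hsurj]].
have [y Dy hy] := hsurj (1 - h x)%N (ltac:(by case: (h x)) : (1 - h x < 2)%N).
exists y; split=> // [e|z Dz].
  by have := hfun _ Dx; move: hy; rewrite e /=; lia.
have := hfun _ Dx; have := hfun _ Dz; rewrite /= => hz hx.
have [e|e] : h z = h x \/ h z = h y by lia.
  by left; apply: hinj; rewrite ?inE.
by right; apply: hinj; rewrite ?inE.
Qed.

Section OfPolytope.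
Local Open Scope nat_scope.
Variables (n : nat) (P : ranked_structure).
Hypothesis Ppoly : polytope n P.

Let refl (A : P) : fle A A. Proof. by case: Ppoly => -[[]]. Qed.
Let anti (A B : P) : fle A B -> fle B A -> A = B.
Proof. by move: A B; case: Ppoly => -[[]]. Qed.
Let trans (A B C : P) : fle A B -> fle B C -> fle A C.
Proof. by move: A B C; case: Ppoly => -[[]]. Qed.
Let strict (A B : P) : flt A B -> (rk A < rk B)%R.
Proof. by move: A B; case: Ppoly => -[]. Qed.

Let rank_bounds (A : P) : (-1 <= rk A <= n%:Z)%R.
Proof.
case: Ppoly => -[_ _ [L [leL rL]] [U [geU rU]]] _; apply/andP; split.
  case: (pselect (A = L)) => [->|ne]; first by rewrite rL.
  by rewrite -rL; apply/ltW/strict; split=> //; exact: nesym ne.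
case: (pselect (A = U)) => [->|ne]; first by rewrite rU.
by rewrite -rU; apply/ltW/strict; split.
Qed.

Let rank_le (A B : P) : fle A B -> (rk A <= rk B)%R.
Proof.
move=> le; case: (pselect (A = B)) => [->|ne]; first exact: lexx.
by apply/ltW/strict; split.
Qed.

Let same_rank (A B : P) : fle A B \/ fle B A -> rk A = rk B -> A = B.
Proof.
move=> cmp rAB; apply: contrapT => ne; case: cmp => le.
  by have := strict (conj le ne); rewrite rAB ltxx.
by have := strict (conj le (nesym ne)); rewrite rAB ltxx.
Qed.

(** Within a chain the order is that of the ranks. *)
Let rank_cmp (A B : P) : fle A B \/ fle B A -> (rk A <= rk B)%R -> fle A B.
Proof.
case=> // le h; rewrite (@same_rank B A) //; first by left.
by apply/eqP; rewrite eq_le h rank_le.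
Qed.

Let flag_cmp (Phi : set P) A B : flag Phi -> Phi A -> Phi B ->
  fle A B \/ fle B A.
Proof. by case=> ch _; exact: ch. Qed.

Let chain_extends (A : set P) : chain A -> exists2 Phi, flag Phi & A `<=` Phi.
Proof.
move=> chA.
have [|B [chB maxB]] := @Zorn_bigcup P [set B | chain (A `|` B)].
  move=> S hS tot F G hF hG.
  have pick (H : P) : (A `|` \bigcup_(X in S) X) H -> A H \/ exists2 X, S X & X H.
    by case=> [|[X SX XH]]; [left|right; exists X].
  case: (pick _ hF) => [AF|[X SX XF]]; case: (pick _ hG) => [AG|[Y SY YG]].
  - exact: chA.
  - by apply: (hS Y SY); [left|right].
  - by apply: (hS X SX); [right|left].
  - case: (tot X Y SX SY) => le.
      by apply: (hS Y SY); right => //; exact: le.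
    by apply: (hS X SX); right => //; exact: le.
exists (A `|` B); last by move=> x; left.
split=> // Psi chPsi le.
apply: contrapT => ne; apply: (maxB Psi).
  split=> [x Bx|le']; first by apply: le; right.
  apply: ne; apply/seteqP; split=> [x /le' Bx|]; by [right|].
have -> : [set B | chain (A `|` B)] Psi = chain (A `|` Psi) by [].
have -> // : A `|` Psi = Psi.
by apply/seteqP; split=> [x [Ax|//]|x]; [apply: le; left|right].
Qed.

(** A flag meets each rank: its [n + 2] faces have distinct ranks between [-1]
    and [n]. *)
Let flag_has_rank (Phi : set P) r : flag Phi -> r <= n.+1 ->
  exists G, Phi G /\ rk G = (r%:Z - 1)%R.
Proof.
move=> fl hr; case: Ppoly => _ [card _ _].
have /card_set_bijP[h [_ _ hsurj]] := card _ fl.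
have [L _] : exists L : P, True by case: Ppoly => -[_ _ [L _]] _ _; exists L.
have /choice[g gP] : forall k, exists G, k < n.+2 -> Phi G /\ h G = k.
  move=> k; case: (ltnP k n.+2) => hk; last by exists L.
  by have [G PG hG] := hsurj k hk; exists G.
apply: contrapT => no.
have [m mE] : exists m : nat -> nat, forall k, rk (g k) = ((m k)%:Z - 1)%R.
  exists (fun k => absz (rk (g k) + 1)%R) => k.
  by have := rank_bounds (g k); lia.
pose f k := if m k < r then m k else (m k).-1.
have mr k : k < n.+2 -> m k != r.
  move=> hk; apply/eqP => e; apply: no; exists (g k).
  by rewrite mE e; split=> //; have [] := gP k hk.
have : n.+2 <= n.+1; last lia.
apply: (@pigeonhole _ _ f) => [i j|_ [k hk <-] /=].
  rewrite !inE /= => hi hj e.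
  have [Pi hgi] := gP i hi; have [Pj hgj] := gP j hj.
  rewrite -hgi -hgj; congr h; apply: same_rank; first exact: flag_cmp fl Pi Pj.
  rewrite !mE; congr (_%:Z - 1)%R; move: e (mr i hi) (mr j hj); rewrite /f.
  by case: ltnP => h1; case: ltnP => h2; lia.
have := mr k hk; have := rank_bounds (g k); rewrite mE /f.
by case: (ltnP (m k) r); lia.
Qed.

(** Every polytope is described by the system of all its flags. *)
Lemma polytope_flag_system : exists (X : Type) (phi : nat -> X -> P)
    (a : nat -> X -> X),
  [/\ presents n phi, flag_system n phi a & exists x : X, True].
Proof.
pose X := {Phi : set P | flag Phi}.
have /choice[phi' phiP'] : forall q : nat * X, exists G,
    q.1 <= n.+1 -> sval q.2 G /\ rk G = (q.1%:Z - 1)%R.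
  move=> [r [Phi fl]] /=; have [hr|hr] := leqP r n.+1; last first.
    have [G _] := flag_has_rank fl (leq0n n.+1); by exists G.
  by have [G hG] := flag_has_rank fl hr; exists G.
pose phi r x := phi' (r, x).
have phiP r x : r <= n.+1 -> sval x (phi r x) by move=> hr; case: (phiP' (r, x)).
have phirk r x : r <= n.+1 -> rk (phi r x) = (r%:Z - 1)%R.
  by move=> hr; case: (phiP' (r, x)).
have rkN (G : P) : exists2 r : nat, r <= n.+1 & rk G = (r%:Z - 1)%R.
  by exists (absz (rk G + 1)%R); have := rank_bounds G; lia.
have phiE r (x : X) G : r <= n.+1 -> sval x G -> rk G = (r%:Z - 1)%R ->
    phi r x = G.
  move=> hr xG rG; apply: same_rank; last by rewrite phirk.
  exact: (flag_cmp (svalP x)) (phiP _ _ hr) xG.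
have phi_le r s x : r <= s -> s <= n.+1 -> fle (phi r x) (phi s x).
  move=> rs hs; have hr : r <= n.+1 by lia.
  apply: rank_cmp; last by rewrite !phirk //; lia.
  exact: (flag_cmp (svalP x)) (phiP _ _ hr) (phiP _ _ hs).
have ext A : chain A -> exists x : X, forall r G, r <= n.+1 -> A G ->
    rk G = (r%:Z - 1)%R -> phi r x = G.
  move=> /chain_extends[Phi fl le]; exists (exist _ Phi fl) => r G hr AG rG.
  by apply: phiE => //; exact: le.
have phi_inj (x y : X) : (forall r, r <= n.+1 -> phi r x = phi r y) -> x = y.
  have sub (u v : X) : (forall r, r <= n.+1 -> phi r u = phi r v) ->
      sval u `<=` sval v.
    move=> h G uG; have [r hr rG] := rkN G.
    by rewrite -(phiE r u G hr uG rG) h //; exact: phiP.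
  move=> h; have : sval x = sval y.
    by apply/seteqP; split; apply: sub => // r hr; rewrite h.
  case: x y {h} => [A fA] [B fB] /= e; subst B.
  by congr exist; exact: Prop_irrelevance.
have bot x y : phi 0 x = phi 0 y.
  case: Ppoly => -[_ _ [L [leL rL]] _] _.
  have e z : phi 0 z = L.
    by apply: same_rank; [right; exact: leL | rewrite phirk // rL].
  by rewrite !e.
have top x y : phi n.+1 x = phi n.+1 y.
  case: Ppoly => -[_ _ _ [U [geU rU]]] _.
  have e z : phi n.+1 z = U.
    by apply: same_rank; [left; exact: geU | rewrite phirk // rU; lia].
  by rewrite !e.
(* the low faces of x and the high faces of y form a chain *)
have mix r x y : r <= n.+1 -> phi r x = phi r y -> exists z,
    (forall i, i <= r -> phi i z = phi i x) /\
    (forall i, r <= i -> i <= n.+1 -> phi i z = phi i y).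
  move=> hr e.
  have [|z hz] := ext [set G | (exists2 i, i <= r & G = phi i x) \/
      (exists2 i, r <= i <= n.+1 & G = phi i y)].
    have le i j : i <= r -> r <= j <= n.+1 -> fle (phi i x) (phi j y).
      move=> hi /andP[hj hjn]; apply: (@trans _ (phi r x)); first exact: phi_le.
      by rewrite e; exact: phi_le.
    move=> A B [[i hi ->]|[i hi ->]] [[j hj ->]|[j hj ->]].
    - have [ij|/ltnW ij] := leqP i j; [left|right]; apply: phi_le => //; lia.
    - by left; exact: le.
    - by right; exact: le.
    - have [ij|/ltnW ij] := leqP i j; [left|right]; apply: phi_le => //; lia.
  exists z; split=> i hi => [|hn]; apply: hz => //; try lia.
  - by left; exists i.
  - by rewrite phirk //; lia.
  - by right; exists i => //; rewrite hi.
  - by rewrite phirk.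
(* the diamond condition gives the other face of rank j between the neighbours *)
have adj_ex j x : j < n -> exists y, [/\ phi j.+1 y <> phi j.+1 x,
    forall i, i != j.+1 -> i <= n.+1 -> phi i y = phi i x
    & forall z, (forall i, i != j.+1 -> i <= n.+1 -> phi i z = phi i x) ->
      z = x \/ z = y].
  move=> jn; case: Ppoly => _ [_ _ dia].
  have lt2 (z : X) i : i <= n -> flt (phi i z) (phi i.+1 z).
    move=> hi; split; first exact: phi_le.
    by move=> /(congr1 (@rk P)); rewrite !phirk //; lia.
  have neq2 : flt (phi j x) (phi j.+2 x).
    split; first by apply: phi_le => //; lia.
    by move=> /(congr1 (@rk P)); rewrite !phirk //; lia.
  have := dia _ _ neq2; rewrite !phirk; [|lia|lia].
  move=> /(_ ltac:(lia)); set D := [set H | _].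
  have Dx : D (phi j.+1 x) by split; apply: lt2; lia.
  move=> /(card2_other Dx)[A [DA neA AP]].
  have ordA : flt (phi j x) A /\ flt A (phi j.+2 x) by [].
  have rA : rk A = j%:Z.
    have := strict ordA.1; have := strict ordA.2; rewrite !phirk; lia.
  have cmpA i : i != j.+1 -> i <= n.+1 -> fle A (phi i x) \/ fle (phi i x) A.
    move=> ij hi; have [ij'|ij'] := leqP i j.
      by right; apply: trans ordA.1.1; apply: phi_le => //; lia.
    by left; apply: trans ordA.2.1 _; apply: phi_le => //; lia.
  have [|y hy] := ext ([set A] `|`
      [set G | exists2 i, (i <= n.+1) && (i != j.+1) & G = phi i x]).
    move=> G H [->|[i /andP[hi ij] ->]] [->|[k /andP[hk kj] ->]].
    - by left.
    - exact: cmpA.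
    - by case: (cmpA i ij hi); [right|left].
    - by have [ik|/ltnW ik] := leqP i k; [left|right]; apply: phi_le => //; lia.
  have yE i : i != j.+1 -> i <= n.+1 -> phi i y = phi i x.
    move=> ij hi; apply: hy => //; last by rewrite phirk.
    by right; exists i; rewrite ?hi ?ij.
  have yA : phi j.+1 y = A.
    by apply: hy; [lia | left | rewrite rA; lia].
  exists y; split=> //; first by rewrite yA.
  move=> z hz; have Dz : D (phi j.+1 z).
    rewrite /D /= -!hz; [|lia|lia|lia|lia].
    by split; apply: lt2; lia.
  case: (AP _ Dz) => e; [left|right]; apply: phi_inj => i hi.
    by have [->//|ij] := eqVneq i j.+1; exact: hz.
  by have [->|ij] := eqVneq i j.+1; [rewrite e yA | rewrite hz // yE].
have /choice[a' aP'] : forall q : nat * X, exists y, q.1 < n ->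
    [/\ phi q.1.+1 y <> phi q.1.+1 q.2,
      forall i, i != q.1.+1 -> i <= n.+1 -> phi i y = phi i q.2
      & forall z, (forall i, i != q.1.+1 -> i <= n.+1 -> phi i z = phi i q.2) ->
        z = q.2 \/ z = y].
  move=> [j x] /=; have [jn|jn] := ltnP j n; last by exists x.
  by have [y hy] := adj_ex j x jn; exists y.
pose a j x := a' (j, x).
have aP j x : j < n -> [/\ phi j.+1 (a j x) <> phi j.+1 x,
    forall i, i != j.+1 -> i <= n.+1 -> phi i (a j x) = phi i x
    & forall z, (forall i, i != j.+1 -> i <= n.+1 -> phi i z = phi i x) ->
      z = x \/ z = a j x] by exact: (aP' (j, x)).
exists X, phi, a; split; last first.
- have [|x _] := ext set0; first by [].
  by exists x.
- split=> //.
  + by move=> j i x jn; have [_ h _] := aP j x jn; exact: h.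
  + by move=> j x jn; have [h _ _] := aP j x jn.
  + by move=> j x y jn; have [_ _ h] := aP j x jn; exact: h.
  move=> x y; case: Ppoly => _ [_ sfc _].
  have [k [c [c0 ck cfl cadj]]] := sfc _ _ (svalP x) (svalP y).
  (* a sequence of adjacent flags is read as a walk; the rank of each step is
     one at which x and y differ since the common faces are never left *)
  have : forall m, m <= k -> exists w z, [/\ all (fun j => j < n) w,
      walk a x w = z, sval z = c m
      & forall j, j \in w -> phi j.+1 x <> phi j.+1 y].
    elim=> [_|m IH mk].
      by exists [::], x; split.
    have [w [z [w1 w2 w3 w4]]] := IH (ltnW mk).
    have [flu sub] := cfl _ mk; pose u : X := exist _ (c m.+1) flu.
    have subz : sval x `&` sval y `<=` sval z.
      by rewrite w3; apply: (cfl m (ltnW mk)).2.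
    have [d [_ _ ne same]] := cadj m mk.
    have zu : z <> u by move=> e; apply: ne; rewrite -w3 e.
    have sameu i : i <= n.+1 -> (i%:Z - 1)%R <> d -> phi i u = phi i z.
      move=> hi id; apply: phiE; rewrite ?phirk //.
      by rewrite /= -same ?phirk // -w3; exact: phiP.
    have [j jn dj] : exists2 j, j < n & d = j%:Z.
      apply: contrapT => no; apply: zu; apply: phi_inj => i hi.
      case: (eqVneq i 0) => [->|i0]; first exact: bot.
      case: (eqVneq i n.+1) => [->|iN]; first exact: top.
      by rewrite sameu // => e; apply: no; exists i.-1; lia.
    have uE : u = a j z.
      have [_ _ h] := aP j z jn; case: (h u) => [i ij hi|e|//].
        by apply: sameu => // e; move/eqP: ij; apply; lia.
      by case: zu.
    exists (rcons w j), u; split=> //.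
    - by rewrite all_rcons jn.
    - by rewrite -cats1 walk_cat w2 /= -uE.
    - move=> i; rewrite mem_rcons inE => /predU1P[-> e|]; last exact: w4.
      have [h _ _] := aP j z jn; apply: h; rewrite -uE.
      have hxy : (sval x `&` sval y) (phi j.+1 x).
        by split; [|rewrite e]; apply: phiP; lia.
      have -> : phi j.+1 z = phi j.+1 x.
        by apply: phiE; [lia|exact: subz|rewrite phirk //; lia].
      by apply: phiE; [lia|exact: sub|rewrite phirk //; lia].
  move=> /(_ k (leqnn _))[w [z [w1 w2 w3 w4]]]; exists w; split=> //.
  rewrite w2; apply: phi_inj => i hi; apply: phiE; rewrite ?phirk //.
  by rewrite w3 ck; exact: phiP.
split=> //.
- move=> G; have [r hr rG] := rkN G.
  have [|x hx] := ext [set G]; first by move=> A B -> ->; left.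
  by exists r, x; split=> //; apply/esym/hx.
- move=> r s x y hr hs; split=> [le|[rs [z [<- <-]]]]; last exact: phi_le.
  split; first by have := rank_le le; rewrite !phirk //; lia.
  have [|z hz] := ext [set phi r x; phi s y].
    by move=> A B [->|->] [->|->]; [left|left|right|left].
  exists z; split; apply: hz; rewrite ?phirk //; first by left.
  by right.
Qed.

End OfPolytope.

(** * Coverings, isomorphisms and regularity in terms of walks *)

Section Covers.
Local Open Scope nat_scope.
Variables (n : nat) (P P' : ranked_structure) (X X' : Type).
Variables (phi : nat -> X -> P) (phi' : nat -> X' -> P').
Variables (a : nat -> X -> X) (a' : nat -> X' -> X').
Hypotheses (pr : presents n phi) (pr' : presents n phi').
Hypotheses (fs : flag_system n phi a) (fs' : flag_system n phi' a').

(** The map [f] on faces is induced by the map [g] on flags. *)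
Definition on_flags (f : P -> P') (g : X -> X') : Prop :=
  forall r x, r <= n.+1 -> f (phi r x) = phi' r (g x).

Lemma image_flagset f g x : on_flags f g ->
  f @` flagset n phi x = flagset n phi' (g x).
Proof.
move=> fg; apply/seteqP; split=> [_ [_ [r hr ->] <-]|_ [r hr ->]].
  by exists r => //; exact: fg.
by exists (phi r x); [exists r | exact: fg].
Qed.

Lemma face_map_of_flag_map (g : X -> X') :
  (forall r x y, r <= n.+1 -> phi r x = phi r y -> phi' r (g x) = phi' r (g y)) ->
  exists f : P -> P', on_flags f g.
Proof.
move=> hg.
have /choice[f fP] : forall G, exists G', exists r x,
    [/\ r <= n.+1, G = phi r x & G' = phi' r (g x)].
  move=> G; have [r [x [hr e]]] := pr_cover pr G.
  by exists (phi' r (g x)), r, x.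
exists f => r x hr; have [s [y [hs e ->]]] := fP (phi r x).
have rs := pr_rank_inj pr hr hs e; subst s.
exact/hg.
Qed.

Lemma flag_map_surj (g : X -> X') (x0 : X) :
  (forall j x, j < n -> g (a j x) = a' j (g x)) ->
  forall x', exists x, g x = x'.
Proof.
move=> ga x'; have [w [w1 w2 _]] := fs_conn fs' (g x0) x'.
exists (walk a x0 w); rewrite -w2.
elim: w x0 {w2} w1 => [//|j w IH] x0 /= /andP[jn wn].
by rewrite -ga // IH.
Qed.

Lemma flag_map_walk (g : X -> X') x w :
  (forall j x, j < n -> g (a j x) = a' j (g x)) ->
  all (fun j => j < n) w -> g (walk a x w) = walk a' (g x) w.
Proof.
move=> ga; elim: w x => [//|j w IH] x /= /andP[jn wn].
by rewrite -ga // IH.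
Qed.

Lemma covering_of_flag_map (f : P -> P') (g : X -> X') (x0 : X) :
  on_flags f g -> (forall j x, j < n -> g (a j x) = a' j (g x)) ->
  covering n f.
Proof.
move=> fg ga; split.
  split; first exact: (flag_system_polytope pr fs x0).
  exact: (flag_system_polytope pr' fs' (g x0)).
split.
- move=> G'; have [r [x' [hr ->]]] := pr_cover pr' G'.
  have [x <-] := flag_map_surj x0 ga x'.
  by exists (phi r x); exact: fg.
- move=> G; have [r [x [hr ->]]] := pr_cover pr G.
  by rewrite fg // (pr_rk pr) // (pr_rk pr').
- move=> G H; have [r [x [hr ->]]] := pr_cover pr G.
  have [s [y [hs ->]]] := pr_cover pr H.
  move=> /(pr_le pr _ _ hr hs)[rs [z [<- <-]]].
  by rewrite !fg //; exact: (pr_le_flag pr').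
move=> j Phi Psi adj; have [fl1 fl2 _ _] := adj.
move: adj; have [x ->] := flagP pr fs x0 fl1; have [y ->] := flagP pr fs x0 fl2.
move=> /(adjacent_flagsetP pr fs)[k kn [-> ->]].
by rewrite !(image_flagset _ fg) ga //; exact: (adjacent_flagset pr' fs').
Qed.

Lemma flag_map_of_covering (f : P -> P') : 0 < n -> covering n f ->
  exists g : X -> X', on_flags f g /\
    forall j x, j < n -> g (a j x) = a' j (g x).
Proof.
move=> n0 [_ [surj frk _ fadj]].
have [g gP] : exists g : X -> X', forall x,
    f @` flagset n phi x = flagset n phi' (g x).
  have /choice[g gP] : forall x, exists x',
      f @` flagset n phi x = flagset n phi' x'.
    move=> x; have [fl _ _ _] := fadj _ _ _ (adjacent_flagset pr fs x n0).
    have [_ [y _]] := pr_cover pr' (f (phi 0 x)).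
    exact: (flagP pr' fs' y fl).
  by exists g.
exists g; split=> [r x hr|j x jn].
  have : flagset n phi' (g x) (f (phi r x)).
    by rewrite -gP; exists (phi r x) => //; exists r.
  move=> [s hs e]; rewrite e; congr phi'.
  have := frk (phi r x); rewrite e (pr_rk pr') // (pr_rk pr) //; lia.
have := fadj _ _ _ (adjacent_flagset pr fs x jn); rewrite !gP.
move=> /(adjacent_flagsetP pr' fs')[k kn [jk ->]].
by have -> : j = k by lia.
Qed.

(** An order isomorphism between polytopes of the same rank preserves ranks,
    since both have flags with the same number of faces. *)
Lemma flag_map_of_isomorphism (f : P -> P') : isomorphism f ->
  exists g : X -> X', on_flags f g /\
    forall j x, j < n -> g (a j x) = a' j (g x).
Proof.
move=> [/bij_inj finj fle_f].
have /choice[g gP] : forall x, exists x', forall r, r <= n.+1 ->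
    f (phi r x) = phi' r x'.
  move=> x; have [_ [y' _]] := pr_cover pr' (f (phi 0 x)).
  have [|x' hx'] := @chain_sub_flagset _ _ _ _ pr' _ fs' y' (f @` flagset n phi x).
    move=> _ _ [A hA <-] [B hB <-]; rewrite -!fle_f.
    exact: (flagset_chain pr) hA hB.
  have /choice[m mP] : forall r, exists s, r <= n.+1 ->
      s <= n.+1 /\ f (phi r x) = phi' s x'.
    move=> r; have [hr|hr] := leqP r n.+1; last by exists 0.
    have [|s hs e] := hx' (f (phi r x)); last by exists s.
    by exists (phi r x) => //; exists r.
  (* the ranks of the images increase strictly within the same bounds *)
  have mono r s : r < s -> s <= n.+1 -> m r < m s.
    move=> rs hs; have hr : r <= n.+1 by lia.
    have [h1 e1] := mP r hr; have [h2 e2] := mP s hs.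
    rewrite ltn_neqAle; apply/andP; split.
      apply/eqP => e; have : f (phi r x) = f (phi s x) by rewrite e1 e2 e.
      by move/finj/(pr_rank_inj pr hr hs); lia.
    have : fle (f (phi r x)) (f (phi s x)).
      by rewrite -fle_f; apply: (pr_le_flag pr); lia.
    by rewrite e1 e2 => /(pr_le pr' _ _ h1 h2)[].
  exists x' => r hr; have [h1 ->] := mP r hr; congr phi'.
  have lo s : s <= n.+1 -> s <= m s.
    by elim: s => [//|s IH] hs; have := mono s s.+1; have := IH; lia.
  have up k : k <= n.+1 -> m (n.+1 - k) <= n.+1 - k.
    elim: k => [_|k IH hk]; first by have [] := mP n.+1 (leqnn _); rewrite subn0.
    by have := mono (n.+1 - k.+1) (n.+1 - k); have := IH; lia.
  have := up (n.+1 - r); have := lo r hr; rewrite subKn //; lia.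
exists g; split=> [r x hr|j x jn]; first exact: gP.
have [i ij hi|e|//] := @fs_diamond _ _ _ _ _ fs' j (g x) (g (a j x)) jn.
  by rewrite -!gP // (fs_adjF fs).
have h : j.+1 <= n.+1 by lia.
case: (@fs_adj_neq _ _ _ _ _ fs j x jn); apply: finj.
by rewrite !gP // e.
Qed.

(** A flag map exists as soon as the closed walks at one flag of [P] are closed
    at one flag of [P']. *)
Lemma covers_of_walks (x : X) (x' : X') :
  (forall w, all (fun j => j < n) w -> walk a x w = x -> walk a' x' w = x') ->
  exists f g, [/\ covering n f, on_flags f g, g x = x'
    & forall w, all (fun j => j < n) w -> g (walk a x w) = walk a' x' w].
Proof.
move=> hw.
have /choice[g gP] : forall y, exists y', exists w,
    [/\ all (fun j => j < n) w, walk a x w = y & walk a' x' w = y'].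
  move=> y; have [w [w1 w2 _]] := fs_conn fs x y.
  by exists (walk a' x' w), w.
have gw w : all (fun j => j < n) w -> g (walk a x w) = walk a' x' w.
  move=> wn; have [v [v1 v2 <-]] := gP (walk a x w).
  have h : walk a' x' (v ++ rev w) = x'.
    apply: hw; first by rewrite all_cat v1 all_rev.
    by rewrite walk_cat v2 (walk_rev fs).
  have := walk_rev fs' (walk a' x' v) (w := rev w).
  by rewrite all_rev revK => /(_ wn); move: h; rewrite walk_cat => ->.
have gx y : exists2 w, all (fun j => j < n) w & walk a x w = y.
  by have [w [w1 w2 _]] := fs_conn fs x y; exists w.
have ga j y : j < n -> g (a j y) = a' j (g y).
  move=> jn; have [w wn <-] := gx y.
  have -> : a j (walk a x w) = walk a x (rcons w j) by rewrite -cats1 walk_cat.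
  by rewrite !gw ?all_rcons ?jn // -cats1 walk_cat.
have [|f fg] := @face_map_of_flag_map g.
  move=> r y z hr e; have [w [wn wz we]] := fs_conn fs y z.
  rewrite -wz (flag_map_walk _ ga) // (walkF fs') //.
  apply/allP => j jw; rewrite (allP wn j jw) /=.
  by apply/eqP => rj; apply: (we j jw); rewrite -rj.
exists f, g; split=> //; first exact: covering_of_flag_map fg ga.
by have := gw [::] isT.
Qed.

Lemma isomorphism_of_flag_map (g : X -> X') :
  (forall r x y, r <= n.+1 ->
    phi r x = phi r y <-> phi' r (g x) = phi' r (g y)) ->
  (forall x', exists x, g x = x') ->
  exists2 f : P -> P', isomorphism f & on_flags f g.
Proof.
move=> hg surj.
have [|f fg] := @face_map_of_flag_map g; first by move=> r x y hr /hg; apply.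
exists f => //; split.
  apply: inj_surj_bijective.
    move=> G H; have [r [x [hr ->]]] := pr_cover pr G.
    have [s [y [hs ->]]] := pr_cover pr H.
    rewrite !fg // => e; have rs := pr_rank_inj pr' hr hs e; subst s.
    by apply/hg.
  move=> G'; have [r [x' [hr ->]]] := pr_cover pr' G'.
  by have [x <-] := surj x'; exists (phi r x); exact: fg.
move=> G H; have [r [x [hr ->]]] := pr_cover pr G.
have [s [y [hs ->]]] := pr_cover pr H.
rewrite !fg // (pr_le pr) // (pr_le pr') //.
split=> -[rs [z [e1 e2]]]; split=> //.
  by exists (g z); split; apply/hg.
have [t zt] := surj z; exists t; split; apply/hg => //; by rewrite zt.
Qed.

End Covers.

Section Regular.
Local Open Scope nat_scope.

(** Two polytopes with the same closed walks at a flag are isomorphic. *)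
Lemma isomorphism_of_walks n (P P' : ranked_structure) (X X' : Type)
  (phi : nat -> X -> P) (phi' : nat -> X' -> P') a a' (x : X) (x' : X') :
  presents n phi -> presents n phi' ->
  flag_system n phi a -> flag_system n phi' a' ->
  (forall w, all (fun j => j < n) w ->
     walk a x w = x <-> walk a' x' w = x') ->
  exists2 f : P -> P', isomorphism f
    & forall r, r <= n.+1 -> f (phi r x) = phi' r x'.
Proof.
move=> pr pr' fs fs' hw.
have [|f [g [cf fg gx gw]]] := covers_of_walks pr pr' fs fs' (x := x) (x' := x').
  by move=> w wn /hw; apply.
have [|f' [g' [_ fg' gx' gw']]] :=
    covers_of_walks pr' pr fs' fs (x := x') (x' := x).
  by move=> w wn /hw; apply.
have gK y : g' (g y) = y.
  by have [w [wn <- _]] := fs_conn fs x y; rewrite gw // gw'.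
have gK' y : g (g' y) = y.
  by have [w [wn <- _]] := fs_conn fs' x' y; rewrite gw' // gw.
have [||h hi hg] := isomorphism_of_flag_map pr pr' (g := g).
- move=> r y z hr; split=> e; first by rewrite -!fg // e.
  by rewrite -[y]gK -[z]gK -!fg' // e.
- by move=> y; exists (g' y).
- by exists h => // r hr; rewrite hg // gx.
Qed.

Lemma regular_of_walks n (P : ranked_structure) X (phi : nat -> X -> P) a (x0 : X) :
  presents n phi -> flag_system n phi a ->
  (forall w x y, all (fun j => j < n) w -> walk a x w = x -> walk a y w = y) ->
  regular n P.
Proof.
move=> pr fs hw; split; first exact: (flag_system_polytope pr fs x0).
move=> Phi Psi /(flagP pr fs x0)[x ->] /(flagP pr fs x0)[y ->].
have [|f fi fP] := isomorphism_of_walks (x := x) (x' := y) pr pr fs fs.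
  by move=> w wn; split; exact: hw.
exists f; split=> //; apply/seteqP; split=> [_ [_ [r hr ->] <-]|_ [r hr ->]].
  by exists r => //; exact: fP.
by exists (phi r x); [exists r | exact: fP].
Qed.

Lemma walks_of_regular n (P : ranked_structure) X (phi : nat -> X -> P) a :
  presents n phi -> flag_system n phi a -> regular n P ->
  forall w x y, all (fun j => j < n) w -> walk a x w = x -> walk a y w = y.
Proof.
move=> pr fs [_ reg] w x y wn e.
have [f [fi fxy]] := reg _ _ (flag_flagset pr fs x) (flag_flagset pr fs y).
have [g [fg ga]] := flag_map_of_isomorphism pr pr fs fs fi.
have gx : g x = y.
  by apply: (flagset_inj pr fs); rewrite -fxy (image_flagset _ fg).
by rewrite -gx -(flag_map_walk _ ga) // e.
Qed.

(** Regular polytopes that cover each other are isomorphic, even when they are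
    infinite: closed walks are preserved in both directions. *)
Lemma regular_covers_antisym n (P Q : ranked_structure) : 0 < n ->
  regular n P -> regular n Q -> covers n P Q -> covers n Q P -> isomorphic P Q.
Proof.
move=> n0 rP rQ [f cf] [f' cf'].
have [X [phi [a [pr fs [x _]]]]] := polytope_flag_system rP.1.
have [Y [psi [b [pr' fs' [y _]]]]] := polytope_flag_system rQ.1.
have [g [_ ga]] := flag_map_of_covering pr pr' fs fs' n0 cf.
have [g' [_ ga']] := flag_map_of_covering pr' pr fs' fs n0 cf'.
have [|h hi _] := isomorphism_of_walks (x := x) (x' := y) pr pr' fs fs'.
  move=> w wn; split=> e.
    apply: (walks_of_regular pr' fs' rQ (x := g x)) => //.
    by rewrite -(flag_map_walk _ ga) // e.
  apply: (walks_of_regular pr fs rP (x := g' y)) => //.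
  by rewrite -(flag_map_walk _ ga') // e.
by exists h.
Qed.

End Regular.

(** * Sections *)

Section Sections.
Local Open Scope nat_scope.

Lemma isomorphic_sym (P Q : ranked_structure) : isomorphic P Q -> isomorphic Q P.
Proof.
move=> [f [[g fK gK] fle_f]]; exists g; split; first by exists f.
by move=> F G; rewrite -{1}(gK F) -{1}(gK G) -fle_f.
Qed.

Lemma isomorphic_trans (P Q R : ranked_structure) :
  isomorphic P Q -> isomorphic Q R -> isomorphic P R.
Proof.
move=> [f [bf hf]] [g [bg hg]]; exists (g \o f); split; first exact: bij_comp.
by move=> F G; rewrite hf hg.
Qed.

Definition in_section (P : ranked_structure) (A B G : P)
  (h : fle A G /\ fle G B) : section A B := SigSub (mem_set h).

Lemma section_isomorphic (P P' : ranked_structure) (f : P -> P') (A B : P) :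
  isomorphism f -> isomorphic (section A B) (section (f A) (f B)).
Proof.
move=> [/[dup] bf [g fK gK] hf].
have inS (H : section A B) : fle (f A) (f (val H)) /\ fle (f (val H)) (f B).
  by rewrite -!hf; exact: (set_valP H).
exists (fun H => in_section (inS H)); split; last by move=> H K; exact: hf.
apply: inj_surj_bijective => [H K /(congr1 val) /= e|K].
  by apply: val_inj; exact: (bij_inj bf).
have inK : fle A (g (val K)) /\ fle (g (val K)) B.
  by rewrite !hf gK; exact: (set_valP K).
by exists (in_section inK); apply: val_inj; rewrite /= gK.
Qed.

(** The section between two faces of the flag [x0] is described by the flags
    through these two faces. *)
Lemma section_presents n (P : ranked_structure) (X : Type) (phi : nat -> X -> P)
    a (r0 r1 : nat) (x0 : X) :
  presents n phi -> flag_system n phi a -> r0 < r1 -> r1 <= n.+1 ->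
  exists psi : nat -> {x | phi r0 x = phi r0 x0 /\ phi r1 x = phi r1 x0} ->
      section (phi r0 x0) (phi r1 x0),
    presents (r1 - r0).-1 psi /\
    forall r x, r <= r1 - r0 -> val (psi r x) = phi (r0 + r) (sval x).
Proof.
move=> pr fs r01 hr1.
pose Y : Type := {x | phi r0 x = phi r0 x0 /\ phi r1 x = phi r1 x0}.
pose S := section (phi r0 x0) (phi r1 x0).
have inS (y : Y) r : r0 <= r -> r <= r1 ->
    fle (phi r0 x0) (phi r (sval y)) /\ fle (phi r (sval y)) (phi r1 x0).
  case: y => x [/= <- <-] h0 h1.
  by split; apply: (pr_le_flag pr); lia.
have /choice[psi' psiP] : forall q : nat * Y, exists H : S,
    q.1 <= r1 - r0 -> val H = phi (r0 + q.1) (sval q.2).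
  move=> [r y] /=; have [hr|hr] := leqP r (r1 - r0); last first.
    by have h := inS y r0 (leqnn _) (ltnW r01); exists (in_section h).
  have [||h1 h2] := inS y (r0 + r); [lia|lia|].
  by exists (in_section (conj h1 h2)).
pose psi r y := psi' (r, y).
have psiE r y : r <= r1 - r0 -> val (psi r y) = phi (r0 + r) (sval y).
  exact: (psiP (r, y)).
exists psi; split=> //.
have e : (r1 - r0).-1.+1 = r1 - r0 by lia.
split; rewrite ?e.
- move=> H; have [h0 h1] := set_valP H.
  have [r [x [hr er]]] := pr_cover pr (val H).
  move: h0 h1; rewrite er.
  move=> /(pr_le pr) [|//|hr0 [u [u1 u2]]]; first lia.
  move=> /(pr_le pr) [//|//|hr1' [v [v1 v2]]].
  have [||z [z1 z2]] := @fs_mix _ _ _ _ _ fs r u v; rewrite ?u2 ?v1 //.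
  have zY : phi r0 z = phi r0 x0 /\ phi r1 z = phi r1 x0 by rewrite z1 ?z2.
  exists (r - r0), (exist _ z zY); split; first lia.
  apply: val_inj; rewrite /= psiE /=; last lia.
  by rewrite subnKC // z1 // u2.
- move=> r y hr; rewrite /= psiE // !(pr_rk pr); lia.
- move=> r s x y hr hs; rewrite /= !psiE //.
  rewrite (pr_le pr); [|lia|lia].
  split=> -[hrs [z [ez1 ez2]]]; split; try lia; last first.
    by exists (sval z); rewrite -!psiE // ez1 ez2.
  have [||u [u1 u2]] := @fs_mix _ _ _ _ _ fs (r0 + r) (sval x) z; [lia|by []|].
  have [||v [v1 v2]] := @fs_mix _ _ _ _ _ fs (r0 + s) u (sval y); [lia| |].
    by rewrite u2 //; lia.
  have [ex0 _] := svalP x; have [_ ey1] := svalP y.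
  have zY : phi r0 v = phi r0 x0 /\ phi r1 v = phi r1 x0.
    rewrite v1; last lia.
    rewrite u1; last lia.
    by rewrite v2 //; lia.
  exists (exist _ v zY); split; apply: val_inj; rewrite /= !psiE //=.
    by rewrite v1 ?u1 //; lia.
  by rewrite v2 //; lia.
- move=> x y; apply: val_inj; rewrite /= !psiE // addn0.
  by rewrite (svalP x).1 (svalP y).1.
- move=> x y; apply: val_inj; rewrite /= !psiE // subnKC; last lia.
  by rewrite (svalP x).2 (svalP y).2.
Qed.

Section Transfer.
Variables (n : nat) (P P' : ranked_structure) (X X' : Type).
Variables (phi : nat -> X -> P) (phi' : nat -> X' -> P').
Variables (a : nat -> X -> X) (a' : nat -> X' -> X').
Hypotheses (pr : presents n phi) (pr' : presents n phi').
Hypotheses (fs : flag_system n phi a) (fs' : flag_system n phi' a').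
Variables (r0 r1 : nat) (A B : P) (x0' : X').
Hypotheses (r01 : r0 < r1) (hr1 : r1 <= n.+1).
Let A' := phi' r0 x0'.
Let B' := phi' r1 x0'.
Variable h : section A B -> section A' B'.
Hypothesis hiso : isomorphism h.

(** The flag [x] passes through the two faces that bound the section. *)
Let over x := phi r0 x = A /\ phi r1 x = B.

(** The isomorphism [h] sends the part of [x] inside the section to that of [x']. *)
Let matched x x' := [/\ phi' r0 x' = A', phi' r1 x' = B'
  & forall r, r0 <= r <= r1 -> forall H, val H = phi r x ->
      val (h H) = phi' r x'].

Let in_over x r : over x -> r0 <= r <= r1 ->
  exists H : section A B, val H = phi r x.
Proof.
move=> [e0 e1] /andP[h0 h1].
have hin : fle A (phi r x) /\ fle (phi r x) B.
  by rewrite -e0 -e1; split; apply: (pr_le_flag pr); lia.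
by exists (in_section hin).
Qed.

Let hinj : injective h. Proof. by case: hiso => /bij_inj. Qed.

Let match_ex x : over x -> exists x', matched x x'.
Proof.
move=> ox.
pose Phi : set P' := fun G => exists r H,
  [/\ r0 <= r <= r1, val H = phi r x & G = val (h H)].
have [|x' hx'] := @chain_sub_flagset _ _ _ _ pr' _ fs' x0' Phi.
  move=> _ _ [r [H [hr eH ->]]] [s [K [hs eK ->]]].
  have [_ hle] := hiso.
  have [rs|/ltnW rs] := leqP r s; [left|right]; apply/(hle _ _);
    rewrite /= eH eK; apply: (pr_le_flag pr); lia.
have /choice[m mP] : forall r, exists s, r0 <= r <= r1 -> s <= n.+1 /\
    forall H, val H = phi r x -> val (h H) = phi' s x'.
  move=> r; case: (boolP (r0 <= r <= r1)) => hr; last by exists 0.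
  have [H eH] := in_over ox hr.
  have [|s hs e] := hx' (val (h H)); first by exists r, H.
  exists s => _; split=> // K eK.
  by have -> : K = H by apply: val_inj; rewrite /= eH eK.
have bnd r : r0 <= r <= r1 -> r0 <= m r <= r1.
  move=> hr; have [hm e] := mP r hr; have [H eH] := in_over ox hr.
  have [l1 l2] := set_valP (h H); move: l1 l2; rewrite (e H eH) /A' /B'.
  move=> /(pr_le pr') [|//|-> _]; first lia.
  by move=> /(pr_le pr') [//|//|-> _].
have mono r s : r0 <= r -> r < s -> s <= r1 -> m r < m s.
  move=> h0 rs h1; have hr : r0 <= r <= r1 by lia.
  have hs : r0 <= s <= r1 by lia.
  have [hm e] := mP r hr; have [H eH] := in_over ox hr.
  have [hm' e'] := mP s hs; have [K eK] := in_over ox hs.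
  rewrite ltn_neqAle; apply/andP; split.
    apply/eqP => em; have : val (h H) = val (h K) by rewrite e // e' // em.
    move=> /val_inj /hinj eHK.
    have : phi r x = phi s x by rewrite -eH -eK eHK.
    by move/(pr_rank_inj pr); lia.
  have [_ hle] := hiso; have : fle (h H) (h K).
    by apply/(hle _ _); rewrite /= eH eK; apply: (pr_le_flag pr); lia.
  by rewrite /= e // e' // => /(pr_le pr' _ _ hm hm')[].
have mE r : r0 <= r <= r1 -> m r = r.
  have lo k : r0 + k <= r1 -> r0 + k <= m (r0 + k).
    elim: k => [|k IH] hk; first by have := bnd (r0 + 0); lia.
    by have := mono (r0 + k) (r0 + k.+1); have := IH; lia.
  have up k : k <= r1 - r0 -> m (r1 - k) <= r1 - k.
    elim: k => [|k IH] hk; first by have := bnd (r1 - 0); lia.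
    by have := mono (r1 - k.+1) (r1 - k); have := IH; lia.
  move=> hr; have := lo (r - r0); have := up (r1 - r).
  have -> : r1 - (r1 - r) = r by lia.
  have -> : r0 + (r - r0) = r by lia.
  lia.
have hP r H : r0 <= r <= r1 -> val H = phi r x -> val (h H) = phi' r x'.
  by move=> hr eH; have [_ e] := mP r hr; rewrite e // mE.
exists x'; split=> [||r hr H]; last exact: hP.
  have hr : r0 <= r0 <= r1 by lia.
  have [H eH] := in_over ox hr; have [l _] := set_valP (h H).
  by move: l; rewrite (hP _ _ hr eH) => /(pr_le_same pr') <- //; lia.
have hr : r0 <= r1 <= r1 by lia.
have [H eH] := in_over ox hr; have [_ l] := set_valP (h H).
by move: l; rewrite (hP _ _ hr eH) => /(pr_le_same pr') -> //.
Qed.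

Let match_step j x x' : r0 <= j -> j.+1 < r1 -> over x -> matched x x' ->
  over (a j x) /\ matched (a j x) (a' j x').
Proof.
move=> hj0 hj1 ox [e0 e1 me]; have jn : j < n by lia.
have oax : over (a j x).
  by case: ox => [o0 o1]; split; rewrite (fs_adjF fs) //; lia.
split=> //; have [y' [f0 f1 me']] := match_ex oax.
have same r : r0 <= r <= r1 -> r != j.+1 -> phi' r y' = phi' r x'.
  move=> hr rj; have [H eH] := in_over oax hr.
  rewrite -(me' r hr H eH) (me r hr H) //.
  by rewrite eH (fs_adjF fs) //; lia.
have diff : phi' j.+1 y' <> phi' j.+1 x'.
  have hr : r0 <= j.+1 <= r1 by lia.
  have [H eH] := in_over oax hr; have [K eK] := in_over ox hr.
  rewrite -(me' _ hr H eH) -(me _ hr K eK) => /val_inj /hinj eHK.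
  by apply: (@fs_adj_neq _ _ _ _ _ fs j x jn); rewrite -eH -eK eHK.
have [||u [u1 u2]] := @fs_mix _ _ _ _ _ fs' r0 x' y'; [lia|by rewrite e0 f0|].
have [||v [v1 v2]] := @fs_mix _ _ _ _ _ fs' r1 u x'; [lia| |].
  by rewrite u2 ?e1 ?f1 //; lia.
have vE r : r <= n.+1 -> (r < r0) || (r1 < r) || (r != j.+1) ->
    phi' r v = phi' r x'.
  move=> hr c; have [h1|h1] := leqP r1 r; first by rewrite v2.
  rewrite v1; last lia.
  have [h0|h0] := leqP r r0; first by rewrite u1.
  by rewrite u2 // ?same //; lia.
have vy r : r0 <= r <= r1 -> phi' r v = phi' r y'.
  by move=> hr; rewrite v1 ?u2 //; lia.
have vE' : v = a' j x'.
  have [r rj hr|e|//] := @fs_diamond _ _ _ _ _ fs' j x' v jn.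
    by apply: vE; rewrite ?rj ?orbT.
  by case: diff; rewrite -vy ?e //; lia.
rewrite -vE'; split; rewrite ?vy //; try lia.
by move=> r hr H eH; rewrite vy //; exact: me'.
Qed.

(** A walk inside the section [B / A] closes up at each flag if so do all the
    walks with the same letters in a polytope with an isomorphic section. *)
Lemma section_walk x w : over x ->
  all (fun j => (r0 <= j) && (j.+1 < r1)) w ->
  (forall x', walk a' x' w = x') -> walk a x w = x.
Proof.
move=> ox hw closed; have [x' mx] := match_ex ox.
have [ow mw] : over (walk a x w) /\ matched (walk a x w) (walk a' x' w).
  elim: w x x' ox mx hw {closed} => [//|j w IH] x x' ox mx /= /andP[/andP[j0 j1] hw].
  have [ox' mx'] := match_step j0 j1 ox mx.
  exact: IH.
apply: (fs_inj fs) => r hr.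
case: (boolP (r0 <= r <= r1)) => hr01; last first.
  apply: (walkF fs) => //; apply/allP => j /(allP hw) /andP[j0 j1].
  by apply/andP; split; first lia; apply/eqP; lia.
have [H eH] := in_over ow hr01; have [K eK] := in_over ox hr01.
rewrite -eH -eK; congr val; apply: hinj; apply: val_inj => /=.
case: mw mx => _ _ m1 [_ _ m2].
by rewrite (m1 _ hr01 H eH) (m2 _ hr01 K eK) closed.
Qed.

End Transfer.
End Sections.

(** * The polytope of a string C-group *)

Section Gen.
Variable A : unitRingType.
Implicit Types (S H : set A) (x y : A).

Lemma gen_eq S H : subgroup H -> S `<=` H -> H `<=` gen S -> gen S = H.
Proof.
by move=> gH SH HS; apply/seteqP; split=> //; exact: smallest_sub.
Qed.

Lemma sub_gen S : S `<=` gen S. Proof. exact: sub_gen_smallest. Qed.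

Lemma gen1 S : gen S 1. Proof. by move=> H [[_ h _ _] _]. Qed.

Lemma genM S x y : gen S x -> gen S y -> gen S (x * y).
Proof.
by move=> hx hy H hH; have [[_ _ h _] _] := hH; apply: h; [exact: hx|exact: hy].
Qed.

Lemma genV S x : gen S x -> gen S x^-1.
Proof. by move=> hx H hH; have [[_ _ _ h] _] := hH; apply: h; exact: hx. Qed.

Lemma gen_mono S S' : S `<=` S' -> gen S `<=` gen S'.
Proof.
move=> le x hx H [gH S'H]; apply: hx; split=> //.
exact: subset_trans le S'H.
Qed.

Section Cosets.
Variable H : set A.
Hypothesis gH : subgroup H.

Lemma rcoset_mem a : Defs.rcoset H a a.
Proof. by exists 1; [case: gH | rewrite mul1r]. Qed.

Lemma rcoset_eqP a b : b \is a GRing.unit -> Defs.rcoset H a = Defs.rcoset H b <-> H (a * b^-1).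
Proof.
case: gH => uH H1 HM HV ub; split=> [e|h].
  have := rcoset_mem a; rewrite e => -[k hk <-].
  by rewrite mulrK.
apply/seteqP; split=> _ [k hk <-].
  by exists (k * (a * b^-1)); [exact: HM | rewrite mulrA mulrVK].
exists (k * (a * b^-1)^-1); first by apply: HM => //; exact: HV.
by rewrite /= -mulrA -[X in _^-1 * X](divrK ub) mulKr // uH.
Qed.

Lemma rcoset_mem_eq a g : g \is a GRing.unit -> Defs.rcoset H a g ->
  Defs.rcoset H g = Defs.rcoset H a.
Proof.
move=> ug [k hk e]; apply/esym/rcoset_eqP => //.
have uk : k \is a GRing.unit by case: gH => uH _ _ _; exact: uH.
case: gH => _ _ _ HV; rewrite -e.
have ua : a \is a GRing.unit by rewrite -(unitrMr a uk) e.
by rewrite invrM // mulrA divrr // mul1r; exact: HV.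
Qed.

End Cosets.
End Gen.

Section StringC.
Variables (A : unitRingType) (n : nat) (t : 'I_n -> A).

(** The value of a word in the generators. *)
Definition mprod (w : seq 'I_n) : A := \prod_(i <- w) t i.

Lemma mprod_cat u v : mprod (u ++ v) = mprod u * mprod v.
Proof. exact: big_cat. Qed.

Lemma mprod_cons i w : mprod (i :: w) = t i * mprod w.
Proof. exact: big_cons. Qed.

Hypothesis t2 : forall i, t i * t i = 1.

Lemma t_unit i : t i \is a GRing.unit.
Proof. by apply/unitrP; exists (t i). Qed.

Lemma t_inv i : (t i)^-1 = t i.
Proof. by rewrite -[LHS]mulr1 -(t2 i) mulKr // t_unit. Qed.

Lemma mprod_unit w : mprod w \is a GRing.unit.
Proof.
elim: w => [|i w IH]; first by rewrite /mprod big_nil unitr1.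
by rewrite mprod_cons unitrMr // t_unit.
Qed.

Lemma mprod_rev w : mprod (rev w) = (mprod w)^-1.
Proof.
elim: w => [|i w IH]; first by rewrite /mprod !big_nil invr1.
rewrite rev_cons -cats1 mprod_cat IH (mprod_cons i w).
rewrite invrM ?t_unit ?mprod_unit //.
by rewrite mprod_cons /mprod big_nil mulr1 t_inv.
Qed.

Lemma mprod_words_subgroup (I : set 'I_n) :
  subgroup [set mprod w | w in [set w : seq 'I_n | {in w, forall i, I i}]].
Proof.
split.
- by move=> _ [w _ <-]; exact: mprod_unit.
- by exists [::] => //; rewrite /mprod big_nil.
- move=> _ _ [v hv <-] [w hw <-]; exists (v ++ w); last exact: mprod_cat.
  by move=> i; rewrite mem_cat => /orP[/hv|/hw].
- move=> _ [w hw <-]; exists (rev w); last exact: mprod_rev.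
  by move=> i; rewrite mem_rev; exact: hw.
Qed.

(** The subgroup generated by some of the involutions [t i] consists of the
    values of the words in these letters. *)
Lemma gen_words (I : set 'I_n) :
  gen (t @` I) = [set mprod w | w in [set w : seq 'I_n | {in w, forall i, I i}]].
Proof.
apply: gen_eq; first exact: mprod_words_subgroup.
  move=> _ [i Ii <-]; exists [:: i]; last by rewrite /mprod big_seq1.
  by move=> j; rewrite inE => /eqP->.
move=> _ [w hw <-]; elim: w hw => [_|i w IH hw].
  by rewrite /mprod big_nil; exact: gen1.
rewrite mprod_cons; apply: genM; last first.
  by apply: IH => j jw; apply: hw; rewrite inE jw orbT.
by apply: sub_gen; exists i => //; apply: hw; rewrite mem_head.
Qed.

Lemma gen_t_subgroup (I : set 'I_n) : subgroup (gen (t @` I)).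
Proof. rewrite gen_words; exact: mprod_words_subgroup. Qed.

Let G := gen (range t).

Lemma G_unit a : G a -> a \is a GRing.unit.
Proof. by case: (gen_t_subgroup setT) => h _ _ _; exact: h. Qed.

Let X := {a | G a}.

(** The [j]-adjacent flag of the flag [a] of the coset polytope. *)
Definition cadj (j : nat) (x : X) : X :=
  if insub j is Some i then
    exist _ (t i * sval x) (genM (sub_gen (imageT t i)) (svalP x))
  else x.

Lemma cadjE (i : 'I_n) x : sval (cadj i x) = t i * sval x.
Proof. by rewrite /cadj valK. Qed.

Lemma walk_cadj (w : seq 'I_n) x :
  sval (walk cadj x [seq val i | i <- w]) = (mprod w)^-1 * sval x.
Proof.
elim: w x => [|i w IH] x /=; first by rewrite /mprod big_nil invr1 mul1r.
by rewrite IH cadjE mprod_cons invrM ?t_unit ?mprod_unit // t_inv mulrA.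
Qed.

Lemma cadj_inj x y : sval x = sval y -> x = y :> X.
Proof.
case: x y => [a ha] [b hb] /= e; subst b; congr exist; exact: Prop_irrelevance.
Qed.

Lemma walk_cadj_id (w : seq 'I_n) x :
  walk cadj x [seq val i | i <- w] = x <-> mprod w = 1.
Proof.
split=> [/(congr1 sval)|e]; last first.
  by apply: cadj_inj; rewrite walk_cadj e invr1 mul1r.
rewrite walk_cadj => e; apply: invr_inj; rewrite invr1.
apply: (mulIr (G_unit (svalP x))); by rewrite e mul1r.
Qed.

Definition coset_face (j : 'I_n) (x : X) :
    proper_cosets G (string_C_stab t) :=
  SigSub (mem_set (ex_intro2 _ (fun a => Defs.rcoset (string_C_stab t j) (sval x) =
    Defs.rcoset (string_C_stab t j) a) _ (svalP x) erefl) :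
    (j, Defs.rcoset (string_C_stab t j) (sval x)) \in
      [set F : 'I_n * set A |
        exists2 a, G a & F.2 = Defs.rcoset (string_C_stab t F.1) a]).

(** The face of rank [r - 1] of the flag [x]. *)
Definition cphi (r : nat) (x : X) : string_C_polytope t :=
  if r is j.+1 then
    if insub j is Some i then Proper (coset_face i x) else Greatest
  else Least.

Hypothesis sC : string_C_group t.

Lemma cphiE (i : 'I_n) x : cphi i.+1 x = Proper (coset_face i x).
Proof. by rewrite /cphi valK. Qed.

Lemma cphi_top x : cphi n.+1 x = Greatest.
Proof. by rewrite /cphi insubF // ltnn. Qed.

Lemma stab_sub j : string_C_stab t j `<=` G.
Proof. by apply: gen_mono => _ [i _ <-]; exists i. Qed.

Lemma cphi_eqP (i : 'I_n) x y :
  cphi i.+1 x = cphi i.+1 y <-> string_C_stab t i (sval x * (sval y)^-1).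
Proof.
rewrite -rcoset_eqP; [|exact: gen_t_subgroup|exact: G_unit (svalP y)].
rewrite !cphiE; split=> [[] //|e].
by congr Proper; apply: val_inj => /=; rewrite e.
Qed.

Lemma index_cases r : (r <= n.+1)%N ->
  r = 0%N \/ r = n.+1 \/ exists i : 'I_n, r = i.+1.
Proof.
case: r => [|r] hr; first by left.
right; case: (ltnP r n) => h; first by right; exists (Ordinal h).
by left; congr S; apply/eqP; rewrite eqn_leq h andbT.
Qed.

Lemma coset_presents : presents n cphi.
Proof.
have bot x y : cphi 0 x = cphi 0 y by [].
have top x y : cphi n.+1 x = cphi n.+1 y by rewrite !cphi_top.
have one : G 1 by exact: gen1.
split=> //.
- case=> [|F|].
  + by exists 0%N, (exist _ 1 one).
  + have [a Ga e] := set_valP F.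
    exists (val F).1.+1, (exist _ a Ga); split.
      by rewrite ltnS ltnW.
    rewrite cphiE; congr Proper; apply: val_inj => /=.
    rewrite -e; exact: surjective_pairing.
  + by exists n.+1, (exist _ 1 one); rewrite cphi_top.
- move=> r x /index_cases[->|[->|[i ->]]].
  + by rewrite sub0r.
  + by rewrite cphi_top /= -addn1 PoszD addrK.
  + by rewrite cphiE /= -[in RHS]addn1 PoszD addrK.
- move=> r s x y /index_cases[->|[->|[i ->]]].
  + by move=> hs; split=> // _; split=> //; exists y.
  + move=> /index_cases[->|[->|[j ->]]].
    * by rewrite cphi_top; split=> [[]|[]].
    * by rewrite !cphi_top; split=> // _; split=> //; exists x; rewrite !cphi_top.
    * rewrite cphi_top cphiE; split=> [[]|[]].
      by rewrite ltnS leqNgt ltn_ord.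
  + move=> /index_cases[->|[->|[j ->]]].
    * by rewrite cphiE; split=> [[]|[]].
    * rewrite cphi_top cphiE; split=> // _; split; first by rewrite ltnS ltnW.
      by exists x; rewrite cphi_top cphiE.
    * have -> : fle (cphi i.+1 x) (cphi j.+1 y) = ((i <= j)%N /\
          Defs.rcoset (string_C_stab t i) (sval x) `&`
          Defs.rcoset (string_C_stab t j) (sval y) !=set0) by rewrite !cphiE.
      rewrite ltnS; split=> -[ij [z]].
        move=> -[[h hh e1] [k hk e2]]; split=> //.
        have Gz : G z by rewrite -e1; apply: genM (svalP x); exact: stab_sub hh.
        have uz := G_unit Gz.
        exists (exist _ z Gz).
        have ux := G_unit (svalP x); have uy := G_unit (svalP y).
        by split; apply/cphi_eqP => /=;
          [rewrite -e1|rewrite -e2]; rewrite mulrK.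
      move=> [/cphi_eqP e1 /cphi_eqP e2]; split=> //.
      exists (sval z); split.
        by exists (sval z * (sval x)^-1); rewrite ?mulrVK //; apply: G_unit;
          exact: svalP.
      by exists (sval z * (sval y)^-1); rewrite ?mulrVK //; apply: G_unit;
        exact: svalP.
Qed.

Let tcomm (i j : 'I_n) : (i.+1 < j)%N -> t i * t j = t j * t i.
Proof.
move=> ij; have [_ h _] := sC; have := h i j (or_introl ij); rewrite expr2 => e.
have uij : t i * t j \is a GRing.unit by rewrite unitrMr t_unit.
apply: (mulIr uij); rewrite e mulrA -[_ * t i * t i]mulrA t2 mulr1.
by rewrite t2.
Qed.

Let IC (I J : set 'I_n) x : gen (t @` I) x -> gen (t @` J) x ->
  gen (t @` (I `&` J)) x.
Proof. by move=> hI hJ; have [_ _ <-] := sC. Qed.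

(** By the intersection condition, the stabilizers of the faces of ranks outside
    [I] intersect in the subgroup generated by the letters in [I]. *)
Let stab_cap (I : set 'I_n) x : G x ->
  (forall i, ~ I i -> string_C_stab t i x) -> gen (t @` I) x.
Proof.
move=> Gx h; suff : forall s : seq 'I_n,
    gen (t @` [set j | I j \/ j \notin s]) x.
  move=> /(_ (enum 'I_n)); congr (gen (t @` _) x).
  by apply/seteqP; split=> j; rewrite /= mem_enum; [case|left].
elim=> [|i s IH].
  by apply: gen_mono Gx => _ [j _ <-]; exists j => //; right.
case: (pselect (I i)) => Ii.
  apply: gen_mono IH => _ [j [hj|hj] <-]; exists j => //; first by left.
  by case: (eqVneq j i) => [->|ji]; [left|right; rewrite inE negb_or ji].
have := IC IH (h i Ii); apply: gen_mono => _ [j [[hj|hj] /= ji] <-].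
  by exists j => //; left.
by exists j => //; right; rewrite inE negb_or hj andbT; apply/eqP.
Qed.

Let below (i : 'I_n) := [set j : 'I_n | (j < i)%N].
Let above (i : 'I_n) := [set j : 'I_n | (i < j)%N].

(** The generators below [i] commute with those above [i]. *)
Let stab_factor (i : 'I_n) x : string_C_stab t i x ->
  exists u v, [/\ gen (t @` below i) u, gen (t @` above i) v & x = v * u].
Proof.
rewrite /string_C_stab gen_words => -[w hw <-].
elim: w hw => [_|j w IH hw].
  by exists 1, 1; split; rewrite ?mulr1 /mprod ?big_nil //; exact: gen1.
have [|u [v [hu hv e]]] := IH.
  by move=> k kw; apply: hw; rewrite inE kw orbT.
have ji : j <> i by apply: hw; rewrite mem_head.
rewrite mprod_cons e; have [lt|gt|e'] := ltngtP j i.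
- exists (t j * u), v; split=> //.
    by apply: genM hu; apply: sub_gen; exists j.
  suff -> : v * (t j * u) = t j * v * u by rewrite mulrA.
  rewrite mulrA; congr (_ * _).
  move: hv; rewrite gen_words => -[v' hw' <-].
  elim: v' hw' => [_|k v' IH' hw']; first by rewrite /mprod big_nil mulr1 mul1r.
  rewrite mprod_cons -mulrA IH'; last first.
    by move=> l lw; apply: hw'; rewrite inE lw orbT.
  rewrite mulrA -tcomm ?mulrA //.
  by have := hw' k (mem_head _ _); rewrite /above /=; lia.
- exists u, (t j * v); split=> //; last by rewrite mulrA.
  by apply: genM hv; apply: sub_gen; exists j.
- by case: ji; apply: val_inj.
Qed.

Let gen_stab (I : set 'I_n) i x : ~ I i -> gen (t @` I) x ->
  string_C_stab t i x.
Proof.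
move=> ni; apply: gen_mono => _ [j hj <-]; exists j => // e.
by apply: ni; rewrite -e.
Qed.

(** The flags of the coset polytope are the elements of the group. *)
Lemma coset_flag_system : flag_system n cphi cadj.
Proof.
have uX (x : X) : sval x \is a GRing.unit by apply: G_unit; exact: svalP.
have cE j (jn : (j < n)%N) x : sval (cadj j x) = t (Ordinal jn) * sval x.
  exact: (cadjE (Ordinal jn)).
have adj_same i j x : (j < n)%N -> i != j.+1 -> (i <= n.+1)%N ->
    cphi i (cadj j x) = cphi i x.
  move=> jn ij /index_cases[->//|[->|[k ek]]]; first by rewrite !cphi_top.
  rewrite ek; apply/cphi_eqP; rewrite (cE _ jn) mulrK //.
  apply: sub_gen; exists (Ordinal jn) => // e; move/eqP: ij; apply.
  by rewrite ek -e.
have inj x y : (forall r, (r <= n.+1)%N -> cphi r x = cphi r y) -> x = y.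
  move=> h; apply: cadj_inj.
  have : gen (t @` set0) (sval x * (sval y)^-1).
    apply: stab_cap => [|i _].
      by apply: genM; [exact: svalP | apply: genV; exact: svalP].
    by apply/cphi_eqP; apply: h; rewrite ltnS ltnW.
  rewrite gen_words => -[[|i w] hw].
    by rewrite /mprod big_nil => e; rewrite -[LHS](mulrVK (uX y)) -e mul1r.
  by have := hw i (mem_head _ _).
split=> //.
- by move=> x y; rewrite !cphi_top.
- move=> r x y /index_cases[->|[->|[i ->]]].
  + by move=> _; exists y; split=> // i; rewrite leqn0 => /eqP->.
  + move=> _; exists x; split=> // i h1 h2.
    have -> : i = n.+1 by apply/eqP; rewrite eqn_leq h1 h2.
    by rewrite !cphi_top.
  move=> /cphi_eqP /stab_factor[u [v [hu hv e]]].
  have Gz : G (v^-1 * sval x).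
    apply: genM (svalP x); apply: genV; apply: gen_mono hv.
    by move=> _ [j _ <-]; exists j.
  exists (exist _ _ Gz); split=> [k|k].
    move=> ki; have : (k <= n.+1)%N by apply: leq_trans ki _; rewrite ltnS ltnW.
    move=> /index_cases[->//|[->|[j ej]]]; first by rewrite !cphi_top.
    rewrite ej; apply/cphi_eqP; rewrite /= mulrK //.
    apply: (gen_stab (I := above i)); last exact: genV.
    by rewrite /above /=; lia.
  move=> ki /index_cases[->//|[->|[j ej]]]; first by rewrite !cphi_top.
  rewrite ej; apply/cphi_eqP; rewrite /= -mulrA e mulrA mulVr ?mul1r; last first.
    by apply: G_unit; apply: gen_mono hv => _ [l _ <-]; exists l.
  apply: (gen_stab (I := below i)) hu.
  by rewrite /below /=; lia.
- by move=> j i x; exact: adj_same.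
- move=> j x jn e; have [t_ord _ _] := sC; have [_ _ tn1] := t_ord (Ordinal jn).
  apply: (tn1 1%N isT); rewrite expr1.
  suff /(congr1 sval) e' : cadj j x = x.
    apply: (mulIr (uX x)); rewrite mul1r -{2}e'.
    by rewrite (cE _ jn).
  apply: inj => r hr; have [->//|rj] := eqVneq r j.+1; exact: adj_same.
- move=> j x y jn h; pose i := Ordinal jn.
  have : gen (t @` [set i]) (sval y * (sval x)^-1).
    apply: stab_cap => [|k ki].
      by apply: genM; [exact: svalP | apply: genV; exact: svalP].
    apply/cphi_eqP; apply: h; last by rewrite ltnS ltnW.
    by apply/eqP => -[e]; apply: ki; apply: val_inj.
  rewrite gen_words => -[w hw e].
  have {hw} : sval y = sval x \/ sval y = t i * sval x.
    rewrite -[sval y](mulrVK (uX x)) -e.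
    elim: w hw {e} => [_|k w IH hw]; first by left; rewrite /mprod big_nil mul1r.
    have -> : k = i by apply: hw; rewrite mem_head.
    rewrite mprod_cons -mulrA; case: IH => [l lw|->|->].
    + by apply: hw; rewrite inE lw orbT.
    + by right.
    + by left; rewrite mulrA t2 mul1r.
  case=> e'; [left|right]; apply: cadj_inj => //.
  by rewrite (cE _ jn).
- move=> x y.
  pose I := [set i : 'I_n | cphi i.+1 x <> cphi i.+1 y].
  have : gen (t @` I) (sval x * (sval y)^-1).
    apply: stab_cap => [|i ni].
      by apply: genM; [exact: svalP | apply: genV; exact: svalP].
    by apply/cphi_eqP; apply: contrapT.
  rewrite gen_words => -[w hw e].
  exists [seq val i | i <- w]; split.
  + by apply/allP => _ /mapP[i _ ->]; exact: (ltn_ord i).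
  + apply: cadj_inj; rewrite walk_cadj e invrM ?unitrV // invrK.
    by rewrite -mulrA mulVr // mulr1.
  + by move=> _ /mapP[i /hw hi ->].
Qed.

End StringC.

(** * Signed permutation matrices *)

Section Codes.
Variable K : numFieldType.

(** A signed permutation: its [i]-th entry consists of the image of [i] and of a
    sign, [true] being the minus sign. *)
Definition code := seq (nat * bool).

(** The matrix of a signed permutation: its [i]-th row is the basis vector with
    index [p.1], negated if [p.2], where [p] is the [i]-th entry of the code. *)
Definition mxc (n : nat) (c : code) : 'M[K]_n :=
  \matrix_(i < n, j < n) ((-1) ^+ (nth (0%N, false) c i).2 *+
    ((nth (0%N, false) c i).1 == j)).

(** Composition, read from left to right like the product of the matrices. *)
Definition cmul (a b : code) : code :=
  [seq (let q := nth (0%N, false) b p.1 in (q.1, p.2 (+) q.2)) | p <- a].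

Definition idcode (n : nat) : code := [seq (i, false) | i <- iota 0 n].

(** The code of a signed permutation of [n] coordinates. *)
Definition code_wf (n : nat) (c : code) : bool :=
  [&& size c == n, all (fun p => (p.1 < n)%N) c & uniq [seq p.1 | p <- c]].

Lemma code_wf_nth n c i : code_wf n c -> (i < n)%N ->
  ((nth (0%N, false) c i).1 < n)%N.
Proof.
move=> /and3P[/eqP sz /allP h _] hi; apply: (h (nth (0%N, false) c i)).
by apply: mem_nth; rewrite sz.
Qed.

Lemma mxc_mul n a b : code_wf n a -> mxc n (cmul a b) = mxc n a *m mxc n b.
Proof.
move=> wa; apply/matrixP => i j; rewrite !mxE.
have sz : size a = n by case/and3P: wa => /eqP.
rewrite (nth_map (0%N, false)) ?sz //=.
rewrite (bigD1 (Ordinal (code_wf_nth wa (ltn_ord i)))) //= big1; last first.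
  move=> k hk; rewrite !mxE; have -> : (nth (0%N, false) a i).1 == k = false.
    by apply/negbTE/eqP => e; move/eqP: hk; apply; apply: val_inj; rewrite /= e.
  by rewrite mulr0n mul0r.
rewrite addr0 !mxE eqxx mulr1n; case: eqP => _; last by rewrite !mulr0n mulr0.
by rewrite !mulr1n signr_addb.
Qed.

Lemma mxc_id n : mxc n (idcode n) = 1%:M.
Proof.
apply/matrixP => i j; rewrite !mxE (nth_map 0%N) ?size_iota //=.
by rewrite nth_iota // add0n expr0.
Qed.

Lemma mxc_inj n a b : code_wf n a -> code_wf n b -> mxc n a = mxc n b -> a = b.
Proof.
move=> wa wb e; have [/eqP sa _ _] := and3P wa; have [/eqP sb _ _] := and3P wb.
apply: (@eq_from_nth _ (0%N, false)); first by rewrite sa.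
move=> i; rewrite sa => hi.
pose j := Ordinal (code_wf_nth wa hi).
have := congr1 (fun M : 'M_n => M (Ordinal hi) j) e; rewrite !mxE /= eqxx mulr1n.
case: (nth _ a i) => u s; case: (nth _ b i) => v s' /=.
case: eqP => [->|_]; last by move/eqP; rewrite mulr0n signr_eq0.
by rewrite mulr1n => /signr_inj ->.
Qed.

(** The same signed permutation acting on coordinates shifted by [n]. *)
Definition cshift (n : nat) (c : code) : code := [seq ((p.1 + n)%N, p.2) | p <- c].

Lemma nth_cshift n c i : (i < size c)%N -> nth (0%N, false) (cshift n c) i =
  (((nth (0%N, false) c i).1 + n)%N, (nth (0%N, false) c i).2).
Proof. by move=> hi; rewrite (nth_map (0%N, false)). Qed.

Lemma mxc_diag n a b : code_wf n a -> code_wf n b ->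
  block_mx (mxc n a) 0 0 (mxc n b) = mxc (n + n) (a ++ cshift n b).
Proof.
move=> wa wb; have [/eqP sa _ _] := and3P wa; have [/eqP sb _ _] := and3P wb.
apply/matrixP => i j; rewrite [RHS]mxE nth_cat sa.
case: (split_ordP i) => i' ->; rewrite /= ?ltn_ord ?(ltnNge (n + i')) ?leq_addr /=;
    last first.
  rewrite addKn nth_cshift ?sb //=.
  case: (split_ordP j) => j' ->; rewrite ?block_mxEdl ?block_mxEdr mxE //=
    [(_ + n)%N]addnC ?eqn_add2l //.
  by rewrite gtn_eqF // ltn_addr.
case: (split_ordP j) => j' ->; rewrite ?block_mxEul ?block_mxEur mxE //=.
by rewrite ltn_eqF // ltn_addr // code_wf_nth.
Qed.

Lemma mxc_antidiag n a b : code_wf n a -> code_wf n b ->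
  block_mx 0 (mxc n a) (mxc n b) 0 = mxc (n + n) (cshift n a ++ b).
Proof.
move=> wa wb; have [/eqP sa _ _] := and3P wa; have [/eqP sb _ _] := and3P wb.
apply/matrixP => i j; rewrite [RHS]mxE nth_cat size_map sa.
case: (split_ordP i) => i' ->; rewrite /= ?ltn_ord ?(ltnNge (n + i')) ?leq_addr /=;
    last first.
  rewrite addKn; case: (split_ordP j) => j' ->;
    rewrite ?block_mxEdl ?block_mxEdr mxE //=.
  by rewrite ltn_eqF // ltn_addr // code_wf_nth.
rewrite nth_cshift ?sa //=.
case: (split_ordP j) => j' ->; rewrite ?block_mxEul ?block_mxEur mxE //=
    [(_ + n)%N]addnC ?eqn_add2l //.
by rewrite gtn_eqF // ltn_addr.
Qed.

(** The point with coordinates [1] and [-1] given by a list of signs, [true]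
    being the minus sign. *)
Definition svec (n : nat) (v : seq bool) : 'rV[K]_n :=
  \row_(j < n) (-1) ^+ nth false v j.

(** The signs of the image of such a point by a signed permutation matrix: the
    [j]-th coordinate of the image comes from the coordinate sent to [j]. *)
Definition vact (v : seq bool) (c : code) : seq bool :=
  [seq (let i := index j [seq p.1 | p <- c] in
        nth false v i (+) (nth (0%N, false) c i).2) | j <- iota 0 (size c)].

Lemma svec_act n v c : code_wf n c -> svec n v *m mxc n c = svec n (vact v c).
Proof.
move=> wc; have [/eqP sz /allP lt un] := and3P wc.
apply/rowP => j; rewrite !mxE.
have sub : {subset [seq p.1 | p <- c] <= iota 0 n}.
  by move=> x /mapP[p hp ->]; rewrite mem_iota; exact: lt.
have [|_ mem] := uniq_min_size un sub; first by rewrite size_iota size_map sz.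
have jc : nat_of_ord j \in [seq p.1 | p <- c].
  by rewrite mem mem_iota ltn_ord.
set i := index (nat_of_ord j) [seq p.1 | p <- c].
have ic : (i < size c)%N by rewrite -(size_map fst) index_mem.
have hi : (i < n)%N by rewrite -sz.
have e : (nth (0%N, false) c i).1 = j.
  by rewrite -(nth_map _ 0%N) // nth_index.
rewrite (bigD1 (Ordinal hi)) //= big1 => [|k hk]; last first.
  rewrite !mxE; case: eqP => [e'|_]; last by rewrite mulr0n mulr0.
  case/eqP: hk; apply: val_inj => /=; rewrite /i -e'.
  rewrite -(nth_map _ 0%N); last by rewrite sz.
  by rewrite index_uniq // size_map sz.
rewrite !mxE e eqxx mulr1n addr0 -signr_addb.
by rewrite (nth_map 0%N) ?size_iota ?sz // nth_iota.
Qed.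

Lemma svec_inj n u v : size u = n -> size v = n -> svec n u = svec n v -> u = v.
Proof.
move=> su sv e; apply: (@eq_from_nth _ false); first by rewrite su.
move=> i; rewrite su => hi.
have := congr1 (fun M : 'rV_n => M 0 (Ordinal hi)) e; rewrite !mxE /=.
exact: signr_inj.
Qed.

Lemma mulmx_inv n (A B : 'M[K]_n.+1) : A * B = 1 -> A^-1 = B.
Proof.
move=> e; have [uA _] := mulmx1_unit e.
by rewrite -[LHS]mulr1 -e mulKr.
Qed.

End Codes.

(** The codes of the matrices [sigma1], [sigma2] and [sigma3]. *)
Definition s1 : code := [:: (3, true); (0, false); (1, false); (2, false)]%N.
Definition s2 : code := [:: (1, false); (3, false); (2, false); (0, false)]%N.
Definition s3 : code := [:: (0, false); (3, false); (1, false); (2, false)]%N.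
(** The codes of [sigmabar1] and [sigmabar2]; the third generator is the same. *)
Definition b1 : code := [:: (1, false); (2, false); (3, false); (0, true)]%N.
Definition b2 : code := cmul (cmul s1 s1) s2.

(** The codes of the generators of [T]. *)
Definition tcodes : seq code :=
  let t0 := cshift 4 (idcode 4) ++ idcode 4 in
  let t1 := cmul t0 (s1 ++ cshift 4 b1) in
  let t2 := cmul t1 (s2 ++ cshift 4 b2) in
  let t3 := cmul t2 (s3 ++ cshift 4 s3) in
  [:: t0; t1; t2; t3].

Section Generators.
Variable K : realType.

Ltac entries := apply/matrixP => -[[|[|[|[|//]]]] hi] [[|[|[|[|//]]]] hj];
  rewrite !mxE /= ?mxE /= ?mulr1n ?mulr0n ?expr0 ?expr1 ?oppr0 //.

Lemma sigma1E : sigma1 K = mxc K 4 s1. Proof. entries. Qed.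
Lemma sigma2E : sigma2 K = mxc K 4 s2. Proof. entries. Qed.
Lemma sigma3E : sigma3 K = mxc K 4 s3. Proof. entries. Qed.

Lemma sigmabar1E : sigmabar1 K = mxc K 4 b1.
Proof.
apply: mulmx_inv; rewrite sigma1E -[LHS]/(mxc K 4 s1 *m mxc K 4 b1).
by rewrite -mxc_mul //; exact: mxc_id.
Qed.

Lemma sigmabar2E : sigmabar2 K = mxc K 4 b2.
Proof.
rewrite /sigmabar2 sigma1E sigma2E expr2 -![_ * _]/(_ *m _).
by rewrite -!mxc_mul.
Qed.

Lemma tauE (j : 'I_4) : tau K j = mxc K 8 (nth [::] tcodes j).
Proof.
have e0 : tau0 K = mxc K (4 + 4) (nth [::] tcodes 0).
  by rewrite /tau0 -mxc_id mxc_antidiag.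
have e1 : kappa1 K = mxc K (4 + 4) (s1 ++ cshift 4 b1).
  by rewrite /kappa1 sigma1E sigmabar1E mxc_diag.
have e2 : kappa2 K = mxc K (4 + 4) (s2 ++ cshift 4 b2).
  by rewrite /kappa2 sigma2E sigmabar2E mxc_diag.
have e3 : kappa3 K = mxc K (4 + 4) (s3 ++ cshift 4 s3).
  by rewrite /kappa3 /sigmabar3 sigma3E mxc_diag.
case: j => [[|[|[|[|//]]]] hj]; rewrite /tau /= ?e0 ?e1 ?e2 ?e3 -?mxc_mul //.
Qed.

End Generators.

(** * Finite flag systems given by tables *)

Section Tables.
Local Open Scope nat_scope.

(** A finite flag system is stored as a map from the names of the flags to the
    pairs consisting of the list of the adjacent flags and of the list of the
    proper faces; faces of each rank are numbered separately. Only polytopes of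
    rank 4 are considered. *)
Definition table := PositiveMap.t (seq positive * seq nat).

Implicit Types (t : table) (x y : positive) (j : nat).

(** The [j]-adjacent flag. *)
Definition step t j x : positive :=
  if PositiveMap.find x t is Some r then nth x r.1 j else x.

(** The number of the [j]-face of [x]; [0] when [x] is not in the table. *)
Definition face_no t j x : nat :=
  if PositiveMap.find x t is Some r then nth 0 r.2 j else 0.

Definition in_table t x : bool :=
  if PositiveMap.find x t is Some _ then true else false.

Definition all_flags t (p : positive -> bool) : bool :=
  all (fun xr => p xr.1) (PositiveMap.elements t).

Lemma all_flagsP t p x : all_flags t p -> in_table t x -> p x.
Proof.
rewrite /in_table /all_flags; case e : PositiveMap.find => [r|//] h _.
have := PositiveMap.elements_correct _ _ e.
elim: (PositiveMap.elements t) h => [//|q s IH] /= /andP[h1 h2] [eq|]; last exact: IH.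
by move: h1; rewrite eq.
Qed.

(** ** Strong connectedness *)

(** The faces of [x] of the ranks that are not in [m], packed in one key. That
    the key determines these faces is not needed: a collision would only make
    the connectedness check fail. *)
Definition face_key t (m : seq bool) x : positive :=
  foldr (fun j k => if nth false m j then k
    else Pos.add (Pos.of_succ_nat (face_no t j x)) (Pos.mul 128 k))
    1%positive (iota 0 4).

(** For each set [m] of ranks: a representative of each class of flags with the
    same faces outside [m], and for each flag a walk with letters in [m] that
    starts at the representative of its class. *)
Definition class_data : Type :=
  PositiveMap.t positive * PositiveMap.t (seq nat).

Definition class_ok t (m : seq bool) (d : class_data) x : bool :=
  match PositiveMap.find (face_key t m x) d.1, PositiveMap.find x d.2 with
  | Some r, Some w =>
      all (fun j => nth false m j && (j < 4)) w &&
      Pos.eqb (walk (step t) r w) x && in_table t r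
  | _, _ => false
  end.

(** The sixteen sets of ranks. *)
Definition masks : seq (seq bool) :=
  iter 4 (fun ms => [seq b :: m | b <- [:: true; false], m <- ms]) [:: [::]].

(** For each set of ranks, two flags with the same faces outside this set are
    joined by walks to a common representative. *)
Definition conn_ok t (ds : seq class_data) : bool :=
  (size ds == 16) &&
  all (fun md => all_flags t (class_ok t md.1 md.2)) (zip masks ds).

(** The passages to adjacent flags are involutions that change exactly one face,
    and they commute at distant ranks. *)
Definition local_ok t : bool :=
  all_flags t (fun x =>
    all (fun j => [&& in_table t (step t j x),
        Pos.eqb (step t j (step t j x)) x,
        all (fun i => (face_no t i (step t j x) == face_no t i x) == (i != j))
          (iota 0 4)
      & all (fun i => (i <= j.+1) && (j <= i.+1)
          || Pos.eqb (step t i (step t j x)) (step t j (step t i x)))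
          (iota 0 4)]) (iota 0 4)).

Section Sound.
Variable t : table.
Hypothesis lok : local_ok t.

(** The flags of the table. *)
Definition tflag : Type := {x | in_table t x}.

Lemma tflag_eq (x y : tflag) : sval x = sval y -> x = y.
Proof. by move=> e; apply: eq_sig_hprop e => z; exact: Prop_irrelevance. Qed.

Let lokP j x : j < 4 -> in_table t x ->
  [/\ in_table t (step t j x), step t j (step t j x) = x,
    forall i, i < 4 -> (face_no t i (step t j x) == face_no t i x) = (i != j)
  & forall i, i < 4 -> i.+1 < j \/ j.+1 < i ->
      step t i (step t j x) = step t j (step t i x)].
Proof.
move=> j4 hx; have /allP h := all_flagsP lok hx.
have := h j; rewrite mem_iota => /(_ j4) /and4P[h1 /Pos.eqb_spec h2 /allP h3 /allP h4].
split=> // i i4; first by have := h3 i; rewrite mem_iota => /(_ i4) /eqP.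
move=> ij; have := h4 i; rewrite mem_iota => /(_ i4) /orP[|/Pos.eqb_spec //].
by lia.
Qed.

(** The [j]-adjacent flag as a flag of the table; the identity when [j >= 4]. *)
Definition tadj (j : nat) (x : tflag) : tflag :=
  match pselect (j < 4) with
  | left h => exist _ (step t j (sval x))
      (let: And4 h1 _ _ _ := lokP h (svalP x) in h1)
  | right _ => x
  end.

Lemma tadjE j (x : tflag) : j < 4 -> sval (tadj j x) = step t j (sval x).
Proof. by rewrite /tadj; case: pselect. Qed.

(** The number of the face of rank [r - 1]; the two improper faces have number
    [0]. *)
Definition tface (r : nat) (x : tflag) : nat :=
  if r is j.+1 then if j < 4 then face_no t j (sval x) else 0 else 0.

Lemma walk_tadj (x : tflag) w : all (fun j => j < 4) w ->
  sval (walk tadj x w) = walk (step t) (sval x) w.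
Proof.
elim: w x => [//|j w IH] x /= /andP[j4 w4].
by rewrite IH // tadjE.
Qed.

Let walk_back (x y : tflag) w : all (fun j => j < 4) w ->
  walk tadj x w = y -> walk tadj y (rev w) = x.
Proof.
elim: w x => [|j w IH] x /=; first by move=> _ ->.
move=> /andP[j4 w4] h.
rewrite rev_cons -cats1 walk_cat (IH (tadj j x)) //=.
apply: tflag_eq; rewrite !tadjE //.
by have [_ -> _ _] := lokP j4 (svalP x).
Qed.

Lemma tface_adj i j (x : tflag) : j < 4 -> i != j.+1 -> tface i (tadj j x) = tface i x.
Proof.
move=> j4; case: i => [//|i] ij; rewrite /tface; case: ifP => // i4.
rewrite tadjE //; have [_ _ h _] := lokP j4 (svalP x).
by apply/eqP; rewrite h //; lia.
Qed.

Lemma tface_walk r (x : tflag) w : all (fun j => (r != j.+1) && (j < 4)) w ->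
  tface r (walk tadj x w) = tface r x.
Proof.
elim: w x => [//|j w IH] x /= /andP[/andP[rj j4] hw].
by rewrite IH // tface_adj.
Qed.

Variable ds : seq class_data.
Hypothesis cok : conn_ok t ds.

Let maskE (p : nat -> bool) : [seq p i | i <- iota 0 4] \in masks.
Proof. by rewrite /=; case: (p 0); case: (p 1); case: (p 2); case: (p 3). Qed.

Let nth_mask (p : nat -> bool) j : j < 4 ->
  nth false [seq p i | i <- iota 0 4] j = p j.
Proof. by move=> j4; rewrite (nth_map 0) ?size_iota // nth_iota. Qed.

Let face_key_eq m (x y : positive) :
  (forall j, j < 4 -> ~~ nth false m j -> face_no t j x = face_no t j y) ->
  face_key t m x = face_key t m y.
Proof.
move=> h; rewrite /face_key.
have : {subset iota 0 4 <= [pred j | j < 4]} by move=> j; rewrite mem_iota.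
elim: (iota 0 4) => [//|j s IH] sub /=.
rewrite IH; last by move=> i hi; apply: sub; rewrite inE hi orbT.
case: ifP => // /negbT hj; rewrite h //.
by apply: (sub j); rewrite mem_head.
Qed.

(** Two flags with the same faces of the ranks outside [p] are joined by a walk
    with letters in [p]. *)
Lemma tface_conn (x y : tflag) (p : nat -> bool) :
  (forall j, j < 4 -> ~~ p j -> tface j.+1 x = tface j.+1 y) ->
  exists w, all (fun j => p j && (j < 4)) w /\ walk tadj x w = y.
Proof.
move=> h; set m := [seq p i | i <- iota 0 4].
have hm j : j < 4 -> nth false m j = p j by exact: nth_mask.
pose d0 : class_data := (PositiveMap.empty _, PositiveMap.empty _).
have /andP[/eqP sz /(all_nthP ([::], d0)) dok] := cok.
have im : index m masks < size masks by rewrite index_mem; exact: maskE.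
have := dok (index m masks); rewrite size_zip sz minnn => /(_ im).
rewrite nth_zip ?sz // nth_index; last exact: maskE.
rewrite /=; move: (nth d0 ds _) => d ok.
have ke : face_key t m (sval x) = face_key t m (sval y).
  apply: face_key_eq => j j4; rewrite hm // => /(h j j4).
  by rewrite /tface j4.
have := all_flagsP ok (svalP x); have := all_flagsP ok (svalP y).
rewrite /class_ok ke.
case: PositiveMap.find => [r|//].
case: PositiveMap.find => [v|//] /andP[/andP[v1 /Pos.eqb_spec v2] hr].
case: PositiveMap.find => [u|//] /andP[/andP[u1 /Pos.eqb_spec u2] _].
pose r' : tflag := exist _ r hr.
have good s : all (fun j => nth false m j && (j < 4)) s ->
    all (fun j => p j && (j < 4)) s /\ all (fun j => j < 4) s.
  move=> /allP hs; split; apply/allP => j /hs /andP[h1 h2] //.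
  by rewrite -hm // h1.
have [u3 u4] := good u u1; have [v3 v4] := good v v1.
exists (rev u ++ v); split; first by rewrite all_cat all_rev u3.
rewrite walk_cat; have -> : walk tadj x (rev u) = r'.
  by apply: walk_back => //; apply: tflag_eq; rewrite walk_tadj.
by apply: tflag_eq; rewrite walk_tadj.
Qed.

(** The mixing and diamond properties follow from connectedness and from the
    commutation of distant adjacencies. *)
Lemma table_flag_system : flag_system 4 tface tadj.
Proof.
have adjC i j (x : tflag) : j < 4 -> i < 4 -> i.+1 < j \/ j.+1 < i ->
    tadj i (tadj j x) = tadj j (tadj i x).
  move=> j4 i4 ij; apply: tflag_eq; rewrite !tadjE //.
  by have [_ _ _ h] := lokP j4 (svalP x); rewrite h.
have inj (x y : tflag) : (forall r, r <= 5 -> tface r x = tface r y) -> x = y.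
  move=> h; have [j j4 _|w [hw <-]] := @tface_conn x y (fun _ => false).
    by apply: h; lia.
  by case: w hw.
split=> //.
- move=> r x y hr e.
  have [|w [hw wy]] := @tface_conn x y (fun j => r != j.+1).
    by move=> j _ /negPn /eqP <-.
  (* the letters below and above r commute, so that w splits *)
  have [u [v [hu hv uv]]] : exists u v, [/\ all (fun j => (j.+1 < r) && (j < 4)) u,
      all (fun j => (r < j.+1) && (j < 4)) v
      & walk tadj (walk tadj x v) u = y].
    elim: w x {e} hw wy => [|j w IH] x; first by move=> _ <-; exists [::], [::].
    move=> /= /andP[/andP[rj j4] hw] wy.
    have [u [v [hu hv uv]]] := IH (tadj j x) hw wy.
    case: (ltngtP r j.+1) rj => // rj _.
      by exists u, (j :: v); split=> //=; rewrite rj j4.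
    exists (j :: u), v; split=> //=; first by rewrite rj j4.
    rewrite -uv; congr walk; elim: v x {uv wy} hv => [//|k v IHv] x /=.
    move=> /andP[/andP[rk k4] hv].
    by rewrite IHv // adjC //; lia.
  exists (walk tadj x v); split=> i hi.
    apply: tface_walk; apply: sub_all hv => j /andP[h1 h2].
    by rewrite h2 andbT; lia.
  move=> _; rewrite -uv; apply/esym/tface_walk; apply: sub_all hu => j /andP[h1 h2].
  by rewrite h2 andbT; lia.
- by move=> j i x j4 ij _; exact: tface_adj.
- move=> j x j4 e; have [_ _ h _] := lokP j4 (svalP x).
  have := h j j4; rewrite eqxx /= => /eqP; apply.
  by move: e; rewrite /tface j4 tadjE.
- move=> j x y j4 h.
  have [|w [hw wy]] := @tface_conn x y (fun i => i == j).
    by move=> i i4 ij; apply/esym/h; lia.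
  have aa z : tadj j (tadj j z) = z.
    apply: tflag_eq; rewrite !tadjE //.
    by have [_ -> _ _] := lokP j4 (svalP z).
  have : forall z, walk tadj z w = z \/ walk tadj z w = tadj j z.
    elim: w hw {wy} => [|k w IH] /= hw z; first by left.
    move: hw => /andP[/andP[/eqP -> _] hw].
    by case: (IH hw (tadj j z)) => ->; [right|left].
  by move=> /(_ x); rewrite wy.
- move=> x y.
  have [|w [hw wy]] := @tface_conn x y (fun i => tface i.+1 x != tface i.+1 y).
    by move=> j _ /negPn /eqP.
  exists w; split=> // [|j /(allP hw) /andP[/eqP //]].
  by apply: sub_all hw => j /andP[].
Qed.

End Sound.
End Tables.

(** * Computation of the tables *)

Section Compute.
Local Open Scope nat_scope.

(** [flood st ls k todo seen] explores the graph with successor functions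
    [st j], [j] in [ls]; [seen] maps each visited point to a walk that leads to
    it, and [k] bounds the number of explored points. *)
Fixpoint flood (st : nat -> positive -> positive) (ls : seq nat) (k : nat)
    (todo : seq (positive * seq nat)) (seen : PositiveMap.t (seq nat)) :=
  match k, todo with
  | k'.+1, (x, w) :: todo' =>
      let: (todo1, seen1) := foldl (fun acc j =>
        let y := st j x in
        if PositiveMap.mem y acc.2 then acc
        else (rcons acc.1 (y, rcons w j), PositiveMap.add y (rcons w j) acc.2))
        (todo', seen) ls in
      flood st ls k' todo1 seen1
  | _, _ => seen
  end.

(** Representatives of the components of the graph, and walks from them. *)
Definition spread st ls (nodes : seq positive) :
    seq positive * PositiveMap.t (seq nat) :=
  foldl (fun acc x =>
      if PositiveMap.mem x acc.2 then acc
      else (rcons acc.1 x,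
            flood st ls (size nodes).+1 [:: (x, [::])]
              (PositiveMap.add x [::] acc.2)))
    ([::], PositiveMap.empty _) nodes.

Definition mk_map (A : Type) (s : seq (positive * A)) : PositiveMap.t A :=
  foldl (fun m p => PositiveMap.add p.1 p.2 m) (PositiveMap.empty A) s.

(** Numbers the components of the graph. *)
Definition component_no st ls nodes : positive -> nat :=
  let: (reps, ws) := spread st ls nodes in
  let num := mk_map (zip reps (iota 0 (size reps))) in
  fun x => if PositiveMap.find x ws is Some w then
      odflt 0 (PositiveMap.find (walk st x (rev w)) num)
    else 0.

(** The data that certify strong connectedness for a set [m] of ranks. *)
Definition mk_class (t : table) (nodes : seq positive) (m : seq bool) :
    class_data :=
  let: (reps, ws) := spread (step t) (mask m (iota 0 4)) nodes in
  (mk_map [seq (face_key t m r, r) | r <- reps], ws).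

Definition mk_classes t nodes : seq class_data :=
  [seq mk_class t nodes m | m <- masks].

(** A signed permutation packed in one key. *)
Definition code_key (c : code) : positive :=
  foldr (fun p k => Pos.add (Pos.of_succ_nat (p.1.*2 + nat_of_bool p.2)) (Pos.mul 32 k))
    1%positive c.

(** The elements of the group generated by a list of codes, in the order in
    which they are met when multiplying on the left by the generators, each of
    them with a word that represents it. *)
Fixpoint elements_from (gens : seq code) (k : nat) (todo : seq (code * seq nat))
    (seen : PositiveMap.t unit) (acc : seq (code * seq nat)) :=
  match k, todo with
  | k'.+1, (c, w) :: todo' =>
      let: (todo1, seen1) := foldl (fun a i =>
        let d := cmul (nth [::] gens i) c in
        if PositiveMap.mem (code_key d) a.2 then a
        else (rcons a.1 (d, i :: w), PositiveMap.add (code_key d) tt a.2))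
        (todo', seen) (iota 0 (size gens)) in
      elements_from gens k' todo1 seen1 ((c, w) :: acc)
  | _, _ => rev acc
  end.

Definition group_elements n gens k : seq (code * seq nat) :=
  elements_from gens k [:: (idcode n, [::])]
    (PositiveMap.add (code_key (idcode n)) tt (PositiveMap.empty _)) [::].

Definition numbering (s : seq code) : seq (positive * code) :=
  zip [seq Pos.of_succ_nat i | i <- iota 0 (size s)] s.

End Compute.

Definition T_elements : seq (positive * code) :=
  Eval vm_compute in numbering [seq cw.1 | cw <- group_elements 8 tcodes 800].

(** The names of the elements of [T] are the positive numbers up to 768, and
    [T_code] gives their matrices. *)
Definition T_code : PositiveMap.t code := Eval vm_compute in mk_map T_elements.

(** The element of [T] with a given matrix. *)
Definition T_index : PositiveMap.t positive :=
  Eval vm_compute in mk_map [seq (code_key p.2, p.1) | p <- T_elements].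

(** The [j]-adjacent flag of an element of [T] is its left multiple by the [j]-th
    generator; its [j]-face is its component for the multiplication by the other
    three generators. *)
Definition T_table : table := Eval vm_compute in
  let nb := mk_map [seq (p.1,
      [seq odflt 1%positive (PositiveMap.find (code_key (cmul g p.2)) T_index)
        | g <- tcodes]) | p <- T_elements] in
  let st j x := nth x (odflt [::] (PositiveMap.find x nb)) j in
  let nodes := [seq p.1 | p <- T_elements] in
  let nos := [seq component_no st (filter (predC1 j) (iota 0 4)) nodes
    | j <- iota 0 4] in
  mk_map [seq (x, (odflt [::] (PositiveMap.find x nb), [seq f x | f <- nos]))
    | x <- nodes].

Definition T_classes : seq class_data := Eval vm_compute in
  mk_classes T_table [seq p.1 | p <- T_elements].

Lemma T_local_ok : local_ok T_table.
Proof. by vm_compute. Qed.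

Lemma T_conn_ok : conn_ok T_table T_classes.
Proof. by vm_compute. Qed.

(** * The group [T] as the set of flags of a table *)

(** The names are in bijection with the matrices and the adjacencies are the left
    multiplications by the generators. *)
Definition T_codes_ok : bool :=
  all_flags T_table (fun x =>
    if PositiveMap.find x T_code is Some c then
      [&& code_wf 8 c,
          if PositiveMap.find (code_key c) T_index is Some y then Pos.eqb x y
            else false
        & all (fun j => PositiveMap.find (step T_table j x) T_code ==
                        Some (cmul (nth [::] tcodes j) c)) (iota 0 4)]
    else false).

Lemma T_codes_okE : T_codes_ok.
Proof. by vm_compute. Qed.

Section TNodes.
Variable K : realType.
Local Open Scope ring_scope.

(** The name of the identity. *)
Definition base_node : positive := 1%positive.

(** The element of [T] with a given name. *)
Definition node_mx (x : positive) : 'M[K]_8 :=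
  mxc K 8 (odflt [::] (PositiveMap.find x T_code)).

Lemma node_mx_root : node_mx base_node = 1.
Proof. exact: mxc_id. Qed.

Lemma node_mx_step (j : 'I_4) x : in_table T_table x ->
  node_mx (step T_table j x) = tau K j * node_mx x.
Proof.
move=> /(all_flagsP T_codes_okE); rewrite /node_mx.
case: PositiveMap.find => [c|//] /and3P[wc _ /allP h].
have := h j; rewrite mem_iota => /(_ (ltn_ord j)) /eqP -> /=.
rewrite tauE -[_ * _]/(_ *m _) -mxc_mul //.
by case: j {h} => [[|[|[|[|//]]]] hj].
Qed.

Lemma node_mx_inj x y : in_table T_table x -> in_table T_table y ->
  node_mx x = node_mx y -> x = y.
Proof.
have idx z : in_table T_table z -> exists c,
    [/\ PositiveMap.find z T_code = Some c, code_wf 8 c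
      & PositiveMap.find (code_key c) T_index = Some z].
  move=> /(all_flagsP T_codes_okE); case: PositiveMap.find => [c|//].
  case e : PositiveMap.find => [u|]; last by rewrite andbF.
  by move=> /and3P[wc /Pos.eqb_spec -> _]; exists c.
move=> /idx[c [ec wc ic]] /idx[d [ed wd id]].
rewrite /node_mx ec ed /= => /(mxc_inj wc wd) e.
by move: ic; rewrite e id => -[].
Qed.

Lemma step_in_T j x : (j < 4)%N -> in_table T_table x ->
  in_table T_table (step T_table j x).
Proof.
move=> hj hx; have /allP h := all_flagsP T_local_ok hx.
by have := h j; rewrite mem_iota => /(_ hj) /and4P[].
Qed.

Lemma walk_in_T w x : all (fun j => j < 4)%N w -> in_table T_table x ->
  in_table T_table (walk (step T_table) x w).
Proof.
elim: w x => [//|j w IH] x /= /andP[hj hw] hx.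
by apply: IH => //; exact: step_in_T.
Qed.

Lemma tau_sqr1 (i : 'I_4) : tau K i * tau K i = 1.
Proof.
rewrite tauE -[_ * _]/(_ *m _) -[1]/(1%:M) -mxc_id -mxc_mul.
  by case: i => [[|[|[|[|//]]]] hj].
by case: i => [[|[|[|[|//]]]] hj].
Qed.

Lemma node_mx_walk (w : seq 'I_4) x : in_table T_table x ->
  node_mx (walk (step T_table) x [seq val i | i <- w]) =
  (mprod (tau K) w)^-1 * node_mx x.
Proof.
elim: w x => [|i w IH] x hx /=; first by rewrite /mprod big_nil invr1 mul1r.
rewrite IH; last by apply: step_in_T => //; exact: ltn_ord.
rewrite node_mx_step // mprod_cons mulrA; congr (_ * _).
have ut := t_unit tau_sqr1; have um := mprod_unit tau_sqr1.
by rewrite invrM // (t_inv tau_sqr1).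
Qed.

Lemma letters_ord n (w : seq nat) : all (fun j => j < n)%N w ->
  exists v : seq 'I_n, w = [seq val i | i <- v].
Proof.
elim: w => [|j w IH] /=; first by exists [::].
by move=> /andP[hj /IH[v ->]]; exists (Ordinal hj :: v).
Qed.

Lemma letters_lt n (v : seq 'I_n) : all (fun j => j < n)%N [seq val i | i <- v].
Proof. by apply/allP => _ /mapP[i _ ->]; exact: ltn_ord. Qed.

(** A word in the generators is a relation of [T] exactly when the corresponding
    walk in the table is closed. *)
Lemma mprod_tau1 (w : seq 'I_4) : mprod (tau K) w = 1 <->
  walk (step T_table) base_node [seq val i | i <- w] = base_node.
Proof.
have h := node_mx_walk w (isT : in_table T_table base_node).
split=> e.
  apply: node_mx_inj => //; first exact: walk_in_T (letters_lt _) _.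
  by rewrite h e invr1 mul1r.
move: h; rewrite e node_mx_root mulr1 => h.
by apply: invr_inj; rewrite invr1 -h.
Qed.

Let tf := tflag T_table.
Definition T_root : tf := exist _ base_node isT.
Let ta := tadj T_local_ok.
Let tfs := table_flag_system T_local_ok T_conn_ok.

Lemma T_walk_root (w : seq 'I_4) : mprod (tau K) w = 1 <->
  walk ta T_root [seq val i | i <- w] = T_root.
Proof.
rewrite mprod_tau1; split=> [e|/(congr1 sval)].
  by apply: tflag_eq; rewrite walk_tadj ?letters_lt.
by rewrite walk_tadj ?letters_lt.
Qed.

Lemma T_node (x : tf) : exists w : seq 'I_4, walk ta T_root [seq val i | i <- w] = x.
Proof.
have [w [w1 w2 _]] := fs_conn tfs T_root x.
by have [v e] := letters_ord w1; exists v; rewrite -e.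
Qed.

Lemma tau_neq1 i : tau K i <> 1.
Proof.
move=> e; have : mprod (tau K) [:: i] = 1 by rewrite /mprod big_seq1.
by move/mprod_tau1; case: i {e} => [[|[|[|[|//]]]] hj].
Qed.

(** The intersection condition follows from strong flag-connectedness: an element
    of both subgroups is a flag that differs from the base flag at ranks in
    [I] and in [J] only, hence is reached by a walk with letters in both sets. *)
Lemma T_string_C_group : string_C_group (tau K).
Proof.
split.
- move=> i; split=> // [|[|[|//]] // _]; first by rewrite expr2 tau_sqr1.
  by rewrite expr1; exact: tau_neq1.
- move=> i j ij; rewrite expr2 mulrA.
  have := mprod_tau1 [:: i; j; i; j].
  rewrite /mprod !big_cons big_nil mulr1 !mulrA => -> /=.
  by move: ij; case: i j => [[|[|[|[|//]]]] hi] [[|[|[|[|//]]]] hj] //= [].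
move=> I J; apply/seteqP; split; last first.
  move=> x hx; split; apply: gen_mono hx => _ [i [Ii Ji] <-];
  by exists i.
move=> x [xI xJ].
have inv (H : set 'I_4) : gen (tau K @` H) x -> exists2 w : seq 'I_4,
    {in w, forall i, H i} & x = mprod (tau K) w.
  by rewrite (gen_words tau_sqr1) => -[w h <-]; exists w.
have [u uI eu] := inv I xI; have [v vJ ev] := inv J xJ.
pose y := walk ta T_root [seq val i | i <- u].
have ey : y = walk ta T_root [seq val i | i <- v].
  apply: tflag_eq; rewrite !walk_tadj ?letters_lt //.
  apply: node_mx_inj; try exact: walk_in_T (letters_lt _) _.
  by rewrite !node_mx_walk // -eu -ev.
have fixes (H : set 'I_4) (w : seq 'I_4) j (h : {in w, forall i, H i}) (j4 : (j < 4)%N) :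
    ~ H (Ordinal j4) ->
    tface j.+1 (walk ta T_root [seq val i | i <- w]) =
    tface j.+1 T_root.
  move=> nH; apply: tface_walk; apply/allP => _ /mapP[i iw ->].
  rewrite ltn_ord andbT; apply/eqP => -[e]; apply: nH.
  have -> : Ordinal j4 = i by apply: val_inj; exact: e.
  exact: h.
have [|w [hw wy]] := tface_conn T_local_ok T_conn_ok (x := T_root) (y := y)
    (p := fun j => `[< exists i : 'I_4, [/\ val i = j, I i & J i] >]).
  move=> j j4 /asboolPn no.
  have [nI|nJ] : ~ I (Ordinal j4) \/ ~ J (Ordinal j4).
    apply: contrapT => /not_orP[/contrapT h1 /contrapT h2]; case: no.
    by exists (Ordinal j4).
  - by rewrite /y (fixes I).
  - by rewrite ey (fixes J).
have w4 : all (fun j => j < 4)%N w by apply: sub_all hw => j /andP[].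
have [s es] := letters_ord w4; subst w.
have -> : x = mprod (tau K) s.
  apply: invr_inj; rewrite eu.
  have h1 := node_mx_walk u (isT : in_table T_table base_node).
  have h2 := node_mx_walk s (isT : in_table T_table base_node).
  move: h1 h2; rewrite node_mx_root !mulr1 => <- <-.
  by rewrite -!(walk_tadj T_local_ok T_root) ?letters_lt // wy.
rewrite (gen_words tau_sqr1); exists s => // i iw.
have /(allP hw) /andP[/asboolP[k [/val_inj -> Ik Jk]] _] : val i \in [seq val i | i <- s].
  exact: map_f.
by split.
Qed.

Lemma T_has_order (i j : 'I_4) n : (0 < n)%N ->
  walk (step T_table) base_node (flatten (nseq n [:: val i; val j])) = base_node ->
  all (fun m => ~~ Pos.eqb
      (walk (step T_table) base_node (flatten (nseq m [:: val i; val j]))) base_node)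
    (iota 1 n.-1) ->
  has_order (tau K i * tau K j) n.
Proof.
have pw m : (tau K i * tau K j) ^+ m = 1 <->
    walk (step T_table) base_node (flatten (nseq m [:: val i; val j])) = base_node.
  have -> : (tau K i * tau K j) ^+ m = mprod (tau K) (flatten (nseq m [:: i; j])).
    elim: m => [|m IH]; first by rewrite expr0 /mprod big_nil.
    by rewrite exprS IH /= mprod_cons mprod_cons mulrA.
  by rewrite mprod_tau1 map_flatten map_nseq.
move=> n0 hn /allP hm; split=> // [|m /andP[m0 mn]]; first exact/pw.
rewrite pw => /Pos.eqb_spec; apply/negP; apply: hm.
by rewrite mem_iota m0 /=; lia.
Qed.

End TNodes.

(** * Order and presentation of [T] *)

Section TOrder.
Variable K : realType.

Lemma T_mprod (w : seq 'I_4) : T K (mprod (tau K) w).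
Proof. by rewrite /T (gen_words (tau_sqr1 K) setT); exists w. Qed.

Lemma T_words (a : 'M[K]_8) : T K a -> exists w : seq 'I_4,
  a = node_mx K (walk (step T_table) base_node [seq val i | i <- w]).
Proof.
rewrite /T (gen_words (tau_sqr1 K) setT) => -[w _ <-]; exists (rev w).
by rewrite node_mx_walk // node_mx_root mulr1 (mprod_rev (tau_sqr1 K)) invrK.
Qed.

Lemma T_in_table_le x : in_table T_table x = Pos.leb x 768.
Proof.
apply/idP/idP => [h|/Pos.leb_spec0 h].
  have ok : all_flags T_table (fun x => Pos.leb x 768) by vm_compute.
  exact: all_flagsP ok h.
have ok : all (fun i => in_table T_table (Pos.of_succ_nat i)) (iota 0 768).
  by vm_compute.
have -> : x = Pos.of_succ_nat (Pos.to_nat x).-1.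
  by have := Pos2Nat.is_pos x; lia.
apply: (allP ok); rewrite mem_iota; have := Pos2Nat.is_pos x; lia.
Qed.

Lemma T_card : T K #= `I_768.
Proof.
have in768 i : (i < 768)%N -> in_table T_table (Pos.of_succ_nat i).
  by move=> hi; rewrite T_in_table_le; apply/Pos.leb_spec0; lia.
have -> : T K = (fun i => node_mx K (Pos.of_succ_nat i)) @` `I_768.
  apply/seteqP; split=> [a /T_words[w ->]|_ [i /= hi <-]].
    have hx := walk_in_T (letters_lt w) (isT : in_table T_table base_node).
    set x := walk _ _ _ in hx *; move: hx; rewrite T_in_table_le => /Pos.leb_spec0 hx.
    exists (Pos.to_nat x).-1; first by have := Pos2Nat.is_pos x; rewrite /=; lia.
    by congr node_mx; have := Pos2Nat.is_pos x; lia.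
  pose x : tflag T_table := exist (fun x => in_table T_table x) _ (in768 _ hi).
  have [w ew] := T_node x; rewrite -[Pos.of_succ_nat i]/(sval x) -ew.
  rewrite walk_tadj ?letters_lt // node_mx_walk // node_mx_root mulr1.
  by rewrite -(mprod_rev (tau_sqr1 K)); exact: T_mprod.
apply: inj_card_eq => i j; rewrite !inE /= => hi hj /node_mx_inj e.
have := e (in768 _ hi) (in768 _ hj); lia.
Qed.

End TOrder.

(** ** Deductions between words *)

Section Words.
Variables (n : nat) (rels : set (word n)).

Lemma word_eq_ctx u v a b : word_eq rels u v ->
  word_eq rels (a ++ u ++ b) (a ++ v ++ b).
Proof.
elim=> {u v} [w|u v _ IH|u v w _ IH1 _ IH2|u v i e|u v r hr].
- exact: word_eq_refl.
- exact: word_eq_sym.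
- exact: word_eq_trans IH1 IH2.
- by rewrite -!catA !catA -![(a ++ u) ++ _]catA; rewrite -!catA;
    have := word_eq_cancel rels (a ++ u) (v ++ b) i e; rewrite -!catA.
- by have := word_eq_rel (a ++ u) (v ++ b) hr; rewrite -!catA.
Qed.

Lemma word_eq_catr u v b : word_eq rels u v -> word_eq rels (u ++ b) (v ++ b).
Proof. exact: (@word_eq_ctx u v [::] b). Qed.

Lemma word_eq_catl u v a : word_eq rels u v -> word_eq rels (a ++ u) (a ++ v).
Proof. by move=> h; have := @word_eq_ctx u v a [::] h; rewrite !cats0. Qed.

Hypothesis square : forall i : 'I_n, word_eq rels (pos_word [:: i; i]) [::].

(** When each letter is an involution, the inverse letters are redundant. *)
Lemma word_eq_pos (w : word n) : word_eq rels w (pos_word [seq l.1 | l <- w]).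
Proof.
elim: w => [|[i e] w IH] /=; first exact: word_eq_refl.
apply: word_eq_trans (word_eq_catl [:: (i, e)] IH) _.
rewrite -[_ :: pos_word _]/([:: (i, false)] ++ _); apply: word_eq_catr.
case: e; last exact: word_eq_refl.
apply: word_eq_trans (word_eq_sym _) (word_eq_cancel rels [::] [:: (i, false)] i true).
exact: (word_eq_catl [:: (i, true)] (square i)).
Qed.

Lemma word_eq_rcancel (u v : word n) (b : seq 'I_n) :
  word_eq rels (u ++ pos_word b) (v ++ pos_word b) -> word_eq rels u v.
Proof.
elim/last_ind: b u v => [|b i IH] u v; first by rewrite !cats0.
rewrite /pos_word map_rcons -cats1 !catA => h; apply: IH.
have two x : word_eq rels ((x ++ [:: (i, false)]) ++ [:: (i, false)]) x.
  by rewrite -catA -[X in word_eq _ _ X]cats0; apply: word_eq_catl; exact: square.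
apply: word_eq_trans (word_eq_sym (two _)) _; apply: word_eq_trans _ (two _).
exact: word_eq_catr.
Qed.

End Words.

(** ** The presentation *)

(** The relators of [T] other than the squares of the generators. *)
Definition relator (k : nat) : seq nat :=
  (nth [::] [:: flatten (nseq 8 [:: 0; 1]); flatten (nseq 3 [:: 1; 2]);
    flatten (nseq 3 [:: 2; 3]); flatten (nseq 2 [:: 0; 2]);
    flatten (nseq 2 [:: 0; 3]); flatten (nseq 2 [:: 1; 3]);
    flatten (nseq 2 (flatten (nseq 3 [:: 1; 0]) ++ [:: 1; 2]))] k)%N.

(** The word of [T] with given letters. *)
Definition letters (w : seq nat) : word 4 :=
  pos_word [seq (inord j : 'I_4) | j <- w].

(** Equality of words modulo the relators. *)
Definition weq (u v : seq nat) : Prop := word_eq T_relators (letters u) (letters v).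

Lemma letters_cat u v : letters (u ++ v) = letters u ++ letters v.
Proof. by rewrite /letters /pos_word !map_cat. Qed.

Lemma T_square (i : 'I_4) : word_eq T_relators (pos_word [:: i; i]) [::].
Proof.
apply: (word_eq_rel (r := pos_word [:: i; i]) [::] [::]); left; by exists i.
Qed.

Lemma relator_weq k : weq (relator k) [::].
Proof.
rewrite /weq; case: (ltnP k 7) => hk; last first.
  by rewrite /relator nth_default //; exact: word_eq_refl.
rewrite -[letters (relator k)]cats0; apply: (word_eq_rel [::] [::]); right.
move: k hk; do 7 (case; first by rewrite !inE eqxx ?orbT).
by [].
Qed.

(** For each element of [T], a walk that leads to it from the identity. Such walks
    certify the connectedness for the set of all ranks, whence the index [0]. *)
Definition T_word (x : positive) : seq nat :=
  odflt [::] (PositiveMap.find x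
    (nth (PositiveMap.empty _, PositiveMap.empty _) T_classes 0).2).

(** An edge [(x, j)] of the Cayley graph is known when the words of [x],
    followed by [j], and of its end point have been shown to be equal. *)
Definition edge_key (x : positive) (j : nat) : positive :=
  Pos.add (Pos.of_succ_nat j) (Pos.mul 8 x).

Definition edges := PositiveMap.t unit.

(** An edge is known together with the reverse edge. *)
Definition add_edge (x : positive) (j : nat) (S : edges) : edges :=
  PositiveMap.add (edge_key x j) tt
    (PositiveMap.add (edge_key (step T_table j x) j) tt S).

Fixpoint known_path (S : edges) (x : positive) (w : seq nat) : bool :=
  if w is j :: w' then
    PositiveMap.mem (edge_key x j) S && known_path S (step T_table j x) w'
  else true.

(** A deduction: the relator number [k], read from [x], has only known edges
    except at the place [p], so that this last edge is known too. *)
Definition deduce (S : edges) (d : positive * (nat * nat)) : edges :=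
  let: (x, (k, p)) := d in
  let r := relator k in
  let j := nth 0%N r p in
  let y := walk (step T_table) x (take p r) in
  if [&& (p < size r)%N, in_table T_table x, known_path S x (take p r),
      known_path S (step T_table j y) (drop p.+1 r)
    & Pos.eqb (walk (step T_table) x r) x]
  then add_edge y j S else S.

(** The edges of the spanning tree given by the words. *)
Definition tree_edges : edges :=
  foldl (fun S xr => let x := xr.1 in
    let j := last 0%N (T_word x) in
    if [&& (j < 4)%N, in_table T_table x
        & T_word x == rcons (T_word (step T_table j x)) j]
    then add_edge x j S else S)
    (PositiveMap.empty _) (PositiveMap.elements T_table).

(** The deduction that the relator number [k] allows at [x], when exactly one of
    its edges is unknown. *)
Definition find_deduction (S : edges) (x : positive) (k : nat) :
    seq (positive * (nat * nat)) :=
  let fix unknown y p w := if w is j :: w' then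
      let rest := unknown (step T_table j y) p.+1 w' in
      if PositiveMap.mem (edge_key y j) S then rest else p :: rest
    else [::] in
  if unknown x 0%N (relator k) is [:: p] then [:: (x, (k, p))] else [::].

(** All the deductions found when the elements and the relators are gone through
    once, with the edges known at the end. *)
Definition find_deductions (S : edges) : seq (positive * (nat * nat)) * edges :=
  foldl (fun acc xk => let ds := find_deduction acc.2 xk.1 xk.2 in
      (acc.1 ++ ds, foldl deduce acc.2 ds))
    ([::], S) [seq (xr.1, k) | xr <- PositiveMap.elements T_table, k <- iota 0 7].

(** Two rounds of deductions suffice to reach all the edges. *)
Definition T_deductions : seq (positive * (nat * nat)) := Eval vm_compute in
  (let: (ds, known) := find_deductions tree_edges in
   ds ++ (find_deductions known).1).

Definition all_known : bool :=
  let S := foldl deduce tree_edges T_deductions in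
  all_flags T_table (fun x =>
    all (fun j => PositiveMap.mem (edge_key x j) S) (iota 0 4)).

Lemma T_all_known : all_known.
Proof. by vm_compute. Qed.

Lemma weq_trans u v w : weq u v -> weq v w -> weq u w.
Proof. exact: word_eq_trans. Qed.

Lemma weq_sym u v : weq u v -> weq v u.
Proof. exact: word_eq_sym. Qed.

Lemma weq_catr u v w : weq u v -> weq (u ++ w) (v ++ w).
Proof. by rewrite /weq !letters_cat; exact: word_eq_catr. Qed.

Lemma weq_catl u v w : weq u v -> weq (w ++ u) (w ++ v).
Proof. by rewrite /weq !letters_cat; exact: word_eq_catl. Qed.

Lemma weq_rcancel u v w : weq (u ++ w) (v ++ w) -> weq u v.
Proof. by rewrite /weq !letters_cat; apply: word_eq_rcancel; exact: T_square. Qed.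

Lemma weq_square u j : weq (u ++ [:: j; j]) u.
Proof.
by rewrite -[X in weq _ X]cats0; apply: weq_catl; exact: T_square.
Qed.

Lemma T_stepK j x : (j < 4)%N -> in_table T_table x ->
  step T_table j (step T_table j x) = x.
Proof.
move=> hj hx; have /allP h := all_flagsP T_local_ok hx.
by have := h j; rewrite mem_iota => /(_ hj) /and4P[_ /Pos.eqb_spec].
Qed.

(** The known edges give equalities of words modulo the relators. *)
Definition sound_edges (S : edges) : Prop := forall x j,
  in_table T_table x -> (j < 4)%N -> PositiveMap.mem (edge_key x j) S ->
  weq (T_word x ++ [:: j]) (T_word (step T_table j x)).

Lemma edge_key_inj x y i j : (i < 4)%N -> (j < 4)%N ->
  edge_key x i = edge_key y j -> x = y /\ i = j.
Proof. rewrite /edge_key => hi hj e; split; lia. Qed.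

Lemma mem_add_edge p q (S : edges) :
  PositiveMap.mem p (PositiveMap.add q tt S) -> p = q \/ PositiveMap.mem p S.
Proof.
rewrite !PositiveMap.mem_find.
case: (Pos.eq_dec p q) => [->|ne]; first by left.
by rewrite PositiveMap.gso //; right.
Qed.

Lemma sound_add_edge x j S : in_table T_table x -> (j < 4)%N ->
  weq (T_word x ++ [:: j]) (T_word (step T_table j x)) ->
  sound_edges S -> sound_edges (add_edge x j S).
Proof.
move=> hx hj h sS y i hy hi /mem_add_edge[|/mem_add_edge[|]]; last exact: sS.
  by move=> /(edge_key_inj hi hj)[-> ->].
move=> /(edge_key_inj hi hj)[-> ->]; rewrite T_stepK //.
apply: weq_trans (weq_square (T_word x) j).
rewrite -[[:: j; j]]/([:: j] ++ [:: j]) catA.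
by apply: weq_catr; exact: weq_sym.
Qed.

Lemma sound_known_path S w x : sound_edges S -> in_table T_table x ->
  all (fun j => j < 4)%N w -> known_path S x w ->
  weq (T_word x ++ w) (T_word (walk (step T_table) x w)).
Proof.
move=> sS; elim: w x => [|j w IH] x hx /=.
  by rewrite cats0 => _ _; exact: word_eq_refl.
move=> /andP[hj hw] /andP[ke kp].
apply: weq_trans (IH _ (step_in_T hj hx) hw kp).
by rewrite -[j :: w]/([:: j] ++ w) catA; apply: weq_catr; exact: sS.
Qed.

Lemma relator_letters k : all (fun j => j < 4)%N (relator k).
Proof.
case: (ltnP k 7) => hk; last by rewrite /relator nth_default.
by move: k hk; do 7 (case=> //).
Qed.

Lemma sound_deduce S d : sound_edges S -> sound_edges (deduce S d).
Proof.
case: d => [x [k p]] sS; rewrite /deduce.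
set r := relator k; set j := nth _ r p; set y := walk _ x _.
case: ifP => // /and5P[hp hx k1 k2 /Pos.eqb_spec closed].
have r4 := relator_letters k; rewrite -/r in r4.
have r1 : all (fun j => j < 4)%N (take p r).
  by apply/allP => i /mem_take; exact: (allP r4).
have r2 : all (fun j => j < 4)%N (drop p.+1 r).
  by apply/allP => i /mem_drop; exact: (allP r4).
have hj : (j < 4)%N by apply: (allP r4); exact: mem_nth.
have hy : in_table T_table y by exact: walk_in_T.
have er : r = take p r ++ j :: drop p.+1 r by rewrite -drop_nth // cat_take_drop.
apply: sound_add_edge => //; apply: (@weq_rcancel _ _ (drop p.+1 r)).
rewrite -catA.
have e1 : weq (T_word y ++ [:: j] ++ drop p.+1 r) (T_word x).
  apply: weq_trans (_ : weq (T_word x ++ r) _).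
    have -> : T_word x ++ r = (T_word x ++ take p r) ++ ([:: j] ++ drop p.+1 r).
      by rewrite -catA /= -er.
    apply: weq_catr; apply: weq_sym; exact: (sound_known_path sS hx r1 k1).
  by rewrite -[X in weq _ X]cats0; apply: weq_catl; exact: relator_weq.
apply: weq_trans e1 (weq_sym _).
have := sound_known_path sS (step_in_T hj hy) r2 k2.
by have -> : walk (step T_table) (step T_table j y) (drop p.+1 r) = x;
  first by rewrite -[RHS]closed [in RHS]er walk_cat.
Qed.

Lemma sound_foldl (I : Type) (f : edges -> I -> edges) s S :
  (forall S i, sound_edges S -> sound_edges (f S i)) ->
  sound_edges S -> sound_edges (foldl f S s).
Proof. by move=> hf; elim: s S => [//|i s IH] S hS /=; apply: IH; exact: hf. Qed.

Lemma T_word_step x j : in_table T_table x -> (j < 4)%N ->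
  weq (T_word x ++ [:: j]) (T_word (step T_table j x)).
Proof.
move=> hx hj; have /allP h := all_flagsP T_all_known hx.
have := h j; rewrite mem_iota => /(_ hj).
have tree : sound_edges tree_edges.
  rewrite /tree_edges; apply: sound_foldl => [S xr sS|y i _ _]; last first.
    by rewrite PositiveMap.mem_find PositiveMap.gempty.
  case: ifP => // /and3P[h4 hx' /eqP e]; apply: sound_add_edge => //.
  by rewrite {1}e -cats1 -catA; exact: weq_square.
have snd : sound_edges (foldl deduce tree_edges T_deductions).
  by apply sound_foldl => // S d; exact: sound_deduce.
exact: (snd x j hx hj).
Qed.

(** Every word is equal modulo the relators to the word chosen for its value. *)
Lemma T_word_walk (w : seq nat) : all (fun j => j < 4)%N w ->
  weq w (T_word (walk (step T_table) base_node w)).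
Proof.
elim/last_ind: w => [_|w j IH]; first exact: word_eq_refl.
rewrite all_rcons => /andP[hj hw]; rewrite -cats1 walk_cat /=.
apply: weq_trans (weq_catr _ (IH hw)) (T_word_step _ hj).
exact: walk_in_T.
Qed.

Section Presentation.
Variable K : realType.

Lemma eval_word_cat (u v : word 4) :
  eval_word (tau K) (u ++ v) = eval_word (tau K) u * eval_word (tau K) v.
Proof. exact: big_cat. Qed.

Lemma eval_word_pos (w : seq 'I_4) : eval_word (tau K) (pos_word w) = mprod (tau K) w.
Proof. by rewrite /eval_word big_map. Qed.

Lemma val_letters (w : seq nat) : all (fun j => j < 4)%N w ->
  [seq val i | i <- [seq (inord j : 'I_4) | j <- w]] = w.
Proof.
move=> /allP h; rewrite -map_comp -[RHS]map_id; apply/eq_in_map => j /h hj.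
by rewrite /= inordK.
Qed.

Lemma T_relatorsP r : T_relators r ->
  (exists j, r = pos_word [:: j; j]) \/ exists k, r = letters (relator k).
Proof.
case=> [[j ->]|]; first by left; exists j.
rewrite !inE => h; right; move: h.
do 6 (case/orP=> [/eqP ->|]; first by
  (exists 0%N + exists 1%N + exists 2%N + exists 3%N + exists 4%N + exists 5%N)).
by move/eqP=> ->; exists 6%N.
Qed.

Lemma T_relators_hold r : T_relators r -> eval_word (tau K) r = 1.
Proof.
move=> /T_relatorsP[[j ->]|[k ->]].
  by rewrite eval_word_pos /mprod !big_cons big_nil mulr1 tau_sqr1.
rewrite eval_word_pos; apply/mprod_tau1; rewrite val_letters ?relator_letters //.
case: (ltnP k 7) => hk; last by rewrite /relator nth_default.
have ok : all (fun k => Pos.eqb (walk (step T_table) base_node (relator k)) base_node) (iota 0 7).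
  by vm_compute.
by apply/Pos.eqb_spec; apply: (allP ok); rewrite mem_iota.
Qed.

Lemma eval_word_eq u v : word_eq T_relators u v ->
  eval_word (tau K) u = eval_word (tau K) v.
Proof.
elim=> {u v} [//|u v _ -> //|u v w _ -> _ -> //|u v i e|u v r /T_relators_hold hr].
  have ut := t_unit (tau_sqr1 K) i.
  have c : eval_word (tau K) [:: (i, e); (i, ~~ e)] = 1.
    rewrite /eval_word !big_cons big_nil mulr1.
    by case: e => /=; rewrite ?mulVr ?mulrV.
  by rewrite !eval_word_cat c mul1r.
by rewrite !eval_word_cat hr mul1r.
Qed.

Lemma T_presentation : has_presentation (T K) (tau K) T_relators.
Proof.
split=> // w; split=> [e|/eval_word_eq ->]; last by rewrite /eval_word big_nil.
have h := word_eq_pos T_square w.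
apply: (word_eq_trans h); move: e; rewrite (eval_word_eq h) eval_word_pos.
set v := [seq l.1 | l <- w] => /mprod_tau1 e.
have := T_word_walk (letters_lt v); rewrite e /weq /letters -map_comp.
by rewrite (eq_map (g := id)) ?map_id // => i /=; rewrite inord_val.
Qed.

End Presentation.

(** * The flags of the polytope of [T] *)

Section Along.
Variables (n : nat) (P : ranked_structure) (X X' C : Type).
Variables (phi : nat -> X -> P) (F : nat -> X' -> C).
Variables (a : nat -> X -> X) (a' : nat -> X' -> X') (g : X' -> X).
Hypotheses (fs : flag_system n phi a) (fs' : flag_system n F a').
Hypotheses (ga : forall j y, (j < n)%N -> g (a' j y) = a j (g y)).
Hypothesis (ginj : injective g).

(** An injective map between flags that commutes with the adjacencies preserves
    and reflects the equality of faces. *)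
Lemma same_faces_along r y z : (r <= n.+1)%N ->
  F r y = F r z <-> phi r (g y) = phi r (g z).
Proof.
move=> hr.
have gw w u : all (fun j => j < n)%N w -> g (walk a' u w) = walk a (g u) w.
  elim: w u => [//|j w IH] u /= /andP[jn wn]; by rewrite IH // ga.
split=> e.
  have [w [wn wz we]] := fs_conn fs' y z; rewrite -wz gw // (walkF fs) //.
  apply/allP => j jw; rewrite (allP wn j jw) /=.
  by apply/eqP => rj; apply: (we j jw); rewrite -rj.
have [w [wn wz we]] := fs_conn fs (g y) (g z).
have -> : z = walk a' y w by apply: ginj; rewrite gw.
rewrite (walkF fs') //; apply/allP => j jw; rewrite (allP wn j jw) /=.
by apply/eqP => rj; apply: (we j jw); rewrite -rj.
Qed.

Lemma presents_along : presents n phi -> (forall x, exists y, g y = x) ->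
  presents n (fun r y => phi r (g y)).
Proof.
move=> pr surj; split.
- move=> G; have [r [x [hr ->]]] := pr_cover pr G.
  by have [y <-] := surj x; exists r, y.
- by move=> r y; exact: (pr_rk pr).
- move=> r s y z hr hs; rewrite (pr_le pr) //.
  split=> -[rs [u [u1 u2]]]; split=> //; last by exists (g u).
  by have [v ev] := surj u; exists v; rewrite ev.
- by move=> x y; exact: (pr_bot pr).
- by move=> x y; exact: (pr_top pr).
Qed.

End Along.

Section TPolytope.
Variable K : realType.

Notation tf := (tflag T_table).
Notation ta := (tadj T_local_ok).

Lemma T_node_mem (x : tf) : gen (range (tau K)) (node_mx K (sval x)).
Proof.
have [w <-] := T_node x; rewrite walk_tadj ?letters_lt // node_mx_walk //.
by rewrite node_mx_root mulr1 -(mprod_rev (tau_sqr1 K)); exact: T_mprod.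
Qed.

(** The element of [T], that is the flag of its coset polytope, with a given name. *)
Definition T_elt (x : tf) : {a | gen (range (tau K)) a} :=
  exist _ (node_mx K (sval x)) (T_node_mem x).

Lemma T_elt_inj : injective T_elt.
Proof.
move=> x y /(congr1 sval) /= e; apply: tflag_eq.
exact: (node_mx_inj (svalP x) (svalP y) e).
Qed.

Lemma T_elt_adj j x : (j < 4)%N -> T_elt (ta j x) = cadj j (T_elt x).
Proof.
move=> j4; apply: (@cadj_inj _ _ (tau K)); rewrite /= tadjE //.
rewrite (cadjE (t := tau K) (Ordinal j4)).
by rewrite -(node_mx_step K (Ordinal j4) (svalP x)).
Qed.

Lemma T_elt_surj a : exists x, T_elt x = a.
Proof.
have [w e] := T_words (svalP a).
exists (walk ta T_root [seq val i | i <- w]); apply: (@cadj_inj _ _ (tau K)).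
by rewrite /= walk_tadj ?letters_lt.
Qed.

(** The faces of the polytope of [T], in terms of the table. *)
Definition T_face (r : nat) (x : tf) : T_polytope K := cphi r (T_elt x).

Lemma T_presents : presents 4 T_face.
Proof.
have pr := coset_presents (tau_sqr1 K).
exact: (presents_along pr T_elt_surj).
Qed.

Lemma T_face_eq r x y : (r <= 5)%N -> tface r x = tface r y <-> T_face r x = T_face r y.
Proof.
apply: (same_faces_along (g := T_elt)
  (coset_flag_system (tau_sqr1 K) (T_string_C_group K))
  (table_flag_system T_local_ok T_conn_ok)); last exact: T_elt_inj.
by move=> j z; exact: T_elt_adj.
Qed.

Lemma T_flag_system : flag_system 4 T_face ta.
Proof.
apply: (flag_system_transfer _ (table_flag_system T_local_ok T_conn_ok)).
exact: T_face_eq.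
Qed.

(** Closed walks of the table do not depend on the flag where they start. *)
Lemma T_closed_walks w (x y : tf) : all (fun j => j < 4)%N w ->
  walk ta x w = x -> walk ta y w = y.
Proof.
move=> w4 e; have [v ev] := letters_ord w4; subst w.
have gw z : T_elt (walk ta z [seq val i | i <- v]) =
    walk (@cadj _ _ (tau K)) (T_elt z) [seq val i | i <- v].
  elim: v z {w4 e} => [//|i v IH] z /=.
  by rewrite IH T_elt_adj //; exact: ltn_ord.
have e1 : mprod (tau K) v = 1.
  by apply/(walk_cadj_id (tau_sqr1 K) v (T_elt x)); rewrite -gw e.
by apply: T_elt_inj; rewrite gw; apply/(walk_cadj_id (tau_sqr1 K)).
Qed.

Lemma T_regular : regular 4 (T_polytope K).
Proof.
exact: (regular_of_walks T_root T_presents T_flag_system T_closed_walks).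
Qed.

(** A flag system in which the relators of [T] act trivially is covered by [T]. *)
Lemma T_covers (P : ranked_structure) X (phi : nat -> X -> P) a (x0 : X) :
  presents 4 phi -> flag_system 4 phi a ->
  (forall k x, walk a x (relator k) = x) ->
  exists f g, [/\ covering 4 f, on_flags 4 T_face phi f g,
    g T_root = x0 & forall w, all (fun j => j < 4)%N w ->
      g (walk ta T_root w) = walk a x0 w].
Proof.
move=> pr fs hrel; apply: (covers_of_walks T_presents pr T_flag_system fs).
move=> w w4 e; have [v ev] := letters_ord w4; subst w.
have /(T_walk_root K) e1 := e.
have h : word_eq T_relators (pos_word v) [::].
  by have [_ h] := T_presentation K; apply/h; rewrite eval_word_pos.
pose nats (u : word 4) : seq nat := [seq val l.1 | l <- u].
have natsC u v' : nats (u ++ v') = nats u ++ nats v' by exact: map_cat.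
have : forall u v', word_eq T_relators u v' ->
    forall x, walk a x (nats u) = walk a x (nats v').
  move=> u v'; elim=> {u v'}.
  - by [].
  - by move=> u v' _ IH x; rewrite IH.
  - by move=> u1 u2 u3 _ IH1 _ IH2 x; rewrite IH1.
  - move=> u1 u2 i s x; rewrite !natsC !walk_cat /=.
    by rewrite (adjK fs) //; exact: ltn_ord.
  - move=> u1 u2 r /T_relatorsP hr x; rewrite !natsC !walk_cat.
    suff -> : forall y, walk a y (nats r) = y by [].
    case: hr => [[i ->]|[k ->]] y /=; first by rewrite (adjK fs) //; exact: ltn_ord.
    rewrite -[RHS](hrel k) -[in RHS](val_letters (relator_letters k)).
    by rewrite /nats /letters /pos_word -!map_comp.
move=> /(_ _ _ h x0); rewrite /nats /pos_word -map_comp /=.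
by [].
Qed.

End TPolytope.

(** * Structures with numbered faces *)

Section Numbered.
Local Open Scope nat_scope.

(** Some flag of the table passes through the [j]-face number [i] and the
    [k]-face number [l]. *)
Definition has_flag (t : table) (j i k l : nat) : bool :=
  has (fun xr => (nth 0 xr.2.2 j == i) && (nth 0 xr.2.2 k == l))
    (PositiveMap.elements t).

(** [inc j i k l] says that the face number [i] of rank [j] is below the face
    number [l] of rank [k]; there are [nth 0 cnt j] proper faces of rank [j]. The
    table is compatible with these data when its flags consist of incident faces
    and when each incidence occurs in some flag. *)
Definition numbering_ok (t : table) (inc : nat -> nat -> nat -> nat -> bool)
    (cnt : seq nat) : bool :=
  all_flags t (fun x => all (fun j => (face_no t j x < nth 0 cnt j) &&
      all (fun k => (k < j) || inc j (face_no t j x) k (face_no t k x)) (iota 0 4))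
    (iota 0 4)) &&
  all (fun j => all (fun k => all (fun i => all (fun l =>
      if inc j i k l then (j <= k) && has_flag t j i k l else true)
      (iota 0 (nth 0 cnt k))) (iota 0 (nth 0 cnt j))) (iota 0 4)) (iota 0 4).

Lemma has_flagP t j i k l : has_flag t j i k l ->
  exists x, [/\ in_table t x, face_no t j x = i & face_no t k x = l].
Proof.
rewrite /has_flag => h.
have [[x r] [hx h1 h2]] : exists xr : positive * (seq positive * seq nat),
    [/\ List.In xr (PositiveMap.elements t), nth 0 xr.2.2 j = i & nth 0 xr.2.2 k = l].
  elim: (PositiveMap.elements t) h => [//|q s IH] /= /orP[/andP[/eqP h1 /eqP h2]|/IH].
    by exists q; split=> //; left.
  by move=> [xr [h0 h1 h2]]; exists xr; split=> //; right.
have e := PositiveMap.elements_complete t x r hx.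
by exists x; rewrite /in_table /face_no e.
Qed.

Variables (t : table) (inc : nat -> nat -> nat -> nat -> bool) (cnt : seq nat).
Hypothesis ok : numbering_ok t inc cnt.

Lemma face_no_lt (x : tflag t) j : j < 4 -> face_no t j (sval x) < nth 0 cnt j.
Proof.
move=> j4; have /andP[h _] := ok; have /allP h' := all_flagsP h (svalP x).
by have := h' j; rewrite mem_iota => /(_ j4) /andP[].
Qed.

Lemma face_no_inc (x : tflag t) j k : j <= k -> k < 4 ->
  inc j (face_no t j (sval x)) k (face_no t k (sval x)).
Proof.
move=> jk k4; have /andP[h _] := ok; have /allP h' := all_flagsP h (svalP x).
have := h' j; rewrite mem_iota => /(_ (leq_ltn_trans jk k4)) /andP[_ /allP h''].
by have := h'' k; rewrite mem_iota => /(_ k4); rewrite ltnNge jk.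
Qed.

Lemma inc_flag j i k l : j < 4 -> k < 4 -> i < nth 0 cnt j -> l < nth 0 cnt k ->
  inc j i k l -> j <= k /\
  exists x : tflag t, face_no t j (sval x) = i /\ face_no t k (sval x) = l.
Proof.
move=> j4 k4 hi hl h; have /andP[_ /allP h1] := ok.
have := h1 j; rewrite mem_iota => /(_ j4) /allP h2.
have := h2 k; rewrite mem_iota => /(_ k4) /allP h3.
have := h3 i; rewrite mem_iota => /(_ hi) /allP h4.
have := h4 l; rewrite mem_iota h => /(_ hl) /andP[jk /has_flagP].
by move=> [x [hx e1 e2]]; split=> //; exists (exist (fun x => in_table t x) x hx).
Qed.

End Numbered.

Section NumberedFaces.
Local Open Scope nat_scope.
(** The faces of rank [j] of a ranked structure are the [psi j i] for the numbers
    [i] in [ids j], and [no j y] is the number of the [j]-face of the flag [y]. *)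
Variables (n : nat) (Y : Type) (no : nat -> Y -> nat) (ids : nat -> seq nat).
Variable inc : nat -> nat -> nat -> nat -> bool.
Hypothesis no_ids : forall j y, j < n -> no j y \in ids j.
Hypothesis no_inc : forall j k y, j <= k -> k < n -> inc j (no j y) k (no k y).
Hypothesis inc_no : forall j i k l, j < n -> k < n -> i \in ids j -> l \in ids k ->
  inc j i k l -> j <= k /\ exists y, no j y = i /\ no k y = l.

Variables (P : ranked_structure) (L U : P) (psi : nat -> nat -> P).
Hypothesis psi_cover : forall G, G = L \/ G = U \/
  exists j i, [/\ j < n, i \in ids j & G = psi j i].
Hypotheses (rkL : rk L = (-1)%R) (rkU : rk U = n%:Z).
Hypothesis rk_psi : forall j i, j < n -> i \in ids j -> rk (psi j i) = j%:Z.
Hypotheses (leL : forall G, fle L G) (leU : forall G, fle G U).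
Hypotheses (Lmin : forall G, fle G L -> G = L) (Umax : forall G, fle U G -> G = U).
Hypothesis psi_le : forall j i k l, j < n -> i \in ids j -> k < n ->
  l \in ids k -> fle (psi j i) (psi k l) <-> inc j i k l.
Hypothesis inc_refl : forall j i, j < n -> i \in ids j -> inc j i j i.

(** The face of rank [r - 1] of a flag. *)
Definition gface (r : nat) (y : Y) : P :=
  if r is j.+1 then if j < n then psi j (no j y) else U else L.

Lemma gface_eq j x y : j < n ->
  no j x = no j y <-> gface j.+1 x = gface j.+1 y.
Proof.
move=> jn; rewrite /= jn; split=> [->//|e].
have : inc j (no j x) j (no j y).
  apply/psi_le => //; try exact: no_ids.
  by rewrite -e; apply/psi_le => //; try exact: no_ids; apply: no_inc.
by move=> /inc_no[||||_ [z [<- <-]]] //; exact: no_ids.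
Qed.

Lemma gface_presents (y0 : Y) : presents n gface.
Proof.
have psiL j i : j < n -> i \in ids j -> psi j i <> L.
  by move=> jn hi e; have := rk_psi jn hi; rewrite e rkL.
have psiU j i : j < n -> i \in ids j -> psi j i <> U.
  by move=> jn hi e; have := rk_psi jn hi; rewrite e rkU; lia.
have LU : L <> U by move=> e; have := rkL; rewrite e rkU.
have cases r : r <= n.+1 -> r = 0 \/ r = n.+1 \/ exists2 j, j < n & r = j.+1.
  by case: r => [|r]; [left | right; case: (eqVneq r n) => [->|h]; [left|right; exists r]; lia].
have n5 z : gface n.+1 z = U by rewrite /= ltnn.
have n0 z : gface 0 z = L by [].
have nE j y : j < n -> gface j.+1 y = psi j (no j y).
  by rewrite /gface => ->.
split=> //.
- move=> G; case: (psi_cover G) => [->|[->|[j [i [jn hi ->]]]]].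
  + by exists 0, y0.
  + by exists n.+1, y0; rewrite n5.
  + have [_ [x [ex _]]] := inc_no jn jn hi hi (inc_refl jn hi).
    by exists j.+1, x; split; [lia | rewrite nE // ex].
- move=> r x /cases[->|[->|[j jn ->]]]; first by rewrite /= rkL.
    by rewrite n5 rkU; lia.
  by rewrite nE // rk_psi //; [lia | exact: no_ids].
- move=> r s x y /cases[->|[->|[j jn ->]]].
  + by move=> _; split=> [_|_]; [split=> //; exists y | exact: leL].
  + move=> /cases[->|[->|[k kn ->]]].
    * rewrite n5 n0.
      by split=> [/Umax e|[]//]; case: (LU e).
    * by rewrite !n5; split=> _; [split=> //; exists x; rewrite !n5 | exact: leU].
    * rewrite n5 (nE k) //; split=> [/Umax e|[]]; last by lia.
      by case: (psiU k _ kn (no_ids y kn)).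
  + move=> /cases[->|[->|[k kn ->]]].
    * rewrite n0 (nE j) //; split=> [/Lmin e|[]//].
      by case: (psiL j _ jn (no_ids x jn)).
    * rewrite n5; split=> _; [split; [lia | exists x] | exact: leU].
      by rewrite n5.
    * rewrite !nE //; split=> [|[jk [z]]].
        move=> /psi_le h; have := inc_no jn kn (no_ids x jn) (no_ids y kn).
        move=> /(_ (h jn (no_ids x jn) kn (no_ids y kn))) [jk [z [e1 e2]]].
        by split=> //; exists z; rewrite !nE // e1 e2.
      move=> [e1 e2]; rewrite -e1 -e2 !nE //.
      by apply/psi_le => //; [exact: no_ids | exact: no_ids | exact: no_inc].
- by move=> x y; rewrite !n5.
Qed.

End NumberedFaces.

Section NumberedTable.
Local Open Scope nat_scope.
Variables (t : table) (inc : nat -> nat -> nat -> nat -> bool) (cnt : seq nat).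
Hypothesis ok : numbering_ok t inc cnt.
Variables (P : ranked_structure) (L U : P) (psi : nat -> nat -> P).
Hypothesis psi_cover : forall G, G = L \/ G = U \/
  exists j i, [/\ j < 4, i < nth 0 cnt j & G = psi j i].
Hypotheses (rkL : rk L = (-1)%R) (rkU : rk U = 4%:Z).
Hypothesis rk_psi : forall j i, j < 4 -> i < nth 0 cnt j -> rk (psi j i) = j%:Z.
Hypotheses (leL : forall G, fle L G) (leU : forall G, fle G U).
Hypotheses (Lmin : forall G, fle G L -> G = L) (Umax : forall G, fle U G -> G = U).
Hypothesis psi_le : forall j i k l, j < 4 -> i < nth 0 cnt j -> k < 4 ->
  l < nth 0 cnt k -> fle (psi j i) (psi k l) <-> inc j i k l.
Hypothesis psi_all : forall j i, j < 4 -> i < nth 0 cnt j -> inc j i j i.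

Let ids j := iota 0 (nth 0 cnt j).

Let mem_ids j i : (i \in ids j) = (i < nth 0 cnt j).
Proof. by rewrite mem_iota. Qed.

(** The face of rank [r - 1] of a flag of the table. *)
Definition nface (r : nat) (x : tflag t) : P :=
  gface 4 (fun j (x : tflag t) => face_no t j (sval x)) L U psi r x.

Lemma nface_eq r x y : r <= 5 -> tface r x = tface r y <-> nface r x = nface r y.
Proof.
case: r => [//|j]; rewrite ltnS leq_eqVlt => /predU1P[->//|j4].
have -> : (tface j.+1 x = tface j.+1 y) =
    (face_no t j (sval x) = face_no t j (sval y)) by rewrite /tface j4.
apply: (gface_eq (no := fun j (x : tflag t) => face_no t j (sval x))
  (ids := ids) (inc := inc)) => //.
- by move=> k z k4; rewrite mem_ids; exact: (face_no_lt ok z k4).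
- by move=> k l z; exact: (face_no_inc ok).
- by move=> k i l m k4 l4; rewrite !mem_ids; exact: (inc_flag ok).
- by move=> k i l m k4; rewrite !mem_ids; exact: psi_le.
Qed.

Lemma numbered_presents (x0 : tflag t) : presents 4 nface.
Proof.
apply: (gface_presents (ids := ids) (inc := inc)) => //.
- by move=> k z k4; rewrite mem_ids; exact: (face_no_lt ok z k4).
- by move=> k l z; exact: (face_no_inc ok).
- by move=> k i l m k4 l4; rewrite !mem_ids; exact: (inc_flag ok).
- move=> G; case: (psi_cover G) => [|[|[j [i [h1 h2 h3]]]]]; [by left|by right; left|].
  by right; right; exists j, i; rewrite mem_ids.
- by move=> j i j4; rewrite mem_ids; exact: rk_psi.
- by move=> k i l m k4; rewrite !mem_ids; exact: psi_le.
- by move=> j i j4; rewrite mem_ids; exact: psi_all.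
Qed.

End NumberedTable.

(** * The faces of the cube *)

Section CubeFaces.
Variables (K : realType) (n : nat).

(** A pattern fixes the signs of some of the coordinates; the face that it
    describes consists of the vertices with these signs. *)
Definition pattern := seq (option bool).

(** The vertices of the face described by a pattern. *)
Definition cface (p : pattern) : set 'rV[K]_n :=
  [set x | cube_vertex x /\
    forall (i : 'I_n) b, nth None p i = Some b -> x 0 i = (-1) ^+ b].

(** The vertex of a face whose free signs are all equal to [d]. *)
Definition fill (p : pattern) (d : bool) : seq bool := [seq odflt d o | o <- p].

(** Inclusion between faces: what [q] fixes is fixed by [p] in the same way. *)
Definition subpattern (p q : pattern) : bool :=
  all (fun i => (nth None q i == None) || (nth None q i == nth None p i)) (iota 0 n).

Lemma svec_vertex v : cube_vertex (svec K n v).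
Proof. by move=> i; rewrite mxE; case: (nth _ _ _); [right|left]. Qed.

Lemma cube_vertex_svec (x : 'rV[K]_n) : cube_vertex x ->
  exists2 v, size v = n & x = svec K n v.
Proof.
move=> vx; exists [seq x 0 i < 0 | i <- enum 'I_n].
  by rewrite size_map size_enum_ord.
apply/rowP => i; rewrite mxE (nth_map i) ?size_enum_ord // nth_ord_enum.
by case: (vx i) => ->; rewrite ?ltr10 ?ltrN10.
Qed.

Lemma fill_cface p d : size p = n -> cface p (svec K n (fill p d)).
Proof.
move=> sp; split=> [|i b e]; first exact: svec_vertex.
by rewrite mxE (nth_map None) ?sp // e.
Qed.

Lemma cface_sub p q : size p = n -> cface p `<=` cface q <-> subpattern p q.
Proof.
move=> sp; split=> [sub|/allP sub x [vx hx]].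
  apply/allP => i; rewrite mem_iota => /= hi.
  case eq : (nth None q i) => [b|] //=; rewrite eq_sym.
  have [_ /(_ (Ordinal hi) b eq)] := sub _ (fill_cface (~~ b) sp).
  rewrite mxE (nth_map None) ?sp //= => /signr_inj.
  by case: (nth None p i) => [c /= ->|/=]; [rewrite eqxx | case: (b)].
split=> // i b e; have := sub i; rewrite mem_iota => /(_ (ltn_ord i)).
by rewrite e /= => /eqP e'; apply: hx; rewrite -e'.
Qed.

(** The reflection in the [i]-th coordinate. *)
Definition flip (i : 'I_n) (x : 'rV[K]_n) : 'rV[K]_n :=
  \row_j (if j == i then - x 0 j else x 0 j).

Lemma flip_vertex i x : cube_vertex x -> cube_vertex (flip i x).
Proof.
move=> vx j; rewrite mxE; case: ifP => // _.
by case: (vx j) => ->; [right | left; rewrite opprK].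
Qed.

(** The functional given by [c] is maximal at the vertices whose signs agree with
    those of the nonzero coefficients of [c]. *)
Lemma cube_faceP (S : set 'rV[K]_n) : cube_face S <->
  S = set0 \/ exists2 p, size p = n & S = cface p.
Proof.
split=> [[->|[c ->]]|[->|[p sp ->]]]; [by left| |by left|]; right.
  exists [seq if c i 0 == 0 then None else Some (c i 0 < 0) | i <- enum 'I_n].
    by rewrite size_map size_enum_ord.
  have nthp (i : 'I_n) : nth None
      [seq if c i 0 == 0 then None else Some (c i 0 < 0) | i <- enum 'I_n] i =
      if c i 0 == 0 then None else Some (c i 0 < 0).
    by rewrite (nth_map i) ?size_enum_ord // nth_ord_enum.
  apply/seteqP; split=> x /= [vx hx]; split=> //.
    move=> i b; rewrite nthp; case: eqP => // ci [<-].
    have := hx _ (flip_vertex i vx); rewrite !mxE (bigD1 i) //= [leRHS](bigD1 i) //=.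
    rewrite mxE eqxx (eq_bigr (fun j => x 0 j * c j 0)); last first.
      by move=> j /negbTE ji; rewrite mxE ji.
    rewrite lerD2r mulNr.
    have [c0|c0|/ci //] := ltrgtP (c i 0) 0; case: (vx i) => -> /=.
    - by rewrite expr1 mul1r => h; lra.
    - by rewrite expr1.
    - by rewrite expr0.
    - by rewrite expr0 mulN1r => h; lra.
  move=> y vy; rewrite !mxE; apply: ler_sum => i _.
  have := hx i; rewrite nthp.
  have [c0|c0|->] := ltrgtP (c i 0) 0; last by rewrite !mulr0.
    by move=> /(_ _ erefl) ->; rewrite expr1; case: (vy i) => ->; lra.
  by move=> /(_ _ erefl) ->; rewrite expr0; case: (vy i) => ->; lra.
exists (\col_i if nth None p i is Some b then (-1) ^+ b else 0).
apply/seteqP; split=> x /= [vx hx]; split=> //.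
  move=> y vy; rewrite !mxE; apply: ler_sum => i _; rewrite !mxE.
  case e : (nth None p i) => [b|]; last by rewrite !mulr0.
  rewrite (hx i b e); case: (vy i) => ->; case: (b); rewrite /= ?expr0 ?expr1; lra.
move=> i b e; have := hx _ (svec_vertex (fill p false)).
have [//|xi] := eqVneq (x 0 i) ((-1) ^+ b).
rewrite !mxE (bigD1 i) //= [leRHS](bigD1 i) //= !mxE (nth_map None) ?sp // e /=.
have xb : x 0 i = - (-1) ^+ b.
  move: xi; case: (vx i) => ->; case: (b); rewrite /= ?expr0 ?expr1 ?eqxx ?opprK //.
rewrite xb mulNr -signr_addb addbb expr0.
have : \sum_(j < n | j != i) (x 0 j * (\col_i0 match nth None p i0 with
    | Some b => (-1) ^+ b | None => 0 end) j 0) <=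
    \sum_(j < n | j != i) (svec K n (fill p false) 0 j * (\col_i0 match nth None p i0 with
    | Some b => (-1) ^+ b | None => 0 end) j 0).
  apply: ler_sum => j _; rewrite !mxE (nth_map None) ?sp //.
  case: (nth None p j) => [b'|]; last by rewrite !mulr0.
  rewrite /= -signr_addb addbb expr0.
  by case: (vx j) => ->; case: (b'); rewrite /= ?expr0 ?expr1; lra.
by move=> h1 h2; lra.
Qed.

(** The dimension is the number of free coordinates: differences of points of the
    face vanish at the fixed coordinates, and twice the free basis vectors are
    such differences. *)
Lemma cface_dim p : size p = n -> face_dim (cface p) = (count (pred1 None) p)%:Z.
Proof.
move=> sp; rewrite /face_dim; case: asboolP => [e|_].
  by have := fill_cface false sp; rewrite e.
congr Posz; pose I : {set 'I_n} := [set i : 'I_n | nth None p i == None]%SET.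
have -> : count (pred1 None) p = #|I|.
  rewrite cardsE cardE size_filter -enumT.
  rewrite -[in LHS](mkseq_nth None p) sp /mkseq count_map -val_enum_ord count_map.
  by apply: eq_count.
pose k := #|I|; pose f : 'I_k -> 'I_n := enum_val.
have fI l : nth None p (f l) = None.
  by have := enum_valP l; rewrite inE => /eqP.
apply/eqP; rewrite eqn_leq; apply/andP; split.
  apply/bigmax_leqP => l /asboolP[A [hA <-]].
  have -> : A = (\matrix_(i < n, l < k) A i (f l)) *m (\matrix_(l < k, j < n) (f l == j)%:R).
    apply/matrixP => i j; rewrite mxE.
    case: (boolP (j \in I)) => [jI|jI].
      rewrite (bigD1 (enum_rank_in jI j)) //= big1 => [|l' hl].
        by rewrite !mxE /f enum_rankK_in // eqxx mulr1 addr0.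
      rewrite !mxE; case: eqP => [e|_]; last by rewrite mulr0.
      by case/eqP: hl; apply: enum_val_inj; rewrite enum_rankK_in.
    rewrite big1 => [|l' _].
      have [x [y [[_ hx] [_ hy] e]]] := hA i.
      have -> : A i j = (row i A) 0 j by rewrite mxE.
      rewrite e !mxE; move: jI; rewrite inE; case ej : (nth None p j) => [b|//] _.
      by rewrite (hx j b ej) (hy j b ej) subrr.
    rewrite !mxE; case: eqP => [e|_]; last by rewrite mulr0.
    by move: jI; rewrite inE -e fI.
  exact: mulmx_max_rank.
have kn : (k < n.+1)%N by rewrite ltnS -[leqRHS](card_ord n); exact: max_card.
apply: (@bigop.bigmax_sup _ (Ordinal kn)) => //; apply/asboolP.
pose A : 'M[K]_n := \matrix_(i, j) (2 *+ ((i \in I) && (i == j))).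
exists A; split; last first.
  apply/eqP; rewrite eqn_leq; apply/andP; split.
    have -> : A = (\matrix_(i < n, l < k) (2 *+ (i == f l))) *m (\matrix_(l < k, j < n) (f l == j)%:R).
      apply/matrixP => i j; rewrite !mxE.
      case: (boolP (i \in I)) => [iI|iI] /=.
        rewrite (bigD1 (enum_rank_in iI i)) //= big1 => [|l' hl].
          by rewrite !mxE /f enum_rankK_in // eqxx mulr1n addr0; case: eqP; rewrite ?mulr1 ?mulr0.
        rewrite !mxE; case: eqP => [e|_]; last by rewrite mulr0n mul0r.
        by case/eqP: hl; apply: enum_val_inj; rewrite enum_rankK_in.
      rewrite big1 // => l' _; rewrite !mxE; case: eqP => [e|_]; last by rewrite mulr0n mul0r.
      by move: iI; rewrite inE e fI.
    exact: mulmx_max_rank.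
  apply: (@mulmx1_min_rank _ _ _ _ _ (\matrix_(l < k, j < n) (2^-1 *+ (f l == j)))
    (\matrix_(j < n, l < k) (j == f l)%:R)).
  apply/matrixP => l l'; rewrite !mxE (bigD1 (f l')) //= big1 => [|j hj].
    rewrite !mxE (bigD1 (f l)) //= big1 => [|j hj].
      rewrite !mxE !eqxx mulr1n addr0 mulr1 inE fI eqxx /=.
      have -> : (f l == f l') = (l == l') by apply/eqP/eqP => [/enum_val_inj|->].
      by case: eqP => _; rewrite ?mulr1n ?mulr0n ?mulr0 ?addr0 // mulVf ?addr0 // pnatr_eq0.
    by rewrite !mxE eq_sym (negbTE hj) mulr0n mul0r.
  by rewrite !mxE (negbTE hj) mulr0.
move=> i; case: (boolP (i \in I)) => [iI|iI].
  exists (svec K n (fill p false)), (flip i (svec K n (fill p false))).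
  have hf := fill_cface false sp; split=> //.
    split=> [|j b e]; first exact: flip_vertex hf.1.
    rewrite mxE; case: eqP => [ji|_]; last exact: hf.2.
    by move: iI; rewrite inE -ji e.
  apply/rowP => j; rewrite !mxE iI /= (eq_sym i j); case: eqP => [->|_]; last first.
    by rewrite subrr.
  rewrite (nth_map None) ?sp //; move: iI; rewrite inE => /eqP -> /=.
  by rewrite expr0 opprK mulr1n.
exists (svec K n (fill p false)), (svec K n (fill p false)).
have hf := fill_cface false sp; split=> //.
by apply/rowP => j; rewrite !mxE (negbTE iI) subrr.
Qed.

End CubeFaces.

(** ** The 4-cube as a numbered structure *)

(** The table of a list of flags, given as lists of face numbers. The ranks are
    at most [3], so that [agree 5] compares all the faces. *)
Definition mk_flag_table (fl : seq (seq nat)) : table :=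
  let nodes := zip [seq Pos.of_succ_nat i | i <- iota 0 (size fl)] fl in
  let agree j (f g : seq nat) := all (fun i => (i == j) ||
      (nth 0%N f i == nth 0%N g i)) (iota 0 4) in
  mk_map [seq (xf.1,
     ([seq head xf.1 [seq yg.1 | yg <- nodes &
          agree j xf.2 yg.2 && ~~ agree 5 xf.2 yg.2] | j <- iota 0 4], xf.2))
   | xf <- nodes].

(** The patterns with [j] free coordinates, for each [j]. *)
Definition cube_patterns : seq (seq pattern) := Eval vm_compute in
  let all_patterns := iter 4 (fun ps =>
    [seq o :: p | o <- [:: Some false; Some true; None], p <- ps]) [:: [::]] in
  [seq [seq p <- all_patterns | count (pred1 None) p == j] | j <- iota 0 5].

(** The [i]-th face of dimension [j] of the 4-cube. *)
Definition cube_pattern (j i : nat) : pattern := nth [::] (nth [::] cube_patterns j) i.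

Definition cube_inc (j i k l : nat) : bool :=
  subpattern 4 (cube_pattern j i) (cube_pattern k l).

(** The numbers of proper faces of each dimension. *)
Definition cube_count : seq nat := [:: 16; 32; 24; 8]%N.

Definition cube_table : table := Eval vm_compute in
  mk_flag_table (foldr (fun j fls => flatten [seq [seq i :: fl | fl <- fls &
      if fl is k :: _ then cube_inc j i j.+1 k else true] | i <- iota 0 (nth 0%N cube_count j)])
    [:: [::]] (iota 0 4)).

Definition cube_classes : seq class_data := Eval vm_compute in
  mk_classes cube_table [seq xr.1 | xr <- PositiveMap.elements cube_table].

Lemma cube_local_ok : local_ok cube_table. Proof. by vm_compute. Qed.

Lemma cube_conn_ok : conn_ok cube_table cube_classes. Proof. by vm_compute. Qed.

Lemma cube_numbering_ok : numbering_ok cube_table cube_inc cube_count.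
Proof. by vm_compute. Qed.

Section Cube.
Variable K : realType.

Lemma cface_face (p : pattern) : cube_face (@cface K 4 p).
Proof.
apply/cube_faceP; right; exists (mkseq (nth None p) 4); first exact: size_mkseq.
by apply/seteqP; split=> x [vx hx]; split=> // i b e; apply: hx;
  move: e; rewrite nth_mkseq.
Qed.

Definition cube_of_pattern (p : pattern) : cube K 4 :=
  SigSub (mem_set (cface_face p)).

Lemma cube_empty_face : cube_face (set0 : set 'rV[K]_4).
Proof. by left. Qed.

Definition cube_least : cube K 4 := SigSub (mem_set cube_empty_face).

Lemma cube_pattern_size j i : (j <= 4)%N -> (i < size (nth [::] cube_patterns j))%N ->
  size (cube_pattern j i) = 4%N /\ count (pred1 None) (cube_pattern j i) = j.
Proof.
have ok : all (fun j => all (fun p => (size p == 4) && (count (pred1 None) p == j))%N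
    (nth [::] cube_patterns j)) (iota 0 5) by vm_compute.
move=> hj hi; have := allP ok j; rewrite mem_iota ltnS => /(_ hj) /allP h.
by have /andP[/eqP h1 /eqP h2] := h _ (mem_nth [::] hi).
Qed.

Lemma cube_pattern_exists p : size p = 4%N -> exists i,
  (i < size (nth [::] cube_patterns (count (pred1 None) p)))%N /\
  cube_pattern (count (pred1 None) p) i = p.
Proof.
move=> sp; have h : p \in nth [::] cube_patterns (count (pred1 None) p).
  case: p sp => [|a [|b [|c [|d [|]]]]] //= _.
  by case: a => [[]|]; case: b => [[]|]; case: c => [[]|]; case: d => [[]|].
by exists (index p (nth [::] cube_patterns (count (pred1 None) p)));
  rewrite index_mem /cube_pattern nth_index.
Qed.

Lemma cube_countE j : (j < 4)%N -> nth 0%N cube_count j = size (nth [::] cube_patterns j).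
Proof. by case: j => [|[|[|[|]]]]. Qed.

Definition cube_face_no (j i : nat) : cube K 4 := cube_of_pattern (cube_pattern j i).

Definition cube_greatest : cube K 4 := cube_face_no 4 0.

Lemma cube_val_inj (G H : cube K 4) : val G = val H -> G = H.
Proof. exact: val_inj. Qed.

Definition cube_flag_face : nat -> tflag cube_table -> cube K 4 :=
  nface cube_least cube_greatest cube_face_no (t := cube_table).

Definition cube_root : tflag cube_table :=
  exist (fun x => in_table cube_table x) 1%positive isT.

Lemma cube_numbered_presents : presents 4 cube_flag_face /\
  forall r x y, (r <= 5)%N -> tface r x = tface r y <->
    cube_flag_face r x = cube_flag_face r y.
Proof.
have rkp j i : (j <= 4)%N -> (i < size (nth [::] cube_patterns j))%N ->
    rk (cube_face_no j i) = j%:Z.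
  by move=> hj hi; have [h1 h2] := cube_pattern_size hj hi; rewrite /= cface_dim // h2.
have cover (G : cube K 4) : G = cube_least \/ G = cube_greatest \/
    exists j i, [/\ (j < 4)%N, (i < nth 0%N cube_count j)%N & G = cube_face_no j i].
  have /cube_faceP[e|[p sp e]] := set_valP G; first by left; apply: cube_val_inj.
  right; have [i [hi ep]] := cube_pattern_exists sp.
  have eG : G = cube_face_no (count (pred1 None) p) i.
    by apply: cube_val_inj; rewrite /= ep.
  have := count_size (pred1 None) p; rewrite sp leq_eqVlt => /predU1P[c4|c4].
    left; rewrite eG; move: hi; rewrite c4; case: (i) => [//|k].
    by rewrite ltnS ltn0.
  right; exists (count (pred1 None) p), i; split=> //.
  by rewrite cube_countE.
have leL (G : cube K 4) : fle cube_least G by move=> x [].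
have leU (G : cube K 4) : fle G cube_greatest.
  have /cube_faceP[e|[p sp e]] := set_valP G; first by move=> x; rewrite /= e => -[].
  rewrite /= e; apply/cface_sub => //.
have anti (G H : cube K 4) : fle G H -> fle H G -> G = H.
  by move=> h1 h2; apply: cube_val_inj; apply/seteqP.
have le j i k l : (j < 4)%N -> (i < nth 0%N cube_count j)%N -> (k < 4)%N ->
    (l < nth 0%N cube_count k)%N ->
    fle (cube_face_no j i) (cube_face_no k l) <-> cube_inc j i k l.
  move=> j4 hi k4 hl; apply: cface_sub.
  by rewrite cube_countE // in hi; have [] := cube_pattern_size (ltnW j4) hi.
have rkL : rk cube_least = -1 by rewrite /= /face_dim; case: asboolP.
have rkU : rk cube_greatest = 4%:Z by rewrite rkp.
have rkj j i : (j < 4)%N -> (i < nth 0%N cube_count j)%N -> rk (cube_face_no j i) = j%:Z.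
  by move=> j4 hi; rewrite rkp // -?cube_countE // ltnW.
have Lmin (G : cube K 4) : fle G cube_least -> G = cube_least by move=> h; apply: anti.
have Umax (G : cube K 4) : fle cube_greatest G -> G = cube_greatest.
  by move=> h; apply: anti.
have refl j i : (j < 4)%N -> (i < nth 0%N cube_count j)%N -> cube_inc j i j i.
  by move=> j4 hi; apply/le => // x.
split.
  exact: (numbered_presents cube_numbering_ok cover rkL rkU rkj leL leU Lmin Umax
    le refl cube_root).
by move=> r x y; exact: (nface_eq cube_numbering_ok cube_least cube_greatest le).
Qed.

Lemma cube_flag_system : flag_system 4 cube_flag_face (tadj cube_local_ok).
Proof.
apply: (flag_system_transfer _ (table_flag_system cube_local_ok cube_conn_ok)).
by have [_ h] := cube_numbered_presents.
Qed.

End Cube.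

(** ** The double covering of the cube *)

(** The relators of [T] act trivially on the flags of the table. *)
Definition walks_closed_ok (t : table) : bool :=
  all_flags t (fun x => all (fun k => Pos.eqb (walk (step t) x (relator k)) x) (iota 0 7)).

Lemma walks_closed (t : table) (lok : local_ok t) k (x : tflag t) :
  walks_closed_ok t -> walk (tadj lok) x (relator k) = x.
Proof.
move=> ok; apply: tflag_eq; rewrite walk_tadj ?relator_letters //.
case: (ltnP k 7) => hk; last by rewrite /relator nth_default.
have /allP h := all_flagsP ok (svalP x).
by apply/Pos.eqb_spec; apply: h; rewrite mem_iota.
Qed.

Lemma T_word_ok : all_flags T_table (fun x => all (fun j => j < 4)%N (T_word x) &&
  Pos.eqb (walk (step T_table) base_node (T_word x)) x).
Proof. by vm_compute. Qed.

Lemma T_wordP (x : tflag T_table) : all (fun j => j < 4)%N (T_word (sval x)) /\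
  walk (tadj T_local_ok) T_root (T_word (sval x)) = x.
Proof.
have /andP[h /Pos.eqb_spec e] := all_flagsP T_word_ok (svalP x).
by split=> //; apply: tflag_eq; rewrite walk_tadj.
Qed.

Lemma cube_relators_ok : walks_closed_ok cube_table. Proof. by vm_compute. Qed.

(** The image of each element of [T] among the flags of the cube. *)
Definition cube_image : PositiveMap.t positive := Eval vm_compute in
  PositiveMap.mapi (fun x _ => walk (step cube_table) 1%positive (T_word x)) T_table.

(** The two preimages of each flag of the cube. *)
Definition cube_fibre : PositiveMap.t (positive * positive) := Eval vm_compute in
  PositiveMap.mapi (fun y _ =>
    match [seq xy.1 | xy <- PositiveMap.elements cube_image & Pos.eqb xy.2 y] with
    | [:: x1; x2] => (x1, x2) | _ => (1%positive, 1%positive) end) cube_table.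

(** Every flag of the cube has two preimages exactly. *)
Definition cube_fibre_ok : bool :=
  all_flags T_table (fun x =>
    if PositiveMap.find x cube_image is Some y then
      Pos.eqb (walk (step cube_table) 1%positive (T_word x)) y &&
      (if PositiveMap.find y cube_fibre is Some (x1, x2) then
         Pos.eqb x x1 || Pos.eqb x x2 else false)
    else false) &&
  all_flags cube_table (fun y =>
    if PositiveMap.find y cube_fibre is Some (x1, x2) then
      [&& ~~ Pos.eqb x1 x2, in_table T_table x1, in_table T_table x2,
         Pos.eqb (walk (step cube_table) 1%positive (T_word x1)) y
       & Pos.eqb (walk (step cube_table) 1%positive (T_word x2)) y]
    else false).

Lemma cube_fibre_okE : cube_fibre_ok. Proof. by vm_compute. Qed.

Lemma card_pair (A : Type) (x y : A) : x <> y -> [set x; y] #= `I_2.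
Proof.
move=> ne; have -> : [set x; y] = (fun i => if i is 0%N then x else y) @` `I_2.
  apply/seteqP; split=> [z [->|->]|z [[|[|//]] /= _ <-]]; [exists 0%N|exists 1%N|left|right] => //.
apply: inj_card_eq => i j; rewrite !inE /=.
by case: i j => [|[|//]] [|[|//]] // _ _ e; case: ne.
Qed.

Lemma T_double_cover (K : realType) : double_cover 4 (T_polytope K) (cube K 4).
Proof.
have [pr _] := cube_numbered_presents K; have fs := cube_flag_system K.
have [f [g [cf fg gr gw]]] := @T_covers K _ _ _ _ cube_root pr fs
  (fun k x => walks_closed cube_local_ok k x cube_relators_ok).
exists f; split=> // Psi /(flagP pr fs cube_root)[y ->].
have gE (x : tflag T_table) :
    sval (g x) = walk (step cube_table) 1%positive (T_word (sval x)).
  by have [h {1}<-] := T_wordP x; rewrite gw // walk_tadj.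
have /andP[ok1 ok2] := cube_fibre_okE.
have := all_flagsP ok2 (svalP y).
case e12 : PositiveMap.find => [[x1 x2]|//] /and5P[ne h1 h2 /Pos.eqb_spec e1 /Pos.eqb_spec e2].
pose y1 : tflag T_table := exist (fun x => in_table T_table x) x1 h1.
pose y2 : tflag T_table := exist (fun x => in_table T_table x) x2 h2.
have -> : [set Phi | flag Phi /\ f @` Phi = flagset 4 (cube_flag_face K) y] =
    [set flagset 4 (@T_face K) y1; flagset 4 (@T_face K) y2].
  apply/seteqP; split=> Phi /=.
    move=> [/(flagP (T_presents K) (T_flag_system K) T_root)[x ->]].
    rewrite (image_flagset _ fg) => e.
    have {e} gx : g x = y by apply: (flagset_inj pr fs); rewrite e.
    have := all_flagsP ok1 (svalP x); case: PositiveMap.find => [z|//].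
    move=> /andP[/Pos.eqb_spec ez]; rewrite -ez -gE gx e12.
    by move=> /orP[] /Pos.eqb_spec ex; [left|right]; congr (flagset 4 (@T_face K) _); apply: tflag_eq.
  have gy1 : g y1 = y by apply: tflag_eq; rewrite gE.
  have gy2 : g y2 = y by apply: tflag_eq; rewrite gE.
  have fl := flag_flagset (T_presents K) (T_flag_system K).
  case=> ->; split; try exact: fl.
    by rewrite (image_flagset y1 fg) gy1.
  by rewrite (image_flagset y2 fg) gy2.
apply: card_pair => e.
have : y1 = y2 by apply: (flagset_inj (T_presents K) (T_flag_system K)); rewrite e.
by move/(congr1 sval) => /= e'; move/negP: ne; apply; apply/Pos.eqb_spec.
Qed.

(** * The tables of Roli's cube *)

Section RoliData.
Local Open Scope nat_scope.

(** The signs of the coordinates of the vertices; the vertex number [0] is the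
    base vertex. *)
Definition roli_vertices : seq (seq bool) := Eval vm_compute in
  iter 4 (fun vs => [seq b :: v | b <- [:: false; true], v <- vs]) [:: [::]].

(** The edges, as sorted lists of vertices: two vertices are joined when they
    differ in one coordinate. *)
Definition roli_edges : seq (seq nat) := Eval vm_compute in
  [seq e <- [seq [:: i; k] | i <- iota 0 16, k <- iota 0 16] |
    if e is [:: i; k] then (i < k) && (count (fun bc => bc.1 != bc.2)
      (zip (nth [::] roli_vertices i) (nth [::] roli_vertices k)) == 1)
    else false].

(** The number of the image of a face: [subs] lists the faces by numbers of
    faces of the preceding rank. *)
Definition image_no (subs : seq (seq nat)) (f : nat -> nat) (i : nat) : nat :=
  index (sort leq [seq f k | k <- nth [::] subs i]) subs.

Definition act_vertex (c : code) (i : nat) : nat :=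
  index (vact (nth [::] roli_vertices i) c) roli_vertices.

(** The elements of the group generated by the three generators of Roli's cube,
    with words. *)
Definition Gplus_elements : seq (code * seq nat) := Eval vm_compute in
  group_elements 4 [:: s1; s2; s3] 200.

(** The elements of the group of the base facet. *)
Definition M_elements : seq (code * seq nat) := Eval vm_compute in
  group_elements 4 [:: s1; s2] 200.

(** The successive vertices of the base octagon. *)
Definition octagon_vertex (k : nat) : nat := iter k (act_vertex s1) 0.

Definition octagon_edges : seq nat := Eval vm_compute in
  sort leq [seq index (sort leq [:: octagon_vertex k; octagon_vertex k.+1]) roli_edges
    | k <- iota 0 8].

(** The images of the face [s] under the elements in the list [L]. *)
Definition images (f : code -> nat -> nat) (s : seq nat) (L : seq (code * seq nat)) :
    seq (seq nat) :=
  undup [seq sort leq [seq f cw.1 i | i <- s] | cw <- L].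

Definition act_edge c := image_no roli_edges (act_vertex c).

(** The octagons, as sorted lists of edges; the base octagon has number [0]. *)
Definition roli_octagons : seq (seq nat) := Eval vm_compute in
  images act_edge octagon_edges Gplus_elements.

Definition act_octagon c := image_no roli_octagons (act_edge c).

(** The 2-faces of the base facet. *)
Definition M_octagons : seq nat := Eval vm_compute in
  sort leq (undup [seq act_octagon cw.1 0 | cw <- M_elements]).

(** The facets, as sorted lists of octagons; the base facet has number [0]. *)
Definition roli_facets : seq (seq nat) := Eval vm_compute in
  images act_octagon M_octagons Gplus_elements.

Definition act_facet c := image_no roli_facets (act_octagon c).

(** The numbers of the faces of rank [j - 1] of the [i]-th face of rank [j]. *)
Definition roli_sub (j i : nat) : seq nat :=
  nth [::] (nth [::] [:: [::]; roli_edges; roli_octagons; roli_facets] j) i.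

(** The numbers of faces of each rank. *)
Definition roli_count : seq nat := [:: 16; 32; 12; 4].

(** The action of a signed permutation on the numbers of the [j]-faces. *)
Definition act_face (c : code) (j : nat) : nat -> nat :=
  nth id [:: act_vertex c; act_edge c; act_octagon c; act_facet c] j.

(** The containment of the face number [i] of rank [j] in the face number [l] of
    rank [k], through faces of the intermediate ranks. *)
Fixpoint roli_inc (j i k l : nat) : bool :=
  if j == k then i == l
  else if k is k'.+1 then has (roli_inc j i k') (roli_sub k l) else false.

(** The flags of Roli's cube. *)
Definition roli_table : table := Eval vm_compute in
  mk_flag_table (flatten [seq flatten [seq [seq [:: v; e; o; f] |
      e <- roli_sub 2 o, v <- roli_sub 1 e] | o <- roli_sub 3 f] | f <- iota 0 4]).

Definition roli_classes : seq class_data := Eval vm_compute in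
  mk_classes roli_table [seq xr.1 | xr <- PositiveMap.elements roli_table].

Lemma roli_local_ok : local_ok roli_table. Proof. by vm_compute. Qed.

Lemma roli_conn_ok : conn_ok roli_table roli_classes. Proof. by vm_compute. Qed.

Lemma roli_numbering_ok : numbering_ok roli_table roli_inc roli_count.
Proof. by vm_compute. Qed.

Lemma roli_relators_ok : walks_closed_ok roli_table. Proof. by vm_compute. Qed.

End RoliData.

(** * Groups of signed permutation matrices given by lists of codes *)

Section CodeGroups.
Variables (K : realType) (n : nat).

(** The product of a word in the generators [gens]. *)
Definition eval_code (gens : seq code) (w : seq nat) : code :=
  foldr (fun k c => cmul (nth [::] gens k) c) (idcode n.+1) w.

(** [L] lists the elements of the group generated by [gens], with words: it
    contains the identity and inverses, and is closed under multiplication by the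
    generators. *)
Definition group_ok (gens : seq code) (L : seq (code * seq nat)) : bool :=
  let cs := [seq cw.1 | cw <- L] in
  [&& all (code_wf n.+1) gens, idcode n.+1 \in cs
    & all (fun cw => [&& all (fun k => k < size gens)%N cw.2,
         cw.1 == eval_code gens cw.2, code_wf n.+1 cw.1,
         all (fun g => cmul g cw.1 \in cs) gens
       & has (fun d => cmul cw.1 d == idcode n.+1) cs]) L].

Section Sound.
Variables (gens : seq code) (L : seq (code * seq nat)).
Hypothesis ok : group_ok gens L.

Notation cs := [seq cw.1 | cw <- L].

Let okP c : c \in cs -> exists w, [/\ all (fun k => k < size gens)%N w,
  c = eval_code gens w, code_wf n.+1 c, forall g, g \in gens -> cmul g c \in cs
  & exists2 d, d \in cs & cmul c d = idcode n.+1].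
Proof.
move=> /mapP[cw hcw ->]; have /and3P[_ _ /allP h] := ok.
have /and5P[h1 /eqP h2 h3 /allP h4 /hasP[d hd /eqP h5]] := h _ hcw.
by exists cw.2; split=> //; exists d.
Qed.

Let gens_wf k : (k < size gens)%N -> code_wf n.+1 (nth [::] gens k).
Proof. by move=> hk; have /and3P[/allP h _ _] := ok; apply: h; exact: mem_nth. Qed.

Lemma mxc_ev_cons k w : (k < size gens)%N ->
  mxc K n.+1 (eval_code gens (k :: w)) = mxc K n.+1 (nth [::] gens k) *m mxc K n.+1 (eval_code gens w).
Proof. by move=> hk; rewrite /= mxc_mul // gens_wf. Qed.

Lemma group_code_word c : c \in cs ->
  exists2 w, all (fun k => k < size gens)%N w & c = eval_code gens w.
Proof. by move=> /okP[w [h1 h2 _ _ _]]; exists w. Qed.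

Lemma group_code_wf c : c \in cs -> code_wf n.+1 c.
Proof. by move=> /okP[w []]. Qed.

Lemma group_code1 : idcode n.+1 \in cs. Proof. by have /and3P[] := ok. Qed.

Lemma group_codeM c d : c \in cs -> d \in cs ->
  exists2 e, e \in cs & mxc K n.+1 c *m mxc K n.+1 d = mxc K n.+1 e.
Proof.
move=> /group_code_word[w + ->] hd; elim: w => [_|k w IH].
  by exists d => //=; rewrite mxc_id mul1mx.
move=> /= /andP[hk /IH[e he ee]].
have [_ [_ _ _ hg _]] := okP he.
exists (cmul (nth [::] gens k) e); first by apply: hg; exact: mem_nth.
by rewrite !mxc_mul ?gens_wf // -mulmxA ee.
Qed.

Lemma group_codeV c : c \in cs ->
  exists2 d, d \in cs & (mxc K n.+1 c)^-1 = mxc K n.+1 d.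
Proof.
move=> /okP[_ [_ _ wc _ [d hd e]]]; exists d => //.
by apply: mulmx_inv; rewrite -[LHS]/(_ *m _) -mxc_mul // e mxc_id.
Qed.

Lemma mxc_unit c : c \in cs -> mxc K n.+1 c \is a GRing.unit.
Proof.
move=> /okP[_ [_ _ wc _ [d hd e]]].
have e1 : mxc K n.+1 c *m mxc K n.+1 d = 1%:M by rewrite -mxc_mul // e mxc_id.
by have [] := mulmx1_unit e1.
Qed.

(** The group generated by some signed permutation matrices is the listed one. *)
Lemma gen_codes : gen [set mxc K n.+1 g | g in [set` gens]] =
  [set mxc K n.+1 c | c in [set` cs]].
Proof.
apply: gen_eq.
- split.
  + by move=> _ [c hc <-]; exact: mxc_unit.
  + by exists (idcode n.+1); [exact: group_code1 | exact: mxc_id].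
  + move=> _ _ [c hc <-] [d hd <-]; have [e he ee] := group_codeM hc hd.
    by exists e => //; rewrite -ee.
  + by move=> _ [c hc <-]; have [d hd ->] := group_codeV hc; exists d.
- move=> _ [g hg <-]; have [_ [_ _ _ h _]] := okP group_code1.
  exists (cmul g (idcode n.+1)); first exact: h.
  rewrite mxc_mul ?mxc_id ?mulmx1 //; have /and3P[/allP hw _ _] := ok; exact: hw.
- move=> _ [c /group_code_word[w hw ->] <-]; elim: w hw => [_|k w IH].
    by rewrite /= mxc_id; exact: gen1.
  move=> /= /andP[hk /IH h]; rewrite mxc_mul ?gens_wf //.
  apply: genM h; apply: sub_gen; exists (nth [::] gens k) => //.
  exact: mem_nth.
Qed.

End Sound.
End CodeGroups.

(** ** The groups of Roli's cube *)

Definition roli_gens : seq code := [:: s1; s2; s3].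

Lemma Gplus_group_ok : group_ok 3 roli_gens Gplus_elements.
Proof. by vm_compute. Qed.

Lemma M_group_ok : group_ok 3 [:: s1; s2] M_elements.
Proof. by vm_compute. Qed.

Definition Gplus_codes : seq code := Eval vm_compute in [seq cw.1 | cw <- Gplus_elements].

(** The reflection in the first coordinate. *)
Definition rho : code := [:: (0, true); (1, false); (2, false); (3, false)]%N.

(** Every signed permutation matrix is in the group generated by the matrices
    of the elements of [Gplus_codes] or becomes so when composed with [rho]. *)
Lemma signed_codes_split : all (fun a => all (fun b => all (fun c => all (fun d =>
  if code_wf 4 [:: a; b; c; d] then
    ([:: a; b; c; d] \in Gplus_codes) || (cmul rho [:: a; b; c; d] \in Gplus_codes)
  else true)
  [seq (i, s) | i <- iota 0 4, s <- [:: false; true]])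
  [seq (i, s) | i <- iota 0 4, s <- [:: false; true]])
  [seq (i, s) | i <- iota 0 4, s <- [:: false; true]])
  [seq (i, s) | i <- iota 0 4, s <- [:: false; true]].
Proof. by vm_compute. Qed.

(** ** The rotation group of the cube *)

Section RotationGroup.
Variable K : realType.

Lemma mxc_signed n (c : code) : code_wf n c -> signed_perm_mx (mxc K n c).
Proof.
move=> wc; have /and3P[/eqP sz _ un] := wc.
pose f (i : 'I_n) := Ordinal (code_wf_nth wc (ltn_ord i)).
have finj : injective f.
  move=> i j /(congr1 val) /=; rewrite -!(nth_map _ 0%N) ?sz // => /eqP.
  by rewrite nth_uniq ?size_map ?sz // => /eqP /val_inj.
exists (fun i => (nth (0%N, false) c i).2), (perm finj).
apply/matrixP => i j; rewrite mul_diag_mx !mxE permE.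
by rewrite -mulr_natr; congr (_ * _%:R).
Qed.

Lemma signed_mxc n (A : 'M[K]_n) : signed_perm_mx A ->
  exists2 c, code_wf n c & A = mxc K n c.
Proof.
move=> [e [s ->]]; exists [seq (val (s i), e i) | i <- enum 'I_n].
  apply/and3P; split.
  - by rewrite size_map size_enum_ord.
  - by apply/allP => _ /mapP[i _ ->] /=; exact: ltn_ord.
  - rewrite -map_comp map_inj_uniq ?enum_uniq // => i j /= /val_inj.
    exact: perm_inj.
apply/matrixP => i j; rewrite mul_diag_mx !mxE.
rewrite (nth_map i) ?size_enum_ord // nth_ord_enum /=.
by rewrite -mulr_natr.
Qed.

(** The transposition of two coordinates. *)
Definition swap_code (i j : nat) : code :=
  [seq ((if k == i then j else if k == j then i else k)%N, false) | k <- iota 0 4].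

Lemma det_swap (i j : 'I_4) : i != j -> \det (mxc K 4 (swap_code i j)) = -1.
Proof.
move=> ij; have -> : mxc K 4 (swap_code i j) = tperm_mx i j.
  apply/matrixP => a b; rewrite !mxE (nth_map 0%N) ?size_iota // nth_iota //=.
  rewrite add0n expr0 -[1 *+ _]/(_%:R); congr (nat_of_bool _)%:R.
  case: tpermP => [->|->|/eqP ai /eqP aj]; rewrite ?eqxx //.
    by rewrite -[(nat_of_ord j == i)%N]/(j == i) (eq_sym j) (negbTE ij).
  rewrite -[(nat_of_ord a == i)%N]/(a == i) (negbTE ai).
  by rewrite -[(nat_of_ord a == j)%N]/(a == j) (negbTE aj).
by rewrite det_perm odd_tperm ij expr1.
Qed.

Lemma det_rho : \det (mxc K 4 rho) = -1.
Proof.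
have -> : mxc K 4 rho = diag_mx (\row_i (-1) ^+ (i == ord0)).
  by apply/matrixP => -[[|[|[|[|//]]]] hi] [[|[|[|[|//]]]] hj]; rewrite !mxE /=.
rewrite det_diag (bigD1 ord0) //= big1 => [|i hi]; first by rewrite !mxE eqxx mulr1.
by rewrite !mxE (negbTE hi).
Qed.

(** The generators are products of an even number of reflections. *)
Lemma det_gens g : g \in roli_gens -> \det (mxc K 4 g) = 1.
Proof.
have d01 := @det_swap (inord 0) (inord 1); have d12 := @det_swap (inord 1) (inord 2).
have d23 := @det_swap (inord 2) (inord 3); have d13 := @det_swap (inord 1) (inord 3).
rewrite -!val_eqE /= !inordK // in d01 d12 d23 d13.
have {}d01 := d01 isT; have {}d12 := d12 isT; have {}d23 := d23 isT; have {}d13 := d13 isT.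
have dr := det_rho.
rewrite !inE => /or3P[] /eqP ->.
- have -> : s1 = cmul rho (cmul (swap_code 0 1) (cmul (swap_code 1 2) (swap_code 2 3))).
    by [].
  rewrite !mxc_mul // !det_mulmx d01 d12 d23 dr; ring.
- have -> : s2 = cmul (swap_code 1 3) (swap_code 0 1) by [].
  by rewrite mxc_mul // det_mulmx d01 d13 mulrNN mulr1.
- have -> : s3 = cmul (swap_code 1 2) (swap_code 2 3) by [].
  by rewrite mxc_mul // det_mulmx d12 d23 mulrNN mulr1.
Qed.

Lemma det_Gplus c : c \in Gplus_codes -> \det (mxc K 4 c) = 1.
Proof.
move=> hc; have [w hw ->] := group_code_word Gplus_group_ok hc.
elim: w hw => [_|k w IH]; first by rewrite /= mxc_id det1.
move=> /= /andP[hk /IH h]; rewrite (mxc_ev_cons K Gplus_group_ok) //.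
by rewrite det_mulmx h mulr1 det_gens // mem_nth.
Qed.

(** A signed permutation matrix outside the listed group has determinant [-1],
    since its product with the reflection [rho] belongs to this group. *)
Lemma GplusE : Gplus K = [set mxc K 4 c | c in [set` Gplus_codes]].
Proof.
apply/seteqP; split=> [A [/signed_mxc[c wc ->] dA]|_ [c hc <-]]; last first.
  split; last exact: det_Gplus.
  by apply: mxc_signed; exact: (group_code_wf Gplus_group_ok).
have : (c \in Gplus_codes) || (cmul rho c \in Gplus_codes).
  have /and3P[/eqP sz lt _] := wc.
  case: c sz lt wc {dA} => [|a [|b [|c [|d [|//]]]]] //= _ /and5P[ha hb hc hd _] wc.
  have inl (p : nat * bool) : (p.1 < 4)%N -> p \in [seq (i, s) | i <- iota 0 4, s <- [:: false; true]].
    by case: p => [[|[|[|[|]]]] []].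
  have := signed_codes_split => /allP/(_ _ (inl a ha))/allP/(_ _ (inl b hb)).
  by move=> /allP/(_ _ (inl c hc))/allP/(_ _ (inl d hd)); rewrite wc.
case/orP => [hc|/det_Gplus]; first by exists c.
rewrite mxc_mul // det_mulmx det_rho dA mulr1 => /eqP.
by rewrite -subr_eq0 -opprD oppr_eq0 (_ : 1 + 1 = 2%:R) // pnatr_eq0.
Qed.

End RotationGroup.

(** * The geometric faces of Roli's cube *)

(** The images of the faces under the generators. *)
Definition gen_images : seq (seq (seq nat)) := Eval vm_compute in
  [seq [seq [seq act_face g j i | i <- iota 0 (nth 0%N roli_count j)] | j <- iota 0 4]
    | g <- roli_gens].

(** The number of the image of the [j]-face number [i] under the [k]-th generator. *)
Definition gen_image (k j i : nat) : nat :=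
  nth 0%N (nth [::] (nth [::] gen_images k) j) i.

(** The number of the image of a face under the product of a word. *)
Definition word_image (w : seq nat) (j i : nat) : nat :=
  foldl (fun i k => gen_image k j i) i w.

Section RoliChecks.
Local Open Scope nat_scope.

(** The images of the faces are compatible with the images of their faces of the
    preceding rank and, for vertices, with the action on points. *)
Definition gen_images_ok : bool :=
  all (fun k => all (fun j => all (fun i =>
    let i' := gen_image k j i in
    [&& i' < nth 0%N roli_count j
      & if j is j'.+1 then
          perm_eq (roli_sub j i') [seq gen_image k j' l | l <- roli_sub j i]
        else nth [::] roli_vertices i' ==
          vact (nth [::] roli_vertices i) (nth [::] roli_gens k)])
    (iota 0 (nth 0%N roli_count j))) (iota 0 4)) (iota 0 3).

Lemma gen_images_okE : gen_images_ok. Proof. by vm_compute. Qed.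

(** Distinct faces of the same rank have distinct sets of faces of the preceding
    rank. *)
Definition roli_sub_ok : bool :=
  all (fun j => all (fun i => all (fun k => k < nth 0%N roli_count j) (roli_sub j.+1 i) &&
    all (fun i' => (i == i') || ~~ (all (mem (roli_sub j.+1 i')) (roli_sub j.+1 i)
       && all (mem (roli_sub j.+1 i)) (roli_sub j.+1 i')))
      (iota 0 (nth 0%N roli_count j.+1)))
    (iota 0 (nth 0%N roli_count j.+1))) (iota 0 3).

Lemma roli_sub_okE : roli_sub_ok. Proof. by vm_compute. Qed.

End RoliChecks.

Section Families.
Variable K : realType.

(** The [i]-th face of rank [j], as a family of faces of rank [j - 1]. *)
Fixpoint fam (j : nat) : nat -> nfamily 'rV[K]_4 j :=
  match j return nat -> nfamily 'rV[K]_4 j with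
  | 0%N => fun i => svec K 4 (nth [::] roli_vertices i)
  | j'.+1 => fun i => [set fam j' k | k in [set k | k \in roli_sub j'.+1 i]]
  end.

Lemma roli_sub_lt j i k : (j < 3)%N -> (i < nth 0%N roli_count j.+1)%N ->
  k \in roli_sub j.+1 i -> (k < nth 0%N roli_count j)%N.
Proof.
move=> hj hi; have := allP roli_sub_okE j; rewrite mem_iota => /(_ hj) /allP h.
have := h i; rewrite mem_iota => /(_ hi) /andP[/allP h' _]; exact: h'.
Qed.

Lemma roli_vertex_size i : (i < 16)%N -> size (nth [::] roli_vertices i) = 4%N.
Proof.
have ok : all (fun v => size v == 4) roli_vertices by vm_compute.
by move=> hi; apply/eqP; apply: (allP ok); exact: mem_nth.
Qed.

Lemma fam_inj j i i' : (j < 4)%N -> (i < nth 0%N roli_count j)%N ->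
  (i' < nth 0%N roli_count j)%N -> fam j i = fam j i' -> i = i'.
Proof.
elim: j i i' => [|j IH] i i' hj hi hi' e.
  have un : uniq roli_vertices by vm_compute.
  apply/eqP; rewrite -(nth_uniq [::] _ _ un) //; apply/eqP.
  by apply: svec_inj e; exact: roli_vertex_size.
have := allP roli_sub_okE j; rewrite mem_iota => /(_ hj) /allP h.
have := h i; rewrite mem_iota => /(_ hi) /andP[_ /allP h'].
have := h' i'; rewrite mem_iota => /(_ hi') /orP[/eqP //|/negP no]; case: no.
have j4 : (j < 4)%N by exact: ltnW.
have sub a b : (a < nth 0%N roli_count j.+1)%N -> (b < nth 0%N roli_count j.+1)%N ->
    fam j.+1 a = fam j.+1 b -> all (mem (roli_sub j.+1 b)) (roli_sub j.+1 a).
  move=> ha hb eab; apply/allP => k ka.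
  have : fam j.+1 a (fam j k) by exists k.
  rewrite eab => -[l lb el].
  rewrite -(IH l k j4 _ _ el) //; exact: roli_sub_lt lb || exact: roli_sub_lt ka.
by rewrite (sub i i') //= (sub i' i).
Qed.

Lemma family_map_mul (A B : 'M[K]_4) j (X : nfamily 'rV[K]_4 j) :
  family_map (mx_act (A *m B)) X = family_map (mx_act B) (family_map (mx_act A) X).
Proof.
elim: j X => [x|j IH X]; first by rewrite /= /mx_act mulmxA.
apply/seteqP; split=> [_ [x Xx <-]|_ [_ [x Xx <-] <-]].
  by exists (family_map (mx_act A) x); [exists x | rewrite -IH].
by exists x => //; rewrite IH.
Qed.

Lemma family_map1 j (X : nfamily 'rV[K]_4 j) : family_map (mx_act 1%:M) X = X.
Proof.
elim: j X => [x|j IH X]; first by rewrite /= /mx_act mulmx1.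
by rewrite /= (_ : @family_map _ (mx_act 1%:M) j = id) ?image_id //; apply/funext.
Qed.

Lemma fam_gen k j i : (k < 3)%N -> (j < 4)%N -> (i < nth 0%N roli_count j)%N ->
  (gen_image k j i < nth 0%N roli_count j)%N /\
  family_map (mx_act (mxc K 4 (nth [::] roli_gens k))) (fam j i) =
  fam j (gen_image k j i).
Proof.
move=> hk; elim: j i => [|j IH] i hj hi;
  have := allP gen_images_okE k; rewrite mem_iota => /(_ hk) /allP h.
  have := h 0%N isT => /allP h'; have := h' i; rewrite mem_iota => /(_ hi).
  move=> /andP[h1 /eqP h2]; split=> //.
  rewrite /= /mx_act h2 svec_act //.
  by have /and3P[/allP wf _ _] := Gplus_group_ok; apply: wf; exact: mem_nth.
have := h j.+1; rewrite mem_iota => /(_ hj) /allP h'.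
have := h' i; rewrite mem_iota => /(_ hi) /andP[h1 /perm_mem h2]; split=> //.
apply/seteqP; split=> [_ [_ [l hl <-] <-]|_ [l hl <-]].
  have [_ e] := IH l (ltnW hj) (roli_sub_lt hj hi hl).
  by exists (gen_image k j l); [rewrite /= h2 map_f | exact: esym e].
move: hl; rewrite /= h2 => /mapP[l' hl' ->].
have [_ e] := IH l' (ltnW hj) (roli_sub_lt hj hi hl').
by exists (fam j l'); [exists l' | exact: e].
Qed.

Lemma fam_word w j i : all (fun k => k < 3)%N w -> (j < 4)%N ->
  (i < nth 0%N roli_count j)%N ->
  (word_image w j i < nth 0%N roli_count j)%N /\
  family_map (mx_act (mxc K 4 (eval_code 3 roli_gens w))) (fam j i) = fam j (word_image w j i).
Proof.
elim: w i => [|k w IH] i; first by move=> _ _ hi; rewrite /= mxc_id family_map1.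
move=> /andP[hk hw] hj hi; have [h1 h2] := fam_gen hk hj hi.
rewrite (mxc_ev_cons K Gplus_group_ok) // family_map_mul h2.
by have := IH _ hw hj h1.
Qed.

Lemma fam_eq_mem j (s s' : seq nat) : s =i s' ->
  [set fam j k | k in [set k | k \in s]] = [set fam j k | k in [set k | k \in s']].
Proof. by move=> e; apply/seteqP; split=> _ [k hk <-]; exists k => //; rewrite /= ?e // -e. Qed.

(** ** Identification of the faces *)

Lemma cube_vertex_fam : @cube_vertex K 4 = [set fam 0 i | i in `I_16].
Proof.
apply/seteqP; split=> [x /cube_vertex_svec[v sv ->]|_ [i _ <-]]; last exact: svec_vertex.
have vin : v \in roli_vertices.
  by case: v sv => [|[] [|[] [|[] [|[] [|]]]]].
have iv : (index v roli_vertices < size roli_vertices)%N by rewrite index_mem.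
exists (index v roli_vertices); first exact: iv.
by rewrite /= nth_index.
Qed.

Lemma vpointE : vpoint K = fam 0 0.
Proof. by apply/rowP => -[[|[|[|[|//]]]] hi]; rewrite !mxE. Qed.

(** The numbers of the successive vertices of the base octagon. *)
Definition octagon_no (k : nat) : nat := iter k (gen_image 0 0) 0%N.

Lemma octagon_vertexE k :
  (octagon_no k < 16)%N /\ vpoint K *m sigma1 K ^+ k = fam 0 (octagon_no k).
Proof.
elim: k => [|k [h1 h2]]; first by rewrite expr0 -[1]/(1%:M) mulmx1 vpointE.
have [h3 h4] := fam_gen (k := 0) isT (j := 0) isT h1.
split=> //; rewrite exprSr -[_ * _]/(_ *m _) mulmxA h2 -[RHS]h4.
by rewrite sigma1E.
Qed.

(** The number of the edge with two given vertices. *)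
Definition edge_no (a b : nat) : nat := index (sort leq [:: a; b]) roli_edges.

Lemma fam_edge a b : sort leq [:: a; b] \in roli_edges ->
  fam 1 (edge_no a b) = [set fam 0 a; fam 0 b].
Proof.
move=> h; have e : roli_sub 1 (edge_no a b) = sort leq [:: a; b] by exact: nth_index.
have mE k : (k \in roli_sub 1 (edge_no a b)) = (k == a) || (k == b).
  by rewrite e mem_sort !inE.
apply/seteqP; split=> [_ [k hk <-]|_ [->|->]].
- by move: hk; rewrite /= mE => /orP[] /eqP ->; [left|right].
- by exists a => //; rewrite /= mE eqxx.
- by exists b => //; rewrite /= mE eqxx orbT.
Qed.

Lemma octagonE : octagon K = fam 2 0.
Proof.
have ok1 : all (fun k => sort leq [:: octagon_no k; octagon_no k.+1] \in roli_edges) (iota 0 8).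
  by vm_compute.
have ok2 : perm_eq (roli_sub 2 0)
    [seq edge_no (octagon_no k) (octagon_no k.+1) | k <- iota 0 8] by vm_compute.
have -> : fam 2 0 = [set fam 1 e | e in [set e | e \in
    [seq edge_no (octagon_no k) (octagon_no k.+1) | k <- iota 0 8]]].
  exact: (@fam_eq_mem 1 _ _ (perm_mem ok2)).
have eE k : (k < 8)%N -> [set vpoint K *m sigma1 K ^+ k; vpoint K *m sigma1 K ^+ k.+1] =
    fam 1 (edge_no (octagon_no k) (octagon_no k.+1)).
  move=> hk; have [_ ->] := octagon_vertexE k; have [_ ->] := octagon_vertexE k.+1.
  by apply/esym/fam_edge/(allP ok1); rewrite mem_iota.
apply/seteqP; split=> [_ [k /= hk <-]|_ [e he <-]]; last first.
  have /mapP[k hk ->] := he.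
  by rewrite mem_iota in hk; exists k; [exact: hk | exact: eE].
have ki : k \in iota 0 8 by rewrite mem_iota.
rewrite (eE k hk); exists (edge_no (octagon_no k) (octagon_no k.+1)); last exact: erefl.
exact: (map_f (fun k => edge_no (octagon_no k) (octagon_no k.+1)) ki).
Qed.

(** The base edge joins the base vertex to the point with first coordinate [-1],
    which is the vertex number [8]. *)
Definition base_edge_no : nat := edge_no 0 8.

Lemma M_base_edgeE : M_base_edge K = fam 1 base_edge_no.
Proof.
rewrite /base_edge_no fam_edge; last by vm_compute.
rewrite /M_base_edge vpointE; congr [set _; _].
by rewrite -/(sigmabar1 K) sigmabar1E /fam svec_act.
Qed.

(** The orbit of a face under a listed group, given the numbers [s] of its
    images. *)
Lemma fam_orbit (L : seq (code * seq nat)) (s : seq nat) j i :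
  (j < 4)%N -> (i < nth 0%N roli_count j)%N ->
  all (fun cw => all (fun k => k < 3)%N cw.2 && (cw.1 == eval_code 3 roli_gens cw.2)) L ->
  [seq word_image cw.2 j i | cw <- L] =i s ->
  [set family_map (mx_act g) (fam j i) | g in
    [set mxc K 4 c | c in [set` [seq cw.1 | cw <- L]]]] =
  [set fam j l | l in [set l | l \in s]].
Proof.
move=> hj hi /allP hL es; apply/seteqP; split.
  move=> _ [_ [_ /mapP[cw hcw ->] <-] <-]; have /andP[hw /eqP ->] := hL _ hcw.
  have [_ ->] := fam_word hw hj hi; exists (word_image cw.2 j i) => //.
  by rewrite /= -es; exact: (map_f (fun cw => word_image cw.2 j i)).
move=> _ [l + <-]; rewrite /= -es => /mapP[cw hcw ->].
have /andP[hw /eqP ew] := hL _ hcw; have [_ <-] := fam_word hw hj hi.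
exists (mxc K 4 (eval_code 3 roli_gens cw.2)) => //; exists cw.1; last by rewrite -ew.
exact: (map_f fst).
Qed.

Lemma Gplus_words : all (fun cw => all (fun k => k < 3)%N cw.2 &&
  (cw.1 == eval_code 3 roli_gens cw.2)) Gplus_elements.
Proof. by vm_compute. Qed.

Lemma M_words : all (fun cw => all (fun k => k < 3)%N cw.2 &&
  (cw.1 == eval_code 3 roli_gens cw.2)) M_elements.
Proof. by vm_compute. Qed.

Lemma Gplus_orbit j i : (j < 4)%N -> (i < nth 0%N roli_count j)%N ->
  all (fun l => l \in [seq word_image cw.2 j i | cw <- Gplus_elements])
    (iota 0 (nth 0%N roli_count j)) ->
  [set family_map (mx_act g) (fam j i) | g in Gplus K] =
  [set fam j l | l in `I_(nth 0%N roli_count j)].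
Proof.
move=> hj hi /allP h; rewrite GplusE.
rewrite (fam_orbit (s := iota 0 (nth 0%N roli_count j)) hj hi Gplus_words).
  by apply/seteqP; split=> _ [l hl <-]; exists l => //; move: hl; rewrite /= mem_iota.
move=> l; apply/idP/idP => [/mapP[cw hcw ->]|/h //].
have /andP[hw _] := allP Gplus_words _ hcw.
by rewrite mem_iota; have [] := fam_word hw hj hi.
Qed.

Lemma M_groupE : M_group K = [set mxc K 4 c | c in [set` [seq cw.1 | cw <- M_elements]]].
Proof.
rewrite -(gen_codes K M_group_ok) /M_group sigma1E sigma2E; congr gen.
apply/seteqP; split=> [x [->|->]|_ [g /= + <-]].
- by exists s1.
- by exists s2.
- by rewrite !inE => /orP[] /eqP ->; [left|right].
Qed.

(** The edges of [M], among the edges of Roli's cube. *)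
Definition M_edges : seq nat := Eval vm_compute in
  sort leq (undup [seq word_image cw.2 1 base_edge_no | cw <- M_elements]).

Lemma M_faces1 : M_faces K 1 = [set fam 1 l | l in [set l | l \in M_edges]].
Proof.
rewrite /M_faces M_base_edgeE M_groupE; apply: (fam_orbit _ _ M_words) => //.
have e : [seq word_image cw.2 1 base_edge_no | cw <- M_elements] =i
    sort leq (undup [seq word_image cw.2 1 base_edge_no | cw <- M_elements]).
  by move=> l; rewrite mem_sort mem_undup.
move=> l; rewrite e; have -> // : sort leq (undup [seq word_image cw.2 1 base_edge_no | cw <- M_elements])
  = M_edges by vm_compute.
Qed.

Lemma M_faces2 : M_faces K 2 = fam 3 0.
Proof.
rewrite /M_faces octagonE M_groupE; apply: (fam_orbit _ _ M_words) => //.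
have e : perm_eq (undup [seq word_image cw.2 2 0 | cw <- M_elements]) (roli_sub 3 0).
  by vm_compute.
by move=> l; rewrite -(perm_mem e) mem_undup.
Qed.

(** The edges of the cube are its faces with one free coordinate. *)
Lemma roli_faces1 : roli_faces K 1 = [set fam 1 l | l in `I_32].
Proof.
have edge p i : p = cube_pattern 1 i -> (i < 32)%N ->
    [/\ sort leq [:: index (fill p false) roli_vertices; index (fill p true) roli_vertices]
         \in roli_edges,
      fill p false \in roli_vertices & fill p true \in roli_vertices].
  have ok : all (fun p => [&& sort leq [:: index (fill p false) roli_vertices;
        index (fill p true) roli_vertices] \in roli_edges,
      fill p false \in roli_vertices & fill p true \in roli_vertices])
    (nth [::] cube_patterns 1) by vm_compute.
  by move=> -> hi; apply/and3P; apply: (allP ok); exact: mem_nth.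
have two p : size p = 4%N -> count (pred1 None) p = 1%N ->
    cface (K := K) (n := 4) p = [set svec K 4 (fill p false); svec K 4 (fill p true)].
  move=> sp cp; apply/seteqP; split=> x; last first.
    by case=> ->; exact: fill_cface.
  move=> [/cube_vertex_svec[v sv ->] hv].
  have hv' i b : (i < 4)%N -> nth None p i = Some b -> nth false v i = b.
    move=> hi e; have := hv (Ordinal hi) b e; rewrite mxE; exact: signr_inj.
  suff [->|->] : v = fill p false \/ v = fill p true by [left|right].
  case: p sp cp {hv} hv' => [|a [|b [|c [|d [|]]]]] //= _.
  case: v sv => [|a' [|b' [|c' [|d' [|]]]]] //= _ cp h.
  have {h} [ha hb hc hd] : [/\ forall x, a = Some x -> a' = x,
      forall x, b = Some x -> b' = x, forall x, c = Some x -> c' = x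
      & forall x, d = Some x -> d' = x].
    by split=> y e; [have := h 0%N y isT|have := h 1%N y isT|have := h 2%N y isT|
      have := h 3%N y isT]; apply.
  case: a ha cp => [a|]; case: b hb => [b|]; case: c hc => [c|]; case: d hd => [d|] //= hd hc hb ha _;
    rewrite /fill /= ?(ha _ erefl) ?(hb _ erefl) ?(hc _ erefl) ?(hd _ erefl).
  - by case: (d'); [right|left].
  - by case: (c'); [right|left].
  - by case: (b'); [right|left].
  - by case: (a'); [right|left].
have famE p i : p = cube_pattern 1 i -> (i < 32)%N -> cface (K := K) (n := 4) p =
    fam 1 (edge_no (index (fill p false) roli_vertices) (index (fill p true) roli_vertices)).
  move=> ep hi; have [h1 h2 h3] := edge p i ep hi.
  have [sp cp] := cube_pattern_size (j := 1) isT (i := i) hi; rewrite -ep in sp cp.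
  have f0 v : v \in roli_vertices -> fam 0 (index v roli_vertices) = svec K 4 v.
    by move=> hv; rewrite /fam nth_index.
  by rewrite (two p sp cp) (fam_edge h1) (f0 _ h2) (f0 _ h3).
apply/seteqP; split=> [e [/cube_faceP[->|[p sp ->]]]|_ [l hl <-]].
- by rewrite /face_dim; case: asboolP.
- rewrite cface_dim // => -[cp]; have [i [hi ep]] := cube_pattern_exists sp.
  rewrite cp in hi ep; rewrite (famE p i) //.
  exists (edge_no (index (fill p false) roli_vertices) (index (fill p true) roli_vertices)) => //.
  by rewrite /= -[32%N]/(size roli_edges) index_mem; have [] := edge p i (esym ep) hi.
have ok : all (fun l => l \in [seq edge_no (index (fill p false) roli_vertices)
    (index (fill p true) roli_vertices) | p <- nth [::] cube_patterns 1]) (iota 0 32).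
  by vm_compute.
have := allP ok l; rewrite mem_iota => /(_ hl) /mapP[p hp ->].
have [i hi ep] : exists2 i, (i < 32)%N & p = cube_pattern 1 i.
  have ip : (index p (nth [::] cube_patterns 1) < size (nth [::] cube_patterns 1))%N.
    by rewrite index_mem.
  exists (index p (nth [::] cube_patterns 1)); first exact: ip.
  by rewrite /cube_pattern nth_index.
have [sp cp] := cube_pattern_size (j := 1) isT (i := i) hi; rewrite -ep in sp cp.
rewrite -(famE p i ep hi); split; first exact: cface_face.
have -> := cface_dim K sp; exact: (congr1 Posz cp).
Qed.

Lemma roli_faces_fam j : (j < 4)%N ->
  roli_faces K j = [set fam j l | l in `I_(nth 0%N roli_count j)].
Proof.
case: j => [|[|[|[|//]]]] _.
- exact: cube_vertex_fam.
- exact: roli_faces1.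
- by rewrite /roli_faces octagonE; apply: Gplus_orbit => //; vm_compute.
- rewrite /roli_faces /M_facet M_faces2; apply: Gplus_orbit => //; by vm_compute.
Qed.

End Families.

(** ** Containment of faces *)

Section Containment.
Variable K : realType.

Notation E := 'rV[K]_4.
Notation tagged_fam := (fun j i => Tagged (nfamily E) (fam K j i)).

(** Inversion of containment, with the dependent types kept in equalities. *)
Lemma contained_inv (x z : {j & nfamily E j}) : contained x z ->
  z = x \/ exists j (y : nfamily E j) (Z : nfamily E j.+1),
    [/\ z = Tagged (nfamily E) Z, contained x (Tagged (nfamily E) y)
      & (Z : set _) y].
Proof. by case=> [|j y Z h1 h2]; [left | right; exists j, y, Z]. Qed.

Lemma roli_inc_le j i k l : roli_inc j i k l -> (j <= k)%N.
Proof.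
elim: k l => [|k IH] l /=; first by case: eqP => // ->.
by case: eqP => [->//|_ /hasP[m _ /IH]]; lia.
Qed.

Lemma contained_fam j i k l : (j < 4)%N -> (i < nth 0%N roli_count j)%N ->
  (k < 4)%N -> (l < nth 0%N roli_count k)%N ->
  contained (tagged_fam j i) (tagged_fam k l) <-> roli_inc j i k l.
Proof.
move=> hj hi; elim: k l => [|k IH] l hk hl; split.
- move=> /contained_inv[e|[m [y [Z [e _ _]]]]]; last by have := congr1 tag e.
  have /= e1 := congr1 tag e; subst j.
  by rewrite (fam_inj hj hl hi (@eq_from_Tagged _ _ _ _ _ e)) /= eqxx.
- by rewrite /=; case: (j =P 0%N) => // e /eqP <-; subst j; exact: contained_refl.
- move=> /contained_inv[e|[m [y [Z [e c Zy]]]]].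
    have /= e1 := congr1 tag e; subst j.
    by rewrite (fam_inj hj hl hi (@eq_from_Tagged _ _ _ _ _ e)) /= !eqxx.
  have /= [e1] := congr1 tag e; subst m.
  move: (@eq_from_Tagged _ _ _ _ _ e) Zy => <- [l' /= hl' el].
  have hl'' := roli_sub_lt (j := k) hk hl hl'.
  move: c; rewrite -el => /(IH l' (ltnW hk) hl'') inc.
  rewrite /= ltn_eqF; last exact: (roli_inc_le inc : (j < k.+1)%N).
  by apply/hasP; exists l'.
- rewrite /=; case: (j =P k.+1) => [e /eqP e'|_ /hasP[l' hl' inc]].
    by subst j l; exact: contained_refl.
  have hl'' := roli_sub_lt (j := k) hk hl hl'.
  apply: (contained_mem (y := fam K k l')); last by exists l'.
  by apply/(IH l' (ltnW hk) hl'').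
Qed.

(** The [j]-face number [i] of a complex of families, with a default value when it
    does not belong to the complex. *)
Definition complex_face n (S : forall j, set (nfamily E j)) (j i : nat) :
    family_complex n S :=
  match pselect ((j < n)%N /\ S j (fam K j i)) with
  | left h => Proper (SigSub (mem_set (h : [set x : {j & nfamily E j} |
      (tag x < n)%N /\ S (tag x) (tagged x)] (tagged_fam j i))))
  | right _ => Greatest
  end.

Lemma complex_faceE n S j i : (j < n)%N -> S j (fam K j i) ->
  exists2 F, complex_face n S j i = Proper F & val F = tagged_fam j i.
Proof.
move=> hj hS; rewrite /complex_face; case: pselect => [h|[]//].
by eexists.
Qed.

Lemma complex_face_rk n S j i : (j < n)%N -> S j (fam K j i) ->
  rk (complex_face n S j i) = j%:Z.
Proof. by move=> hj hS; have [F -> /= ->] := complex_faceE hj hS. Qed.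

Lemma complex_face_le n S j i k l : (j < n)%N -> S j (fam K j i) ->
  (k < n)%N -> S k (fam K k l) ->
  fle (complex_face n S j i) (complex_face n S k l) =
  contained (tagged_fam j i) (tagged_fam k l).
Proof.
move=> hj hS hk hS'; have [F -> eF] := complex_faceE hj hS.
by have [G -> eG] := complex_faceE hk hS'; rewrite /= eF eG.
Qed.

Lemma complex_face_eq n S j i l : (j < n)%N -> S j (fam K j i) ->
  fam K j i = fam K j l -> complex_face n S j i = complex_face n S j l.
Proof.
move=> hj hS e; have hS' : S j (fam K j l) by rewrite -e.
have [F -> eF] := complex_faceE hj hS; have [G -> eG] := complex_faceE hj hS'.
by congr Proper; apply: val_inj; rewrite eF eG e.
Qed.

Lemma complex_cover n S (G : family_complex n S) :
  (forall j x, (j < n)%N -> S j x -> exists i, x = fam K j i) ->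
  G = Least \/ G = Greatest \/
  exists j i, [/\ (j < n)%N, S j (fam K j i) & G = complex_face n S j i].
Proof.
move=> hS; case: G => [|F|]; [by left| |by right; left].
right; right; have := set_valP F; case eF : (val F) => [j x] [/= hj Sx].
have [i ex] := hS j x hj Sx; exists j, i; rewrite -ex; split=> //.
rewrite ex in Sx; have [F' -> eF'] := complex_faceE hj Sx.
by congr Proper; apply: val_inj; rewrite /= eF' eF ex.
Qed.

(** The faces of Roli's cube, in terms of its table. *)
Definition roli_flag_face : nat -> tflag roli_table -> roli_cube K :=
  nface (Least : roli_cube K) Greatest (complex_face 4 (roli_faces K)) (t := roli_table).

(** The first flag of the table. *)
Definition roli_root : tflag roli_table :=
  exist (fun x => in_table roli_table x) 1%positive isT.

Lemma roli_inc_refl j i : roli_inc j i j i.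
Proof. by case: j => [|j] /=; rewrite eqxx. Qed.

Lemma roli_numbered_presents : presents 4 roli_flag_face /\
  forall r x y, (r <= 5)%N -> tface r x = tface r y <->
    roli_flag_face r x = roli_flag_face r y.
Proof.
have inS j i : (j < 4)%N -> (i < nth 0%N roli_count j)%N -> roli_faces K j (fam K j i).
  by move=> hj hi; rewrite roli_faces_fam //; exists i.
have cover (G : roli_cube K) : G = Least \/ G = Greatest \/
    exists j i, [/\ (j < 4)%N, (i < nth 0%N roli_count j)%N
      & G = complex_face 4 (roli_faces K) j i].
  case: (@complex_cover _ _ G) => [j x hj|->|[->|[j [i [hj hS ->]]]]].
  - by rewrite roli_faces_fam // => -[i _ <-]; exists i.
  - by left.
  - by right; left.
  - right; right; move: hS; rewrite roli_faces_fam // => -[l hl e].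
    by exists j, l; split=> //; apply: complex_face_eq => //; rewrite -e; exact: inS.
have le j i k l : (j < 4)%N -> (i < nth 0%N roli_count j)%N -> (k < 4)%N ->
    (l < nth 0%N roli_count k)%N ->
    fle (complex_face 4 (roli_faces K) j i) (complex_face 4 (roli_faces K) k l) <->
    roli_inc j i k l.
  move=> hj hi hk hl; rewrite complex_face_le //; try exact: inS.
  exact: contained_fam.
have rkj j i : (j < 4)%N -> (i < nth 0%N roli_count j)%N ->
    rk (complex_face 4 (roli_faces K) j i) = j%:Z.
  by move=> hj hi; rewrite complex_face_rk //; exact: inS.
split; last by move=> r x y; exact: (nface_eq roli_numbering_ok _ _ le).
apply: (numbered_presents roli_numbering_ok cover _ _ rkj _ _ _ _ le _ roli_root) => //.
- by case.
- by case.
- by case.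
- by move=> j i _ _; exact: roli_inc_refl.
Qed.

Lemma roli_flag_system : flag_system 4 roli_flag_face (tadj roli_local_ok).
Proof.
apply: (flag_system_transfer _ (table_flag_system roli_local_ok roli_conn_ok)).
by have [_ h] := roli_numbered_presents.
Qed.

End Containment.

(** * The enantiomorph of Roli's cube *)

Section BarData.
Local Open Scope nat_scope.

(** The generators of the stabilizers that define the enantiomorph. *)
Definition bar_gens (j : nat) : seq code := nth [::]
  [:: [:: b2; s3]; [:: cmul b1 b2; s3]; [:: b1; cmul b2 s3]; [:: b1; b2]] j.

(** The elements of these stabilizers, with words. *)
Definition bar_groups : seq (seq (code * seq nat)) := Eval vm_compute in
  [seq group_elements 4 (bar_gens j) 100 | j <- iota 0 4].

Definition bar_codes (j : nat) : seq code := [seq cw.1 | cw <- nth [::] bar_groups j].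

(** The flag of Roli's cube that differs from the base flag in its vertex; the
    stabilizers of its faces are the groups that define the enantiomorph, whose
    faces can thus be identified with those of Roli's cube. *)
Definition bar_base : seq nat := Eval vm_compute in [:: 8; base_edge_no; 0; 0].

Definition bar_labels : PositiveMap.t (seq nat) := Eval vm_compute in
  mk_map [seq (code_key cw.1, [seq word_image cw.2 j (nth 0 bar_base j) | j <- iota 0 4])
    | cw <- Gplus_elements].

(** The image of the [j]-face of this flag under an element of the group. *)
Definition bar_label (j : nat) (c : code) : nat :=
  nth 0 (odflt [::] (PositiveMap.find (code_key c) bar_labels)) j.

Definition bar_reps : seq (seq code) := Eval vm_compute in
  [seq [seq head [::] [seq c <- Gplus_codes | bar_label j c == i]
    | i <- iota 0 (nth 0 roli_count j)] | j <- iota 0 4].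

(** An element of the coset numbered by [i]. *)
Definition bar_rep (j i : nat) : code := nth [::] (nth [::] bar_reps j) i.

Lemma bar_groups_ok : all (fun j => group_ok 3 (bar_gens j) (nth [::] bar_groups j)) (iota 0 4).
Proof. by vm_compute. Qed.

(** All the elements of the coset of a representative have the same label. *)
Lemma bar_reps_ok : all (fun j => all (fun i =>
    (bar_rep j i \in Gplus_codes) &&
    all (fun h => let c := cmul h (bar_rep j i) in
       if c \in Gplus_codes then bar_label j c == i else false) (bar_codes j))
  (iota 0 (nth 0 roli_count j))) (iota 0 4).
Proof. by vm_compute. Qed.

(** Each element is in the coset of the representative of its label, and the
    labels of an element are numbers of incident faces. *)
Lemma bar_labels_ok : all (fun c => all (fun j =>
    [&& bar_label j c < nth 0 roli_count j,
      has (fun h => cmul h (bar_rep j (bar_label j c)) == c) (bar_codes j)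
    & all (fun k => if j <= k then roli_inc j (bar_label j c) k (bar_label k c) else true)
        (iota 0 4)]) (iota 0 4)) Gplus_codes.
Proof. by vm_compute. Qed.

(** Incident faces are the images of the base faces under a common element. *)
Lemma bar_inc_ok : all (fun j => all (fun k => all (fun i => all (fun l =>
    if roli_inc j i k l then
      has (fun c => if bar_label j c == i then bar_label k c == l else false) Gplus_codes
    else true) (iota 0 (nth 0 roli_count k))) (iota 0 (nth 0 roli_count j)))
  (iota 0 4)) (iota 0 4).
Proof. by vm_compute. Qed.

End BarData.

Section Bar.
Variable K : realType.

Notation stab := (roli_bar_stab K).

Let bar_ok (j : 'I_4) : group_ok 3 (bar_gens j) (nth [::] bar_groups j).
Proof. by apply: (allP bar_groups_ok); rewrite mem_iota; exact: ltn_ord. Qed.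

Lemma bar_stabE (j : 'I_4) : stab j = [set mxc K 4 c | c in [set` bar_codes j]].
Proof.
rewrite -(gen_codes K (bar_ok j)) /roli_bar_stab; congr gen.
have two (a b : code) : [set mxc K 4 a; mxc K 4 b] = [set mxc K 4 g | g in [set` [:: a; b]]].
  apply/seteqP; split=> [x [->|->]|_ [g /= + <-]].
  - by exists a => //; rewrite /= mem_head.
  - by exists b => //; rewrite /= !inE eqxx orbT.
  - by rewrite !inE => /orP[] /eqP ->; [left|right].
have e12 : sigmabar1 K * sigmabar2 K = mxc K 4 (cmul b1 b2).
  by rewrite sigmabar1E sigmabar2E -[_ * _]/(_ *m _) -mxc_mul.
have e23 : sigmabar2 K * sigmabar3 K = mxc K 4 (cmul b2 s3).
  by rewrite /sigmabar3 sigma3E sigmabar2E -[_ * _]/(_ *m _) -mxc_mul.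
case: j => [[|[|[|[|//]]]] hj]; rewrite /= ?e12 ?e23 ?sigmabar1E ?sigmabar2E;
  rewrite /sigmabar3 ?sigma3E; exact: two.
Qed.

Lemma bar_stab_subgroup (j : 'I_4) : subgroup (stab j).
Proof.
rewrite bar_stabE; split.
- by move=> _ [c hc <-]; exact: (mxc_unit K (bar_ok j) hc).
- by exists (idcode 4); [exact: (group_code1 (bar_ok j)) | exact: mxc_id].
- move=> _ _ [c hc <-] [d hd <-].
  by have [e he ee] := group_codeM K (bar_ok j) hc hd; exists e.
- move=> _ [c hc <-]; have [d hd ->] := group_codeV K (bar_ok j) hc.
  by exists d.
Qed.

(** The proper face given by the coset of [a]. *)
Definition bar_proper (j : 'I_4) (a : 'M[K]_4) (ha : Gplus K a) :
    proper_cosets (Gplus K) stab :=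
  SigSub (mem_set (ex_intro2 _ (fun b => Defs.rcoset (stab j) a = Defs.rcoset (stab j) b)
    a ha erefl : [set F : 'I_4 * set 'M[K]_4 |
      exists2 b, Gplus K b & F.2 = Defs.rcoset (stab F.1) b]
      (j, Defs.rcoset (stab j) a))).

(** The [j]-face number [i], with a default value out of range. *)
Definition bar_face (j i : nat) : roli_cube_bar K :=
  if insub j is Some k then
    match pselect (Gplus K (mxc K 4 (bar_rep j i))) with
    | left h => Proper (bar_proper (k : 'I_4) h)
    | right _ => Greatest
    end
  else Greatest.

Lemma bar_rep_in (j i : nat) : (j < 4)%N -> (i < nth 0%N roli_count j)%N ->
  bar_rep j i \in Gplus_codes.
Proof.
move=> hj hi; have := allP bar_reps_ok j; rewrite mem_iota => /(_ hj) /allP h.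
by have := h i; rewrite mem_iota => /(_ hi) /andP[].
Qed.

Lemma bar_faceE (j : 'I_4) i : (i < nth 0%N roli_count j)%N ->
  exists2 F, bar_face j i = Proper F
    & val F = (j, Defs.rcoset (stab j) (mxc K 4 (bar_rep j i))).
Proof.
move=> hi; rewrite /bar_face valK; case: pselect => [h|[]]; first by eexists.
by rewrite GplusE; exists (bar_rep j i) => //; exact: bar_rep_in.
Qed.

Let wfG c : c \in Gplus_codes -> code_wf 4 c.
Proof. exact: (group_code_wf Gplus_group_ok). Qed.

Let labelP c (j : 'I_4) : c \in Gplus_codes ->
  [/\ (bar_label j c < nth 0%N roli_count j)%N,
      exists2 h, h \in bar_codes j & c = cmul h (bar_rep j (bar_label j c))
    & forall k, (j <= k)%N -> (k < 4)%N -> roli_inc j (bar_label j c) k (bar_label k c)].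
Proof.
move=> hc; have /allP h := allP bar_labels_ok _ hc.
have := h j; rewrite mem_iota => /(_ (ltn_ord j)) /and3P[h1 /hasP[g hg /eqP eg] /allP h3].
split=> //; first by exists g.
by move=> k jk k4; have := h3 k; rewrite mem_iota jk; apply.
Qed.

(** The coset of the representative of [i] consists of the elements labelled by
    [i]. *)
Let in_coset (j : 'I_4) i g : (i < nth 0%N roli_count j)%N ->
  Defs.rcoset (stab j) (mxc K 4 (bar_rep j i)) g <->
  exists c, [/\ c \in Gplus_codes, g = mxc K 4 c & bar_label j c = i].
Proof.
move=> hi; rewrite /Defs.rcoset bar_stabE; split.
  move=> [_ [h hh <-] <-]; exists (cmul h (bar_rep j i)).
  have := allP bar_reps_ok j; rewrite mem_iota => /(_ (ltn_ord j)) /allP ok.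
  have := ok i; rewrite mem_iota => /(_ hi) /andP[_ /allP/(_ _ hh)] /=.
  case: ifP => // hc /eqP e; split=> //.
  by rewrite mxc_mul //; exact: (group_code_wf (bar_ok j)).
move=> [c [hc -> ec]]; have [_ [h hh eh] _] := labelP j hc.
exists (mxc K 4 h); first by exists h.
rewrite -[_ * _]/(_ *m _) -mxc_mul; last exact: (group_code_wf (bar_ok j)).
by rewrite -ec -eh.
Qed.

(** The faces of the enantiomorph, in terms of the table of Roli's cube. *)
Definition bar_flag_face : nat -> tflag roli_table -> roli_cube_bar K :=
  nface (Least : roli_cube_bar K) Greatest bar_face (t := roli_table).

Lemma bar_numbered_presents : presents 4 bar_flag_face /\
  forall r x y, (r <= 5)%N -> tface r x = tface r y <->
    bar_flag_face r x = bar_flag_face r y.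
Proof.
have cover (G : roli_cube_bar K) : G = Least \/ G = Greatest \/
    exists j i, [/\ (j < 4)%N, (i < nth 0%N roli_count j)%N & G = bar_face j i].
  case: G => [|F|]; [by left| |by right; left].
  right; right; have [a Ga eF] := set_valP F.
  have [c hc ea] : [set mxc K 4 c | c in [set` Gplus_codes]] a by rewrite -GplusE.
  pose j := (val F).1; have [hl _ _] := labelP j hc.
  exists j, (bar_label j c); split=> //.
  have [F' -> eF'] := bar_faceE hl; congr Proper; apply: val_inj.
  rewrite /= eF' [LHS]surjective_pairing -/j; congr pair.
  rewrite eF -/j -ea; apply: (rcoset_mem_eq (bar_stab_subgroup j)).
    exact: (mxc_unit K Gplus_group_ok hc).
  by apply/(in_coset _ hl); exists c.
have le j i k l : (j < 4)%N -> (i < nth 0%N roli_count j)%N -> (k < 4)%N ->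
    (l < nth 0%N roli_count k)%N ->
    fle (bar_face j i) (bar_face k l) <-> roli_inc j i k l.
  move=> hj hi hk hl.
  have [F -> eF] := bar_faceE (j := Ordinal hj) hi.
  have [G -> eG] := bar_faceE (j := Ordinal hk) hl.
  rewrite /= eF eG /=; split.
    move=> [jk [g [/(in_coset (j := Ordinal hj) _ hi)[c [hc eg lc]]]]].
    move=> /(in_coset (j := Ordinal hk) _ hl)[d [hd eg' ld]].
    have e : c = d by apply: (mxc_inj (K := K) (wfG hc) (wfG hd)); rewrite -eg -eg'.
    subst d; have [_ _ h] := labelP (Ordinal hj) hc.
    by have := h k jk hk; rewrite lc ld.
  move=> inc; split; first exact: roli_inc_le inc.
  have := allP bar_inc_ok j; rewrite mem_iota => /(_ hj) /allP h1.
  have := h1 k; rewrite mem_iota => /(_ hk) /allP h2.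
  have := h2 i; rewrite mem_iota => /(_ hi) /allP h3.
  have := h3 l; rewrite mem_iota inc => /(_ hl) /hasP[c hc].
  case: eqP => // ei /eqP el.
  exists (mxc K 4 c); split.
    by apply/(in_coset (j := Ordinal hj) _ hi); exists c.
  by apply/(in_coset (j := Ordinal hk) _ hl); exists c.
have rkj j i : (j < 4)%N -> (i < nth 0%N roli_count j)%N -> rk (bar_face j i) = j%:Z.
  by move=> hj hi; have [F -> /= ->] := bar_faceE (j := Ordinal hj) hi.
split; last by move=> r x y; exact: (nface_eq roli_numbering_ok _ _ le).
apply: (numbered_presents roli_numbering_ok cover _ _ rkj _ _ _ _ le _ roli_root) => //.
- by case.
- by case.
- by case.
- by move=> j i _ _; exact: roli_inc_refl.
Qed.

Lemma bar_flag_system : flag_system 4 bar_flag_face (tadj roli_local_ok).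
Proof.
apply: (flag_system_transfer _ (table_flag_system roli_local_ok roli_conn_ok)).
by have [_ h] := bar_numbered_presents.
Qed.

End Bar.

(** * Minimal regular covers *)

(** The flag that is 0-adjacent to the first flag of the table. *)
Definition roli_adjacent_root : positive := Eval vm_compute in step roli_table 0 1%positive.

(** Only the identity of [T] fixes two adjacent flags of Roli's cube. *)
Definition faithful_on_roli : bool :=
  all_flags T_table (fun t =>
    if Pos.eqb (walk (step roli_table) 1%positive (T_word t)) 1%positive then
      if Pos.eqb (walk (step roli_table) roli_adjacent_root (T_word t)) roli_adjacent_root then
        Pos.eqb t base_node
      else true
    else true).

Lemma faithful_on_roliE : faithful_on_roli. Proof. by vm_compute. Qed.

(** Both Roli's cube and its enantiomorph are described by [roli_table]; [P] stands
    for either of them. *)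
Section MinimalCover.
Variables (K : realType) (P : ranked_structure).
Variable phi : nat -> tflag roli_table -> P.
Notation ra := (tadj roli_local_ok).
Hypotheses (pr : presents 4 phi) (fs : flag_system 4 phi ra).

Let rel k x : walk ra x (relator k) = x.
Proof. exact: walks_closed roli_relators_ok. Qed.

Lemma T_covers_roli : covers 4 (T_polytope K) P.
Proof.
by have [f [g [cf _ _ _]]] := @T_covers K _ _ _ _ roli_root pr fs rel; exists f.
Qed.

(** A walk that is closed at every flag of [P] is a relation of [T]. *)
Let closed_in_T w : all (fun j => j < 4)%N w ->
  (forall x, walk ra x w = x) -> walk (tadj T_local_ok) T_root w = T_root.
Proof.
move=> w4 closed; set t := walk _ T_root w.
have at_base (x0 : tflag roli_table) : walk (step roli_table) (sval x0) (T_word (sval t)) = sval x0.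
  have [f [g [_ _ _ gw]]] := @T_covers K _ _ _ _ x0 pr fs rel.
  have [tw et] := T_wordP t.
  have := gw _ tw; rewrite et /t (gw _ w4) closed => /(congr1 sval).
  by rewrite walk_tadj.
have := all_flagsP faithful_on_roliE (svalP t).
have /Pos.eqb_spec -> := at_base roli_root.
pose x1 : tflag roli_table := exist (fun x => in_table roli_table x) roli_adjacent_root isT.
have /Pos.eqb_spec -> := at_base x1.
by move=> /Pos.eqb_spec e; apply: tflag_eq.
Qed.

Lemma regular_cover_covers_T Y : regular 4 Y -> covers 4 Y P -> covers 4 Y (T_polytope K).
Proof.
move=> rY [f cf].
have [X [psi [b [prY fsY [y _]]]]] := polytope_flag_system rY.1.
have [g [_ gb]] := flag_map_of_covering prY pr fsY fs isT cf.
have [|h [_ [ch _ _ _]]] :=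
    covers_of_walks prY (T_presents K) fsY (T_flag_system K) (x := y) (x' := T_root).
  move=> w w4 e; apply: closed_in_T => // x.
  have [z <-] := flag_map_surj fs y gb x.
  by rewrite -(flag_map_walk _ gb) // (walks_of_regular prY fsY rY (x := y)).
by exists h.
Qed.

Lemma T_minimal_cover : the_minimal_regular_cover 4 (T_polytope K) P.
Proof.
have rT := T_regular K; split.
  split; first by split; [exact: rT | exact: T_covers_roli].
  move=> Y rY cTY cYP; apply: (regular_covers_antisym _ rY rT) => //.
  exact: regular_cover_covers_T.
move=> Y [[rY cYP] minY]; apply: isomorphic_sym; apply: minY => //.
  exact: regular_cover_covers_T.
exact: T_covers_roli.
Qed.

End MinimalCover.

(** * The facets and the vertex-figures of the polytope of [T] *)

Section SectionModel.
Local Open Scope nat_scope.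

(** The base facet ([d = 0]) is the section between the faces of ranks [-1] and
    [3] of the base flag, and the base vertex-figure ([d = 1]) is the section
    between its faces of ranks [0] and [4]; [section_rank d] is the rank of the
    proper one of these two faces. *)
Definition section_rank (d : nat) : nat := if d is 0 then 3 else 0.

(** The flag [x] of [T] passes through the base facet or the base vertex. *)
Definition in_base_section (d : nat) (x : positive) : bool :=
  face_no T_table (section_rank d) x == face_no T_table (section_rank d) base_node.

(** For each flag of [T] through this face, the table [rows] contains the numbers
    of the three proper faces that it has in the section, followed by the numbers
    of the corresponding faces of a model of the section with numbers in [ids]
    and incidence [inc]; the correspondence is one-to-one and preserves
    incidence. *)
Definition section_ok (d : nat) (rows : table) (ids : nat -> seq nat)
    (inc : nat -> nat -> nat -> nat -> bool) : bool :=
  [&& all_flags T_table (fun x => if in_base_section d x then in_table rows x &&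
        all (fun j => face_no rows j x == face_no T_table (d + j) x) (iota 0 3)
      else true),
    all_flags rows (fun x => in_table T_table x && in_base_section d x),
    all_flags rows (fun x => all_flags rows (fun y => all (fun j =>
      (face_no rows j x == face_no rows j y) ==
      (face_no rows (3 + j) x == face_no rows (3 + j) y)) (iota 0 3))),
    all_flags rows (fun x => all (fun j => (face_no rows (3 + j) x \in ids j) &&
      all (fun k => if j <= k then inc j (face_no rows (3 + j) x) k (face_no rows (3 + k) x)
        else true) (iota 0 3)) (iota 0 3))
  & all (fun j => all (fun k => all (fun i => all (fun l =>
      if inc j i k l then (j <= k) && has_flag rows (3 + j) i (3 + k) l else true)
      (ids k)) (ids j)) (iota 0 3)) (iota 0 3)].

Variables (K : realType) (d : nat) (rows : table) (ids : nat -> seq nat).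
Variable inc : nat -> nat -> nat -> nat -> bool.
Hypotheses (d1 : d <= 1) (ok : section_ok d rows ids inc).

Variables (M : ranked_structure) (L U : M) (psi : nat -> nat -> M).
Hypothesis psi_cover : forall G, G = L \/ G = U \/
  exists j i, [/\ j < 3, i \in ids j & G = psi j i].
Hypotheses (rkL : rk L = (-1)%R) (rkU : rk U = 3%:Z).
Hypothesis rk_psi : forall j i, j < 3 -> i \in ids j -> rk (psi j i) = j%:Z.
Hypotheses (leL : forall G, fle L G) (leU : forall G, fle G U).
Hypotheses (Lmin : forall G, fle G L -> G = L) (Umax : forall G, fle U G -> G = U).
Hypothesis psi_le : forall j i k l, j < 3 -> i \in ids j -> k < 3 ->
  l \in ids k -> fle (psi j i) (psi k l) <-> inc j i k l.
Hypothesis inc_refl : forall j i, j < 3 -> i \in ids j -> inc j i j i.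

(** The base section is isomorphic to any structure with the numbered faces of
    the model. *)
Lemma T_section_isomorphic :
  isomorphic (section (T_face K d T_root) (T_face K (d + 4) T_root)) M.
Proof.
have /and5P[ok1 ok2 ok3 ok4 /allP ok5] := ok.
have lt : d < d + 4 by lia.
have le5 : d + 4 <= 5 by lia.
have [chi [prS chiE]] :=
  section_presents T_root (T_presents K) (T_flag_system K) lt le5.
have e3 : (d + 4 - d).-1 = 3 by lia.
rewrite e3 in prS.
pose Y := {x | T_face K d x = T_face K d T_root /\ T_face K (d + 4) x = T_face K (d + 4) T_root}.
have face_noE j (x y : tflag T_table) : j < 4 ->
    T_face K j.+1 x = T_face K j.+1 y <->
    face_no T_table j (sval x) = face_no T_table j (sval y).
  move=> j4; rewrite -T_face_eq; last by rewrite ltnS ltnW.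
  by rewrite /tface j4.
have inY (y : Y) : in_base_section d (sval (sval y)).
  case: y => x [/= h1 h2]; apply/eqP; rewrite /section_rank.
  move: h1 h2 d1; case: (d) => [|[|//]] h1 h2 _; first exact: (proj1 (face_noE 3 x T_root isT) h2).
  exact: (proj1 (face_noE 0 x T_root isT) h1).
have row (y : Y) : in_table rows (sval (sval y)) /\
    forall j, j < 3 -> face_no rows j (sval (sval y)) = face_no T_table (d + j) (sval (sval y)).
  have := all_flagsP ok1 (svalP (sval y)); rewrite inY => /andP[h1 /allP h2].
  by split=> // j j3; apply/eqP; apply: h2; rewrite mem_iota.
pose no j (y : Y) := face_no rows (3 + j) (sval (sval y)).
have no_ids j y : j < 3 -> no j y \in ids j.
  move=> j3; have [hy _] := row y; have /allP h := all_flagsP ok4 hy.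
  by have := h j; rewrite mem_iota => /(_ j3) /andP[].
have no_inc j k y : j <= k -> k < 3 -> inc j (no j y) k (no k y).
  move=> jk k3; have [hy _] := row y; have /allP h := all_flagsP ok4 hy.
  have := h j; rewrite mem_iota => /(_ (leq_ltn_trans jk k3)) /andP[_ /allP h'].
  by have := h' k; rewrite mem_iota jk => /(_ k3).
have inc_no j i k l : j < 3 -> k < 3 -> i \in ids j -> l \in ids k ->
    inc j i k l -> j <= k /\ exists y, no j y = i /\ no k y = l.
  move=> j3 k3 hi hl h.
  have := ok5 j; rewrite mem_iota => /(_ j3) /allP h2.
  have := h2 k; rewrite mem_iota => /(_ k3) /allP /(_ i hi) /allP /(_ l hl).
  rewrite h => /andP[jk /has_flagP[x [hx ei el]]]; split=> //.
  have /andP[xT xin] := all_flagsP ok2 hx.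
  pose x' : tflag T_table := exist (fun x => in_table T_table x) x xT.
  have xY : T_face K d x' = T_face K d T_root /\ T_face K (d + 4) x' = T_face K (d + 4) T_root.
    move: xin d1; rewrite /in_base_section /section_rank.
    case: (d) => [|[|//]] /eqP xin _; split => //.
      exact: (proj2 (face_noE 3 x' T_root isT) xin).
      exact: (proj2 (face_noE 0 x' T_root isT) xin).
    exact: (pr_top (T_presents K)).
  by exists (exist _ x' xY).
have root_Y : T_face K d T_root = T_face K d T_root /\
    T_face K (d + 4) T_root = T_face K (d + 4) T_root by [].
have prM := gface_presents no_ids no_inc inc_no psi_cover rkL rkU rk_psi leL leU
  Lmin Umax psi_le inc_refl (exist _ T_root root_Y : Y).
have [||f fi _] := isomorphism_of_flag_map prS prM (g := id).
- move=> r x y hr.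
  have chi_eq : chi r x = chi r y <-> T_face K (d + r) (sval x) = T_face K (d + r) (sval y).
    have h4 : r <= d + 4 - d by lia.
    rewrite -!chiE //; split=> [->//|]; exact: val_inj.
  have [r0|[r4|[j j3 rj]]] : r = 0 \/ r = 4 \/ exists2 j, j < 3 & r = j.+1.
    case: (eqVneq r 0) => [->|r0]; first by left.
    case: (eqVneq r 4) => [->|r4]; first by right; left.
    by right; right; exists r.-1; lia.
  + by subst r; split=> _ //; exact: (pr_bot prS).
  + by subst r; split=> _ //; exact: (pr_top prS).
  subst r; rewrite chi_eq addnS face_noE; last by lia.
  rewrite -(gface_eq no_ids no_inc inc_no L U psi_le x y j3).
  have [hx ex] := row x; have [hy ey] := row y; rewrite -!ex // -!ey //.
  have /allP h := all_flagsP (all_flagsP ok3 hx) hy.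
  have := h j; rewrite mem_iota => /(_ j3) /eqP e.
  by rewrite /no; split=> /eqP; [rewrite e | rewrite -e] => /eqP.
- by move=> y; exists y.
- by exists f.
Qed.

End SectionModel.

(** ** The facets are isomorphic to [M], the vertex-figures to the tetrahedron *)

(** In the facet, the flag of [T] reached by a word corresponds to the flag of
    Roli's cube reached by the same word. *)
Definition facet_rows : table := Eval vm_compute in
  mk_map [seq (xr.1, ([::], [seq face_no T_table j xr.1 | j <- iota 0 3] ++
      [seq face_no roli_table j (walk (step roli_table) 1%positive (T_word xr.1))
        | j <- iota 0 3]))
    | xr <- PositiveMap.elements T_table & in_base_section 0 xr.1].

(** The numbers of the faces of [M] among those of Roli's cube. *)
Definition M_ids (j : nat) : seq nat :=
  nth [::] [:: iota 0 16; M_edges; roli_sub 3 0] j.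

Lemma facet_ok : section_ok 0 facet_rows M_ids roli_inc.
Proof. by vm_compute. Qed.

(** A set of vertices of the tetrahedron is coded by a number: it contains the
    vertex [b] when the binary digit [b] is [1]. *)
Definition bit (b i : nat) : bool := odd (i %/ 2 ^ b).

(** The codes of the sets of one, two and three vertices. *)
Definition tetra_ids (j : nat) : seq nat :=
  nth [::] [:: [:: 1; 2; 4; 8]; [:: 3; 5; 6; 9; 10; 12]; [:: 7; 11; 13; 14]]%N j.

(** Inclusion of the coded sets. *)
Definition tetra_inc (j i k l : nat) : bool :=
  all (fun b => if bit b i then bit b l else true) (iota 0 4).

(** A face of the vertex-figure is coded by the set of its vertices, which are
    the edges of [T] through the base vertex. *)
Definition vertex_rows : table := Eval vm_compute in
  let xs := [seq xr.1 | xr <- PositiveMap.elements T_table & in_base_section 1 xr.1] in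
  let es := undup [seq face_no T_table 1 x | x <- xs] in
  let code j i := sumn [seq if has (fun x => (face_no T_table 1 x == nth 0 es b) &&
      (face_no T_table j x == i)) xs then 2 ^ b else 0 | b <- iota 0 4]%N in
  mk_map [seq (x, ([::], [seq face_no T_table j x | j <- iota 1 3] ++
      [seq code j (face_no T_table j x) | j <- iota 1 3])) | x <- xs].

Lemma vertex_figure_ok : section_ok 1 vertex_rows tetra_ids tetra_inc.
Proof. by vm_compute. Qed.

Section Sections.
Variable K : realType.

Lemma M_faces_fam j : (j < 3)%N -> M_faces K j = [set fam K j i | i in [set i | i \in M_ids j]].
Proof.
case: j => [|[|[|//]]] _; last exact: M_faces2.
  rewrite -[LHS]/(@cube_vertex K 4) cube_vertex_fam.
  by apply/seteqP; split=> _ [i hi <-]; exists i => //; move: hi; rewrite /= mem_iota.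
exact: M_faces1.
Qed.

Lemma M_ids_lt j i : (j < 3)%N -> i \in M_ids j -> (i < nth 0%N roli_count j)%N.
Proof.
have ok : all (fun j => all (fun i => i < nth 0%N roli_count j)%N (M_ids j)) (iota 0 3).
  by vm_compute.
move=> hj; have := allP ok j; rewrite mem_iota => /(_ hj) /allP h; exact: h.
Qed.

Lemma base_facet_isomorphic :
  isomorphic (section (T_face K 0 T_root) (T_face K 4 T_root)) (M_polytope K).
Proof.
have inS j i : (j < 3)%N -> i \in M_ids j -> M_faces K j (fam K j i).
  by move=> hj hi; rewrite M_faces_fam //; exists i.
apply: (@T_section_isomorphic K 0 _ _ _ isT facet_ok (M_polytope K) Least Greatest
  (@complex_face K 3 (M_faces K))) => //.
- move=> G; case: (@complex_cover K _ _ G) => [j x hj|->|[->|[j [i [hj hS ->]]]]].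
  + by rewrite M_faces_fam // => -[i _ <-]; exists i.
  + by left.
  + by right; left.
  + right; right; move: (hS); rewrite M_faces_fam // => -[l hl e].
    by exists j, l; split=> //; apply: complex_face_eq.
- by move=> j i hj hi; rewrite complex_face_rk //; exact: inS.
- by case.
- by case.
- by case.
- move=> j i k l hj hi hk hl; rewrite complex_face_le //; try exact: inS.
  by apply: contained_fam; rewrite ?M_ids_lt // ltnW.
- by move=> j i _ _; exact: roli_inc_refl.
Qed.

Definition tetra_face (i : nat) : tetrahedron := [set b : 'I_4 | bit b i]%SET.

Lemma tetra_card i : #|(tetra_face i : {set 'I_4})| =
  (bit 0 i + bit 1 i + bit 2 i + bit 3 i)%N.
Proof.
rewrite -sum1dep_card big_mkcond !big_ord_recr big_ord0 /=.
by case: (bit 0 i); case: (bit 1 i); case: (bit 2 i); case: (bit 3 i).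
Qed.

Lemma base_vertex_figure_isomorphic :
  isomorphic (section (T_face K 1 T_root) (T_face K 5 T_root)) tetrahedron.
Proof.
have sub i l : tetra_inc 0 i 0 l <-> tetra_face i \subset tetra_face l.
  split=> [/allP h|/fintype.subsetP h].
    apply/fintype.subsetP => b; rewrite !inE => hb; have := h b.
    by rewrite mem_iota ltn_ord hb; apply.
  apply/allP => b; rewrite mem_iota /= => hb; case: ifP => // hi.
  by have := h (Ordinal hb); rewrite !inE; apply.
have idsE j i : (j < 3)%N -> i \in tetra_ids j ->
    (bit 0 i + bit 1 i + bit 2 i + bit 3 i)%N = j.+1.
  have ok : all (fun j => all (fun i => bit 0 i + bit 1 i + bit 2 i + bit 3 i == j.+1)%N
      (tetra_ids j)) (iota 0 3) by vm_compute.
  move=> hj hi; have := allP ok j; rewrite mem_iota => /(_ hj) /allP h.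
  by apply/eqP; exact: h.
apply: (@T_section_isomorphic K 1 _ _ _ isT vertex_figure_ok tetrahedron
  (finset.set0 : {set 'I_4}) [set: 'I_4]%SET (fun _ => tetra_face)) => //=.
- move=> S; pose m (b : nat) := (inord b : 'I_4) \in (S : {set 'I_4}).
  have Sm (b : 'I_4) : (b \in (S : {set 'I_4})) = m b by rewrite /m inord_val.
  have SE i : (forall b : 'I_4, m b = bit b i) -> S = tetra_face i.
    by move=> h; apply/finset.setP => b; rewrite inE Sm h.
  have all4 i : m 0%N = bit 0 i -> m 1%N = bit 1 i -> m 2%N = bit 2 i ->
      m 3%N = bit 3 i -> S = tetra_face i.
    by move=> h0 h1 h2 h3; apply: SE => -[[|[|[|[|//]]]] hb].
  pose i := (m 0%N + (m 1%N).*2 + (m 2%N).*2.*2 + (m 3%N).*2.*2.*2)%N.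
  have Si : S = tetra_face i.
    by apply: all4; rewrite /i; case: (m 0%N); case: (m 1%N); case: (m 2%N); case: (m 3%N).
  have : i = 0%N \/ i = 15%N \/ exists j, (j < 3)%N /\ i \in tetra_ids j.
    rewrite /i; case: (m 0%N); case: (m 1%N); case: (m 2%N); case: (m 3%N);
    by (left + (right; left) + (right; right; (exists 0%N + exists 1%N + exists 2%N))).
  case=> [i0|[i15|[j [hj hi]]]].
  + left; rewrite Si i0; apply/finset.setP => b; rewrite !inE.
    by case: b => [[|[|[|[|]]]] hb].
  + right; left; rewrite Si i15; apply/finset.setP => b; rewrite !inE.
    by case: b => [[|[|[|[|]]]] hb].
  + by right; right; exists j, i.
- by rewrite cards0.
- by rewrite cardsT card_ord.
- by move=> j i hj hi; rewrite tetra_card (idsE j) //; lia.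
- by move=> S; exact: finset.sub0set.
- by move=> S; rewrite finset.subset0 => /eqP.
- by move=> S; rewrite finset.subTset => /eqP.
- by move=> j i k l _ _ _ _; rewrite -sub.
- by move=> j i _ _; apply/allP => b _; case: ifP.
Qed.

Lemma T_facets : facets_isomorphic_to 4 (T_polytope K) (M_polytope K).
Proof.
move=> L F Lmin rF; apply: isomorphic_trans base_facet_isomorphic.
have pr := T_presents K; have fs := T_flag_system K.
have [r [x [hr eF]]] := pr_cover pr F.
have er : r = 4%N by move: rF; rewrite eF (pr_rk pr) //; lia.
subst r; have eL : L = T_face K 0 x.
  have [s [y [hs eL]]] := pr_cover pr L.
  have := Lmin (T_face K 0 x); rewrite eL.
  move=> /(pr_le pr) [//|//|]; rewrite leqn0 => /eqP s0 _; subst s.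
  exact: (pr_bot pr).
have [|f fi fE] := isomorphism_of_walks (x := x) (x' := T_root) pr pr fs fs.
  by move=> w w4; split; exact: (T_closed_walks K).
by rewrite eL eF -!fE //; exact: section_isomorphic.
Qed.

Lemma T_vertex_figures : vertex_figures_isomorphic_to (T_polytope K) tetrahedron.
Proof.
move=> F U rF Umax; apply: isomorphic_trans base_vertex_figure_isomorphic.
have pr := T_presents K; have fs := T_flag_system K.
have [r [x [hr eF]]] := pr_cover pr F.
have er : r = 1%N by move: rF; rewrite eF (pr_rk pr) //; lia.
subst r; have eU : U = T_face K 5 x.
  have [s [y [hs eU]]] := pr_cover pr U.
  have := Umax (T_face K 5 x); rewrite eU.
  move=> /(pr_le pr) [//|//|h _]; have s5 : s = 5%N by lia.
  subst s; exact: (pr_top pr).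
have [|f fi fE] := isomorphism_of_walks (x := x) (x' := T_root) pr pr fs fs.
  by move=> w w4; split; exact: (T_closed_walks K).
by rewrite eU eF -!fE //; exact: section_isomorphic.
Qed.

Lemma T_relator_closed k (x : tflag T_table) : walk (tadj T_local_ok) x (relator k) = x.
Proof.
apply: (T_closed_walks K (x := T_root)); first exact: relator_letters.
apply: tflag_eq; rewrite walk_tadj ?relator_letters //.
case: (ltnP k 7) => hk; last by rewrite /relator nth_default.
have ok : all (fun k => Pos.eqb (walk (step T_table) base_node (relator k)) base_node) (iota 0 7).
  by vm_compute.
by apply/Pos.eqb_spec; apply: (allP ok); rewrite mem_iota.
Qed.

(** The relators of [T] that involve only the first three or the last three
    generators live in the facets or in the vertex-figures, so that they hold in
    every polytope with facets [M] and tetrahedral vertex-figures; the other ones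
    are commutations, which hold in every polytope. *)
Lemma T_universal : universal 4 (M_polytope K) tetrahedron (T_polytope K).
Proof.
split; first by split; [exact: T_regular|exact: T_facets|exact: T_vertex_figures].
move=> Q [rQ facQ vfQ].
have [X [psi [b [prQ fsQ [x0 _]]]]] := polytope_flag_system rQ.1.
have pr := T_presents K; have fs := T_flag_system K.
have in_facet k x : all (fun j => (0 <= j) && (j.+1 < 4))%N (relator k) ->
    walk b x (relator k) = x.
  move=> hk; have Lmin : least (psi 0%N x).
    move=> G; have [r [y [hr ->]]] := pr_cover prQ G.
    by rewrite (pr_bot prQ x y); apply: (pr_le_flag prQ).
  have rF : rk (psi 4%N x) = 4%:Z - 1 by rewrite (pr_rk prQ).
  have [h hi] := isomorphic_trans (facQ _ _ Lmin rF) (isomorphic_sym base_facet_isomorphic).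
  apply: (section_walk prQ pr fsQ fs (r0 := 0) (r1 := 4) (x0' := T_root) isT isT hi) => //.
  exact: T_relator_closed.
have in_vf k x : all (fun j => (1 <= j) && (j.+1 < 5))%N (relator k) ->
    walk b x (relator k) = x.
  move=> hk; have Umax : greatest (psi 5%N x).
    move=> G; have [r [y [hr ->]]] := pr_cover prQ G.
    by rewrite (pr_top prQ x y); apply: (pr_le_flag prQ).
  have rF : rk (psi 1%N x) = 0 by rewrite (pr_rk prQ).
  have [h hi] := isomorphic_trans (vfQ _ _ rF Umax) (isomorphic_sym base_vertex_figure_isomorphic).
  apply: (section_walk prQ pr fsQ fs (r0 := 1) (r1 := 5) (x0' := T_root) isT isT hi) => //.
  exact: T_relator_closed.
have commuting i j x : (i.+1 < j)%N -> (j < 4)%N -> walk b x [:: i; j; i; j] = x.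
  move=> ij j4; have i4 : (i < 4)%N by lia.
  by rewrite /= -(adjC fsQ x ij j4) (adjK fsQ) // (adjK fsQ).
have [f [g [cf _ _ _]]] : exists f g, [/\ covering 4 f, on_flags 4 (T_face K) psi f g,
    g T_root = x0 & forall w, all (fun j => j < 4)%N w ->
      g (walk (tadj T_local_ok) T_root w) = walk b x0 w].
  apply: T_covers => // k x.
  case: k => [|[|[|[|[|[|[|k]]]]]]].
  - exact: in_facet.
  - exact: in_facet.
  - exact: in_vf.
  - exact: (commuting 0%N 2%N).
  - exact: (commuting 0%N 3%N).
  - exact: (commuting 1%N 3%N).
  - exact: in_facet.
  - by rewrite /relator nth_default.
by exists f.
Qed.

Lemma T_universal_unique U : universal 4 (M_polytope K) tetrahedron U ->
  isomorphic (T_polytope K) U.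
Proof.
move=> [rU uU]; have [rT uT] := T_universal.
have [regT _ _] := rT; have [regU _ _] := rU.
by apply: regular_covers_antisym regT regU _ _ => //; [exact: uT | exact: uU].
Qed.

End Sections.

(** * The realization of the polytope of [T] *)

(** The signs of the coordinates of the base vertex. *)
Definition base_signs : seq bool :=
  [:: false; false; false; false; true; false; false; false].

(** The signs of the image of the base vertex under an element of [T]. *)
Definition node_signs (x : positive) : seq bool :=
  vact base_signs (odflt [::] (PositiveMap.find x T_code)).

(** The representatives of the vertices of [T], by number. *)
Definition T_points : seq (seq bool) := Eval vm_compute in
  let xs := [seq xr.1 | xr <- PositiveMap.elements T_table] in
  [seq (if [seq x <- xs | face_no T_table 0 x == i] is x :: _ then node_signs x else [::])
    | i <- iota 0 32].

(** For each face of rank [j.+1], flags through this face and through each of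
    its faces of rank [j]. *)
Definition T_subfaces (j c : nat) : seq positive :=
  nth [::] (nth [::] ltac:(let r := eval vm_compute in
    (let xs := [seq xr.1 | xr <- PositiveMap.elements T_table] in
     [seq [seq (let ys := [seq x <- xs | face_no T_table j.+1 x == c] in
                [seq nth 1%positive [seq y <- ys | face_no T_table j y == i] 0
                  | i <- undup [seq face_no T_table j y | y <- ys]])
          | c <- iota 0 (nth 0%N [:: 64; 24; 8]%N j)] | j <- iota 0 3]) in exact r) j) c.

(** The points are distinct, and the image of the base vertex depends only on the
    vertex of the flag. *)
Definition points_ok : bool :=
  uniq T_points && all_flags T_table (fun x =>
    (node_signs x == nth [::] T_points (face_no T_table 0 x)) &&
    (face_no T_table 0 x < 32)%N).

(** The lists of faces are complete, and distinct faces of rank [j.+1] have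
    distinct sets of faces of rank [j]. *)
Definition subfaces_ok (j : nat) : bool :=
  let subs c := [seq face_no T_table j z | z <- T_subfaces j c] in
  let n := nth 0%N [:: 64; 24; 8]%N j in
  all_flags T_table (fun x => let c := face_no T_table j.+1 x in
    (c < n)%N && (face_no T_table j x \in subs c)) &&
  all (fun c => all (fun d => if c == d then true else let s := subs d in
    has (fun z => [&& in_table T_table z, face_no T_table j.+1 z == c
                    & face_no T_table j z \notin s]) (T_subfaces j c)) (iota 0 n)) (iota 0 n).

Lemma points_okE : points_ok. Proof. by vm_compute. Qed.

Lemma subfaces_okE : all subfaces_ok (iota 0 3). Proof. by vm_compute. Qed.

Section Realization.
Variable K : realType.

Lemma T_base_vertexE : T_base_vertex K = svec K 8 base_signs.
Proof.
apply/rowP => -[j hj]; rewrite !mxE /=.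
by case: j hj => [|[|[|[|[|[|[|[|//]]]]]]]] hj /=; rewrite ?expr0 ?expr1.
Qed.

Lemma T_base_vertex_fixed j : j <> ord0 -> T_base_vertex K *m tau K j = T_base_vertex K.
Proof.
move=> j0; rewrite T_base_vertexE tauE svec_act; last by case: j {j0} => [[|[|[|[|]]]]].
case: j j0 => [[|[|[|[|//]]]] hj] j0 //.
by case: j0; exact: val_inj.
Qed.

Lemma T_vertex (x : tflag T_table) :
  T_base_vertex K *m node_mx K (sval x) = svec K 8 (node_signs (sval x)).
Proof.
rewrite T_base_vertexE svec_act //.
have := all_flagsP T_codes_okE (svalP x).
by case: PositiveMap.find => [c|//] /and3P[].
Qed.

Lemma T_point_eq (x y : tflag T_table) :
  node_signs (sval x) = node_signs (sval y) <->
  face_no T_table 0 (sval x) = face_no T_table 0 (sval y).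
Proof.
have /andP[un ok] := points_okE.
have /andP[/eqP ex hx] := all_flagsP ok (svalP x).
have /andP[/eqP ey hy] := all_flagsP ok (svalP y).
rewrite ex ey; split=> [/eqP|->]; last exact: erefl.
by rewrite (nth_uniq [::] (s := T_points) hx hy un) => /eqP.
Qed.

(** The point of [E^8] representing a vertex; its value is irrelevant at the
    other faces. *)
Definition T_point (G : T_polytope K) : 'rV[K]_8 :=
  if pselect (exists x, T_face K 1 x = G) is left h
  then T_base_vertex K *m node_mx K (sval (projT1 (cid h))) else 0.

Lemma T_face_no j (x y : tflag T_table) : (j < 4)%N ->
  T_face K j.+1 x = T_face K j.+1 y <->
  face_no T_table j (sval x) = face_no T_table j (sval y).
Proof.
by move=> j4; rewrite -T_face_eq /tface ?j4 // ltnS ltnW.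
Qed.

Lemma T_pointE x : T_point (T_face K 1 x) = svec K 8 (node_signs (sval x)).
Proof.
rewrite /T_point; case: pselect => [h|[]]; last by exists x.
case: (cid h) => y e.
rewrite T_vertex; congr svec; apply/T_point_eq.
exact: (proj1 (T_face_no y x (isT : (0 < 4)%N)) e).
Qed.

(** A [j]-face below the [(j + 1)]-face of a flag is on some flag through this
    [(j + 1)]-face. *)
Lemma T_below j (G : T_polytope K) y : (j < 4)%N -> rk G = j%:Z ->
  fle G (T_face K j.+2 y) -> exists z, G = T_face K j.+1 z /\ T_face K j.+2 z = T_face K j.+2 y.
Proof.
have pr := T_presents K.
move=> j4 rG; have [r [x [hr eG]]] := pr_cover pr G.
have er : r = j.+1 by move: rG; rewrite eG (pr_rk pr) //; lia.
by subst r; rewrite eG => /(pr_le pr _ _ hr) [//|_ [z [z1 z2]]]; exists z; rewrite z1.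
Qed.

(** The vertices are told apart by their points, and a face of higher rank by
    the set of its faces of the rank below. *)
Lemma T_representative_inj j (x y : tflag T_table) : (j < 4)%N ->
  representative T_point j (T_face K j.+1 x) = representative T_point j (T_face K j.+1 y) ->
  face_no T_table j (sval x) = face_no T_table j (sval y).
Proof.
have pr := T_presents K.
elim: j x y => [|j IH] x y hj.
  rewrite /= !T_pointE => /svec_inj e; apply/T_point_eq; apply: e.
    by rewrite size_map size_iota; have := all_flagsP T_codes_okE (svalP x);
      case: PositiveMap.find => [c|//] /and3P[/and3P[/eqP]].
  by rewrite size_map size_iota; have := all_flagsP T_codes_okE (svalP y);
      case: PositiveMap.find => [c|//] /and3P[/and3P[/eqP]].
move=> e; have j3 : (j < 3)%N by [].
have /andP[ok1 /allP ok2] : subfaces_ok j.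
  by apply: (allP subfaces_okE); rewrite mem_iota.
have /andP[cx _] := all_flagsP ok1 (svalP x).
have /andP[cy _] := all_flagsP ok1 (svalP y).
apply/eqP; apply/negPn/negP => /negbTE ne.
have := ok2 (face_no T_table j.+1 (sval x)); rewrite mem_iota => /(_ cx) /allP.
move=> /(_ (face_no T_table j.+1 (sval y))); rewrite mem_iota => /(_ cy).
rewrite ne => /(has_nthP base_node)[i _].
set z := nth base_node _ i => /and3P[zT /eqP zx /negP]; apply.
pose z' : tflag T_table := exist (fun x => in_table T_table x) z zT.
have mem : (representative T_point j.+1 (T_face K j.+2 x) : set _)
    (representative T_point j (T_face K j.+1 z')).
  exists (T_face K j.+1 z') => //; split; first by rewrite (pr_rk pr) //; lia.
  apply: (proj2 (pr_le pr (r := j.+1) (s := j.+2) z' x _ _)); [lia|lia|].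
  by split=> //; exists z'; split=> //; apply/(T_face_no _ _ hj).
move: mem; rewrite e => -[G [rG leG] eG].
have [u [eu uy]] := T_below (ltnW hj) rG leG; subst G.
have zu := IH _ _ (ltnW hj) eG.
have /andP[_] := all_flagsP ok1 (svalP u).
by rewrite (proj1 (T_face_no _ _ hj) uy) zu.
Qed.

Lemma T_realization : faithful_wythoff_realization (tau K) (T_base_vertex K).
Proof.
split; first exact: T_base_vertex_fixed.
exists T_point; split.
  move=> F a ha eF; have [x ex] := T_elt_surj (exist _ a ha).
  have -> : Proper F = T_face K 1 x.
    rewrite /T_face (cphiE ord0) ex; congr Proper; apply: val_inj.
    by rewrite /= eF.
  by rewrite T_pointE -T_vertex -[node_mx _ _]/(sval (T_elt K x)) ex.
have pr := T_presents K.
have face_at j (F : T_polytope K) : (j < 4)%N -> rk F = j%:Z -> exists x, F = T_face K j.+1 x.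
  move=> j4 rF; have [r [x [hr eF]]] := pr_cover pr F.
  have er : r = j.+1 by move: rF; rewrite eF (pr_rk pr) //; lia.
  by exists x; rewrite eF er.
move=> j F G j4 rF rG; have [x ->] := face_at j F j4 rF; have [y ->] := face_at j G j4 rG.
by move=> /(T_representative_inj j4) e; apply/(T_face_no _ _ j4).
Qed.

End Realization.

Theorem theorem7p1 (K : realType) :
  (* (a) *)
  [/\ string_C_group (tau K),
      T K #= `I_768
    & has_presentation (T K) (tau K) T_relators]
  /\
  (* (b) *)
  [/\ regular 4 (T_polytope K),
      [/\ has_order (tau K (inord 0) * tau K (inord 1)) 8,
          has_order (tau K (inord 1) * tau K (inord 2)) 3
        & has_order (tau K (inord 2) * tau K (inord 3)) 3],
      faithful_wythoff_realization (tau K) (T_base_vertex K),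
      the_minimal_regular_cover 4 (T_polytope K) (roli_cube K) /\
      the_minimal_regular_cover 4 (T_polytope K) (roli_cube_bar K)
    & double_cover 4 (T_polytope K) (cube K 4)]
  /\
  (* (c) *)
  universal 4 (M_polytope K) tetrahedron (T_polytope K) /\
  forall U, universal 4 (M_polytope K) tetrahedron U ->
    isomorphic (T_polytope K) U.
Proof.
have valE k : (k < 4)%N -> val (inord k : 'I_4) = k by exact: inordK.
split; first by split; [exact: T_string_C_group|exact: T_card|exact: T_presentation].
split; last by split; [exact: T_universal|exact: T_universal_unique].
split.
- exact: T_regular.
- by split; apply: T_has_order; rewrite ?valE.
- exact: T_realization.
- have [prR _] := roli_numbered_presents K; have fsR := roli_flag_system K.
  have [prB _] := bar_numbered_presents K; have fsB := bar_flag_system K.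
  split; first exact: (T_minimal_cover K prR fsR).
  exact: (T_minimal_cover K prB fsB).
- exact: T_double_cover.
Qed.
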